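(* Consider a sequence (indexed by the number of states $n$) of Block Markov Chains with fixed parameters $(\alpha,p)$, as defined in the context. Assume $\min_{k\in[K]}\alpha_k>0$, that $p$ is irreducible (with stationary distribution $\pi$), that $I(\alpha,p)>0$, and that $\ell_n=\omega(n)$. Let $\gamma_n,h_n,\rho_n>0$ be deterministic sequences satisfying $$\omega\big(\sqrt{\ell_n/n}\big)=\gamma_n=o(\ell_n/n),\qquad \omega(\ell_n/n)=nh_n^2=o\big((\ell_n/n)^2\big),\qquad \omega\big((\ell_n/n)/h_n^2\big)=\rho_n=o(n).$$ Let $\hat K^{\mathrm{spec}}=|\{i\in[n]:\sigma_i(\hat N_\Gamma)\ge\gamma_n\}|$, and let $\hat K$ be the output of the density-based clustering algorithm described in the context, run on $\hat N_\Gamma$ with $r=\hat K^{\mathrm{spec}}$ and thresholds $h_n,\rho_n$. Then $\mathbb P[\hat K=K]\to1$ as $n\to\infty$.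
   Context: Notation: $[m]=\{1,\dots,m\}$; for deterministic positive sequences, $a_n=\omega(b_n)$ means $a_n/b_n\to\infty$ and $a_n=o(b_n)$ means $a_n/b_n\to0$; ''$\omega(b_n)=a_n=o(c_n)$'' means $a_n=\omega(b_n)$ and $a_n=o(c_n)$. $\sigma_1(A)\ge\sigma_2(A)\ge\dots$ denote the singular values of a matrix $A$. Block Markov Chain (BMC): fix $K\in\mathbb N_{\ge1}$, a stochastic matrix $p=(p_{i,j})_{i,j\in[K]}$ and $\alpha=(\alpha_k)_{k\in[K]}$ with $\sum_k\alpha_k=1$. For each (sufficiently large) $n$ there is a surjective map $\sigma:[n]\to[K]$ (depending on $n$) with clusters $\mathcal V_k=\sigma^{-1}(k)$ satisfying $|\mathcal V_k|/n\to\alpha_k$ as $n\to\infty$. The BMC is the Markov chain $(X_t)_{t\ge0}$ on $[n]$ with transition matrix $P_{x,y}=p_{\sigma(x),\sigma(y)}/|\mathcal V_{\sigma(y)}|$. If $p$ is irreducible with stationary distribution $\pi$, then $\Pi_x=\pi_{\sigma(x)}/|\mathcal V_{\sigma(x)}|$ is the unique stationary distribution of $P$. One observes a trajectory $X_0,\dots,X_{\ell_n}$ with $X_0\sim\Pi$, where $(\ell_n)$ is a deterministic sequence of positive integers. Information quantity: $$I(\alpha,p)=\min_{i,j\in[K],\,i\ne j}\Big\{\sum_{k=1}^K\frac1{\alpha_i}\Big(\pi_ip_{i,k}\ln\frac{p_{i,k}}{p_{j,k}}+\pi_kp_{k,i}\ln\frac{p_{k,i}\alpha_j}{p_{k,j}\alpha_i}\Big)+\Big(\frac{\pi_j}{\alpha_j}-\frac{\pi_i}{\alpha_i}\Big)\Big\},$$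 with the conventions $0\ln(\cdot)=0$ (including $0\ln\frac00=0$) and $a\ln\frac a0=+\infty$ for $a>0$ (and $I=+\infty$ if $K=1$). Trimmed count matrix: $\hat N_{x,y}=\sum_{t=0}^{\ell_n-1}\mathbf 1\{X_t=x,X_{t+1}=y\}$ for $x,y\in[n]$. $\Gamma\subseteq[n]$ is the set of the $\lfloor n\exp(-\ell_n/n)\rfloor$ most visited states, i.e. those $y$ with the largest column sums $\sum_x\hat N_{x,y}$ (ties broken arbitrarily), and $(\hat N_\Gamma)_{x,y}=\hat N_{x,y}\mathbf 1\{x\notin\Gamma,\,y\notin\Gamma\}$. Density-based clustering algorithm (input $\hat N_\Gamma$, $r$, $h_n$, $\rho_n$): let $\hat N_\Gamma=U\Sigma V^{\top}$ be a singular value decomposition with $\Sigma=\mathrm{diag}(\sigma_1,\dots,\sigma_n)$, $\sigma_1\ge\dots\ge\sigma_n$, and form the $n\times2r$ matrix $\hat X=[\sigma_1U_{\cdot,1},\dots,\sigma_rU_{\cdot,r},\sigma_1V_{\cdot,1},\dots,\sigma_rV_{\cdot,r}]$. For $x\in[n]$ let $\mathcal N_x=\{y\in[n]:\|\hat X_{x,\cdot}-\hat X_{y,\cdot}\|_2\le h_n\}$. Initialize $\hat{\mathcal V}_0=[n]$, $k=0$. While $|\hat{\mathcal V}_k|\ge\rho_n$: increase $k$ by 1, choose $z_k^*\in\arg\max_{x\in[n]}|\mathcal N_x\setminus\bigcup_{l=1}^{k-1}\hat{\mathcal V}_l|$ (ties broken arbitrarily), and set $\hat{\mathcal V}_k=\mathcal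 N_{z_k^*}\setminus\bigcup_{l=1}^{k-1}\hat{\mathcal V}_l$. When the loop stops, output $\hat K=k-1$, the centers $z_1^*,\dots,z_{\hat K}^*$ and the sets $\hat{\mathcal V}_1,\dots,\hat{\mathcal V}_{\hat K}$. *)

(* Defs.v *)
From HB Require Import structures.
From mathcomp Require Import all_boot all_order all_algebra.
From mathcomp Require Import all_classical all_reals all_analysis.

Set Implicit Arguments.
Unset Strict Implicit.
Unset Printing Implicit Defensive.

Import Order.TTheory GRing.Theory Num.Theory.
Import numFieldNormedType.Exports.

Local Open Scope ring_scope.

(** * Asymptotic comparison of sequences *)

Section Asymptotics.
Context {R : realType}.
Implicit Types a b : nat -> R.

Definition is_omega a b : Prop := (a n / b n @[n --> \oo] --> +oo)%classic.

Definition is_o a b : Prop := (a n / b n @[n --> \oo] --> (0 : R))%classic.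

End Asymptotics.

(** * Block Markov chains *)

Section BlockMarkovChain.
Context {R : realType}.

Definition stochastic (m : nat) (P : 'M[R]_m) : Prop :=
  (forall i j, 0 <= P i j) /\ (forall i, \sum_j P i j = 1).

Definition irreducible_mx (m : nat) (P : 'M[R]_m) : Prop :=
  forall i j, exists t : nat, 0 < (P ^+ t) i j.

Definition stationary_distribution (m : nat) (P : 'M[R]_m) (mu : 'rV[R]_m) :
    Prop :=
  [/\ forall i, 0 <= mu 0 i, \sum_i mu 0 i = 1 & mu *m P = mu].

Definition cluster_set (K n : nat) (sigma : 'I_n -> 'I_K) (k : 'I_K) : {set 'I_n} :=
  [set x | sigma x == k]%SET.

Definition bmc_transition (K n : nat) (sigma : 'I_n -> 'I_K) (p : 'M[R]_K) :
    'M[R]_n :=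
  \matrix_(x, y) (p (sigma x) (sigma y) / #|cluster_set sigma (sigma y)|%:R).

Definition bmc_stationary (K n : nat) (sigma : 'I_n -> 'I_K) (pi : 'rV[R]_K) :
    'rV[R]_n :=
  \row_x (pi 0 (sigma x) / #|cluster_set sigma (sigma x)|%:R).

(** The state space [n] is embedded in [nat] as {0, ..., n-1}: a probability
    space is nonempty, so there is no ['I_0]-valued random variable, and families
    indexed by all [n] would not exist. The law below forces the chain to stay
    in {0, ..., n-1} almost surely. *)
Definition is_markov_chain (d : measure_display) (Omega : measurableType d)
    (Pr : probability Omega R) (n : nat) (mu : 'rV[R]_n) (P : 'M[R]_n)
    (X : nat -> Omega -> nat) : Prop :=
  forall (m : nat) (x : nat -> 'I_n),
    Pr [set w | forall t : nat, (t <= m)%N -> X t w = x t]%classic =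
    (mu 0 (x 0%N) * \prod_(t < m) P (x t) (x t.+1))%:E.

(** [a * ln (b / c)] with the conventions [0 * ln _ = 0] (whatever the
    argument) and [a * ln (b / 0) = +oo] for [a > 0]. *)
Definition mul_ln_ratio (a b c : R) : \bar R :=
  if a == 0 then 0%E else if c == 0 then +oo%E else (a * ln (b / c))%:E.

Definition information_term (K : nat) (alpha pi : 'rV[R]_K) (p : 'M[R]_K)
    (i j : 'I_K) : \bar R :=
  (\sum_(k < K) ((alpha 0 i)^-1)%R%:E *
      (mul_ln_ratio (pi 0 i * p i k)%R (p i k) (p j k) +
       mul_ln_ratio (pi 0 k * p k i)%R
         (p k i * alpha 0 j)%R (p k j * alpha 0 i)%R)
   + (pi 0 j / alpha 0 j - pi 0 i / alpha 0 i)%R%:E)%E.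

Definition information (K : nat) (alpha pi : 'rV[R]_K) (p : 'M[R]_K) :
    \bar R :=
  \big[Order.min/+oo%E]_(ij : 'I_K * 'I_K | ij.1 != ij.2)
    information_term alpha pi p ij.1 ij.2.

End BlockMarkovChain.

(** * Trimmed count matrix *)

Section Counts.
Context {R : realType}.

Definition count_mx (n l : nat) (x : nat -> nat) : 'M[R]_n :=
  \matrix_(i, j) (\sum_(t < l) ((x t == i) && (x t.+1 == j)))%N%:R.

(** [G] is a set of the floor (n exp (-l/n)) states with the largest column sums;
    all sets compatible with some tie-breaking are allowed. *)
Definition most_visited (n l : nat) (N : 'M[R]_n) (G : {set 'I_n}) : Prop :=
  #|G| = Num.truncn (n%:R * expR (- (l%:R / n%:R)) : R) /\
  forall y z : 'I_n, y \in G -> z \notin G ->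
    \sum_x N x z <= \sum_x N x y.

Definition trim_mx (n : nat) (N : 'M[R]_n) (G : {set 'I_n}) : 'M[R]_n :=
  \matrix_(x, y) (if (x \notin G) && (y \notin G) then N x y else 0).

End Counts.

(** * Density-based clustering *)

Section Clustering.
Context {R : realType}.

Definition is_svd (n : nat) (A U : 'M[R]_n) (s : 'rV[R]_n) (V : 'M[R]_n) :
    Prop :=
  [/\ U^T *m U = 1%:M, V^T *m V = 1%:M,
      forall i, 0 <= s 0 i,
      forall i j : 'I_n, (i <= j)%N -> s 0 j <= s 0 i &
      A = U *m diag_mx s *m V^T].

Definition spectral_rank (n : nat) (s : 'rV[R]_n) (gamma : R) : nat :=
  #|[set i | gamma <= s 0 i]%SET|.

(** For [r <= n], right multiplication by [pid_mx r : 'M_(n, r)] keeps the first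
    [r] columns. *)
Definition svd_embedding (n r : nat) (U : 'M[R]_n) (s : 'rV[R]_n)
    (V : 'M[R]_n) : 'M[R]_(n, r + r) :=
  row_mx (U *m diag_mx s *m pid_mx r) (V *m diag_mx s *m pid_mx r).

(** The norm [`|v|] of MathComp-Analysis on matrices is the sup norm. *)
Definition l2norm (m : nat) (v : 'rV[R]_m) : R :=
  Num.sqrt (\sum_j v 0 j ^+ 2).

Definition neighborhood (n m : nat) (Xhat : 'M[R]_(n, m)) (h : R) (x : 'I_n) :
    {set 'I_n} :=
  [set y | l2norm (row x Xhat - row y Xhat) <= h]%SET.

(** A state of the loop after [k] iterations is the sequence
    [:: (z_1, V_1); ...; (z_k, V_k)] of the centers and sets found so far. *)
Definition covered (n : nat) (run : seq ('I_n * {set 'I_n})) : {set 'I_n} :=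
  (\bigcup_(c <- run) c.2)%SET.

Definition current (n : nat) (run : seq ('I_n * {set 'I_n})) : {set 'I_n} :=
  last [set: 'I_n]%SET (map snd run).

Inductive clustering_run (n : nat) (nbhd : 'I_n -> {set 'I_n}) (rho : R) :
    seq ('I_n * {set 'I_n}) -> Prop :=
| run_init : clustering_run nbhd rho [::]
| run_step run z :
    clustering_run nbhd rho run ->
    rho <= #|current run|%:R ->
    (forall x, (#|nbhd x :\: covered run| <= #|nbhd z :\: covered run|)%N) ->
    clustering_run nbhd rho (rcons run (z, nbhd z :\: covered run)).

(** [m] is the number [k - 1] of clusters returned by some execution of the loop,
    [k] being the number of iterations performed. *)
Definition clustering_output (n : nat) (nbhd : 'I_n -> {set 'I_n}) (rho : R)
    (m : nat) : Prop :=
  exists run, [/\ clustering_run nbhd rho run,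
    #|current run|%:R < rho & m = (size run).-1].

(** [m] is a possible value of the estimator computed from the trajectory [x],
    for some way of breaking the ties and some choice of singular value
    decomposition. *)
Definition estimated_clusters (n l : nat) (gamma h rho : R) (x : nat -> nat)
    (m : nat) : Prop :=
  exists (G : {set 'I_n}) (U : 'M[R]_n) (s : 'rV[R]_n) (V : 'M[R]_n),
    let N := count_mx n l x in
    let r := spectral_rank s gamma in
    [/\ most_visited l N G, is_svd (trim_mx N G) U s V &
        clustering_output (neighborhood (svd_embedding r U s V) h) rho m].

End Clustering.

(* Main.v *)
Require Import Defs.
From HB Require Import structures.
From mathcomp Require Import all_boot all_order all_algebra.
From mathcomp Require Import all_classical all_reals all_analysis.
From mathcomp Require Import zify ring lra.

Set Implicit Arguments.
Unset Strict Implicit.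
Unset Printing Implicit Defensive.

Import Order.TTheory GRing.Theory Num.Theory.
Import numFieldNormedType.Exports.

Local Open Scope classical_set_scope.
Local Open Scope ring_scope.

(** Given the sequence of clusters visited, the states are independent and uniform
    on their clusters. So the reference matrix is not the mean of the count matrix
    [N] but its average over blocks, which has rank at most [K]; the light pairs of
    the Feige-Ofek argument then concentrate by a moment generating function bound
    on the transitions of even and of odd index, and only a law of large numbers for
    the [K]-state chain (from the Poisson equation, so periodicity is harmless) is
    needed to compare the block averages with [pi_i p_ij]. Trimming the most visited
    states bounds all degrees by [O(l / n)], whence the heavy pairs are controlled by
    the discrepancy property, and [N_Gamma] is within [O(sqrt (l / n))] of the block
    average in operator norm.

    Let [M] be the block average. Since [gamma] exceeds the perturbation, at most [K]
    singular values are kept, and the rows of the embedding are close in mean square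
    to those of [(M V_r, M^T U_r)], which are constant on clusters. The directions
    discarded carry [M] only up to [O(gamma) = o(l / n)], so distinct clusters stay
    apart, [I > 0] making the rows and columns of [pi_i p_ij / alpha_i] differ.
    Hence all but [o(rho)] states lie within [h / 2] of the centre of their cluster,
    and the greedy loop finds the clusters one by one. *)

(** The natural scale is [D] with [D ^+ 2 = l / n], the mean degree, and [kappa] bounds all ratios
    of [n] to a cluster size. The perturbation is at most [op_const kappa * D], so the asymptotic
    assumptions enter only as finitely many inequalities that hold for large [n]. Randomness enters
    only through [good_counts]: on such a trajectory the conclusion is deterministic and covers
    every breaking of ties and every singular value decomposition, so neither choice needs a
    probabilistic description. Probabilities are finite sums over paths, computed by recursion, and
    meet the given probability space once, through cylinders. Centring at the block average pays off
    because averaging is self-adjoint: a linear form in the centred counts is a path sum of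
    coefficients with sum 0 on each block, so the linear term of the exponential disappears.
    Trimming answers the sparse regime: when [l / n] grows slower than [ln n], a few states are
    visited far more often than average, and their rows and columns alone could spoil a norm bound
    of order [D]. *)

(** * The greedy loop when most states are well placed *)

Section GreedyClustering.
Context {R : realType}.

(** Elements outside [Gd] may serve as centres and may fall into any set. A cluster once found keeps
    at most [#|~: Gd|] good elements: by maximality the set found is at least as large as the good
    part of the cluster, and at most [#|~: Gd|] of its elements lie outside that part. So a bound
    [rho] above twice this number tells the first [K] sets from the next one, and the loop makes
    [K.+1] iterations. *)
Lemma clustering_output_good (n K : nat) (sigma : 'I_n -> 'I_K)
    (nbhd : 'I_n -> {set 'I_n}) (rho : R) (Gd : {set 'I_n}) (m : nat) :
  (forall x y, x \in Gd -> y \in Gd -> sigma x = sigma y -> y \in nbhd x) ->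
  (forall z x y, x \in Gd -> y \in Gd -> x \in nbhd z -> y \in nbhd z ->
     sigma x = sigma y) ->
  (#|~: Gd|.*2%:R < rho) ->
  (forall a, rho <= #|cluster_set sigma a :&: Gd|%:R) ->
  (0 < K)%N ->
  clustering_output nbhd rho m -> m = K.
Proof.
move=> near1 near2 bad_lt rho_le K0 [run [hrun hlast ->]].
pose Bd := ~: Gd; pose VG a := cluster_set sigma a :&: Gd.
have bad2 s : rho <= #|s : {set 'I_n}|%:R -> (#|Bd|.*2 < #|s|)%N.
  by move=> hs; rewrite -(ltr_nat R); exact: lt_le_trans bad_lt hs.
have VGne a : exists x, x \in VG a.
  apply/card_gt0P; have := bad2 _ (rho_le a); rewrite -/(VG a); lia.
(* [cs] lists the clusters already found. *)
pose inv (r : seq ('I_n * {set 'I_n})) (cs : seq 'I_K) :=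
  [/\ uniq cs, size cs = size r, rho <= #|current r|%:R,
      forall a, a \notin cs -> VG a :&: covered r = finset.set0 &
      forall a, a \in cs -> (#|VG a :\: covered r| <= #|Bd|)%N].
(* The second alternative is the state after [K.+1] iterations: the last set is below [rho], which
   forbids another iteration. *)
suff: (exists cs, inv run cs) \/ (size run = K.+1 /\ #|current run|%:R < rho).
  case=> [[cs [_ _ h _ _]]|[-> _ //]].
  by move: (lt_le_trans hlast h); rewrite ltxx.
elim: hrun {hlast} => [|r z _ IH hr zmax].
  left; exists [::]; split=> //.
    apply: le_trans (rho_le (Ordinal K0)) _; rewrite ler_nat.
    by apply: subset_leq_card; apply/fintype.subsetP => x; rewrite inE.
  by move=> a _; rewrite /covered big_nil finset.setI0.
case: IH => [[cs [ucs scs _ hnew hold]]|[_ h]]; last first.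
  by move: (lt_le_trans h hr); rewrite ltxx.
set cov := covered r in zmax hnew hold *.
set W := nbhd z :\: cov.
have covS : covered (rcons r (z, W)) = cov :|: W.
  by rewrite /covered -cats1 big_cat big_seq1.
have curS : current (rcons r (z, W)) = W by rewrite /current map_rcons last_rcons.
have Wsub c x : x \in W -> x \in VG c -> W :\: Bd \subset VG c :\: cov.
  move=> xW xV; apply/fintype.subsetP => y; rewrite !inE negbK => /andP[yG /andP[ycov yz]].
  rewrite ycov yG andbT /=; move: xW xV; rewrite !inE => /andP[_ xz] /andP[/eqP <- xG].
  by rewrite (near2 z x y).
have Wcard : (#|W| <= #|Bd| + #|W :\: Bd|)%N.
  rewrite -(cardsID Bd W) leq_add2r; exact: subset_leq_card (finset.subsetIr _ _).
have [call|] := boolP [forall a, a \in cs].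
  right; have sz : size cs = K.
    rewrite -(card_uniqP ucs) -[RHS]card_ord; apply: eq_card => a.
    by rewrite (forallP call).
  rewrite size_rcons -scs sz curS; split=> //.
  apply: le_lt_trans bad_lt; rewrite ler_nat -addnn; apply: leq_trans Wcard _.
  rewrite leq_add2l; have [->|[x]] := set_0Vmem (W :\: Bd); first by rewrite cards0.
  rewrite !inE negbK => /andP[xG xW].
  have xV : x \in VG (sigma x) by rewrite !inE eqxx.
  apply: leq_trans (subset_leq_card (Wsub _ x _ xV)) _; first by rewrite inE.
  exact/hold/(forallP call).
rewrite negb_forall => /existsP[a acs]; left.
have big b : b \notin cs -> (#|VG b| <= #|W|)%N.
  move=> bcs; have [x xV] := VGne b.
  apply: leq_trans (zmax x); apply: subset_leq_card; apply/fintype.subsetP => y yV.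
  rewrite inE; apply/andP; split.
    apply/negP => yc; have : y \in VG b :&: cov by rewrite inE yV.
    by rewrite hnew // inE.
  move: xV yV; rewrite !inE => /andP[/eqP sx xG] /andP[/eqP sy yG].
  by apply: near1; rewrite // sx sy.
have rhoW : rho <= #|W|%:R by apply: le_trans (rho_le a) _; rewrite ler_nat big.
have [x xW] : exists x, x \in W :\: Bd.
  by apply/card_gt0P; have := bad2 _ rhoW; lia.
move: xW; rewrite !inE negbK => /andP[xG xW].
have xWW : x \in W by rewrite inE.
set c := sigma x; have xV : x \in VG c by rewrite !inE eqxx.
have WV := subset_leq_card (Wsub c x xWW xV).
(* Had [c] been found before, [W] would consist of at most [#|Bd|] bad elements and at most [#|Bd|]
   leftovers of [c], too few for [rho]. *)
have ccs : c \notin cs.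
  apply/negP => /hold hc; have := bad2 _ rhoW; rewrite ltnNge -addnn => /negP; apply.
  by apply: leq_trans Wcard _; rewrite leq_add2l; exact: leq_trans WV hc.
exists (c :: cs); split; rewrite /= ?ccs ?curS ?size_rcons ?scs //.
  move=> b; rewrite inE negb_or => /andP[bc bcs]; rewrite covS finset.setIUr hnew //.
  rewrite finset.set0U; apply/setP => y; rewrite finset.in_set0.
  apply/negbTE/negP; rewrite finset.in_setI => /andP[yV yW].
  move: (yV); rewrite !inE => /andP[/eqP sy yG].
  have : y \in VG c :\: cov.
    by apply: (fintype.subsetP (Wsub c x xWW xV)); rewrite finset.in_setD yW inE negbK yG.
  by rewrite !inE => /and3P[_ /eqP syc _]; rewrite -sy syc eqxx in bc.
move=> b; rewrite inE covS => /orP[/eqP->|bcs]; last first.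
  by apply: leq_trans (hold b bcs); apply: subset_leq_card; rewrite finset.setDS // finset.subsetUl.
have h1 : (#|VG c :\: (cov :|: W)| <= #|VG c :\: (W :\: Bd)|)%N.
  apply: subset_leq_card; rewrite finset.setDS //; apply/fintype.subsetP => y.
  by rewrite !inE => /andP[_ ->]; rewrite orbT.
have h2 : W :\: Bd \subset VG c.
  exact: fintype.subset_trans (Wsub c x xWW xV) (finset.subsetDl _ _).
move: h1; rewrite (cardsD (VG c) (W :\: Bd)) (finset.setIidPr h2) => h1; apply: leq_trans h1 _.
by rewrite leq_subLR addnC; apply: leq_trans (big c ccs) Wcard.
Qed.

End GreedyClustering.

(** * Squared Euclidean norms and operator bounds *)

Section SquaredNorm.
Context {R : realType}.

Definition nsq (m : nat) (v : 'rV[R]_m) : R := \sum_j v 0 j ^+ 2.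

Lemma nsq_ge0 m (v : 'rV[R]_m) : 0 <= nsq v.
Proof. by apply: sumr_ge0 => j _; rewrite sqr_ge0. Qed.

Lemma nsqD m (u v : 'rV[R]_m) : nsq (u + v) <= 2 * nsq u + 2 * nsq v.
Proof.
rewrite /nsq !mulr_sumr -big_split /=; apply: ler_sum => j _; rewrite !mxE.
by have := sqr_ge0 (u 0 j - v 0 j); nra.
Qed.

Lemma nsqZ m (c : R) (v : 'rV[R]_m) : nsq (c *: v) = c ^+ 2 * nsq v.
Proof. by rewrite /nsq mulr_sumr; apply: eq_bigr => j _; rewrite mxE exprMn. Qed.

Lemma nsqN m (v : 'rV[R]_m) : nsq (- v) = nsq v.
Proof. by rewrite -scaleN1r nsqZ sqrrN expr1n mul1r. Qed.

Lemma nsqB m (u v : 'rV[R]_m) : nsq (u - v) <= 2 * nsq u + 2 * nsq v.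
Proof. by rewrite -[nsq v]nsqN nsqD. Qed.

Lemma nsq0_eq0 m (v : 'rV[R]_m) : nsq v = 0 -> v = 0.
Proof.
move=> /eqP; rewrite psumr_eq0; last by move=> j _; rewrite sqr_ge0.
move=> /allP h; apply/rowP => j; rewrite mxE; apply/eqP.
by rewrite -sqrf_eq0; apply: h; rewrite mem_index_enum.
Qed.

Lemma nsq_row_mx m1 m2 (u : 'rV[R]_m1) (v : 'rV[R]_m2) :
  nsq (row_mx u v) = nsq u + nsq v.
Proof.
rewrite /nsq big_split_ord /=; congr (_ + _); apply: eq_bigr => j _.
  by rewrite row_mxEl.
by rewrite row_mxEr.
Qed.

Lemma nsq_mxE m (v : 'rV[R]_m) : nsq v = (v *m v^T) 0 0.
Proof. by rewrite mxE; apply: eq_bigr => j _; rewrite mxE expr2. Qed.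

Lemma nsq_isometry m k (v : 'rV[R]_m) (W : 'M[R]_(m, k)) :
  W *m W^T = 1%:M -> nsq (v *m W) = nsq v.
Proof. by move=> h; rewrite !nsq_mxE trmx_mul mulmxA -(mulmxA v) h mulmx1. Qed.

Lemma l2norm_le m (v : 'rV[R]_m) (h : R) :
  0 <= h -> (l2norm v <= h) = (nsq v <= h ^+ 2).
Proof.
move=> h0; rewrite /l2norm -/(nsq v) -{1}(ger0_norm h0) -(sqrtr_sqr h).
by rewrite ler_sqrt // sqr_ge0.
Qed.

Lemma nsq_pid n r (v : 'rV[R]_n) : (r <= n)%N ->
  nsq (v *m (pid_mx r : 'M[R]_(n, r))) = \sum_(j < n | (j < r)%N) v 0 j ^+ 2.
Proof.
move=> rn; rewrite (big_ord_narrow rn) /=; apply: eq_bigr => j _.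
congr (_ ^+ 2); rewrite mxE (bigD1 (widen_ord rn j)) //= big1 => [|k kj].
  by rewrite !mxE /= eqxx ltn_ord mulr1 addr0.
rewrite !mxE; case: eqP => [e|_]; last by rewrite mulr0.
by case/eqP: kj; apply: val_inj.
Qed.

Lemma mul_pid_frame k n : (k <= n)%N ->
  (pid_mx k : 'M[R]_(k, n)) *m (pid_mx k : 'M[R]_(n, k)) = 1%:M.
Proof. by move=> kn; rewrite mul_pid_mx minnn (minn_idPr kn) pid_mx_1. Qed.

Lemma nsq_diag m (v s : 'rV[R]_m) :
  nsq (v *m diag_mx s) = \sum_j v 0 j ^+ 2 * s 0 j ^+ 2.
Proof. by apply: eq_bigr => j _; rewrite mul_mx_diag mxE exprMn. Qed.

Lemma sum_nsq_row m k (B : 'M[R]_(m, k)) :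
  \sum_x nsq (row x B) = \sum_j nsq (row j B^T).
Proof.
rewrite /nsq exchange_big /=; apply: eq_bigr => j _; apply: eq_bigr => x _.
by rewrite !mxE.
Qed.

(** For [0 <= eta], spectral norm at most [eta], acting on row vectors. The bounds for [E] and [E^T]
    are carried side by side instead of being deduced from each other. *)
Definition op_le n (E : 'M[R]_n) (eta : R) : Prop :=
  forall z : 'rV_n, nsq (z *m E) <= eta ^+ 2 * nsq z.

(** The left side is the squared Frobenius norm of [E *m W]; summed by columns, it consists of [r]
    images of unit vectors. *)
Lemma op_le_frame n r (E : 'M[R]_n) (eta : R) (W : 'M[R]_(n, r)) :
  op_le E^T eta -> W^T *m W = 1%:M ->
  \sum_x nsq (row x (E *m W)) <= r%:R * eta ^+ 2.
Proof.
move=> hE hW; rewrite sum_nsq_row -[r in r%:R]card_ord -sum1_card natr_sum mulr_suml.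
apply: ler_sum => j _; rewrite trmx_mul row_mul mul1r.
apply: le_trans (hE _) _; rewrite nsq_mxE tr_row.
have -> : (row j W^T *m col j W^T^T) 0 0 = (W^T *m W) j j.
  by rewrite trmxK !mxE; apply: eq_bigr => k _; rewrite !mxE.
by rewrite hW !mxE eqxx mulr1.
Qed.

End SquaredNorm.

(** * Singular values and vectors of a perturbed block matrix *)

Section SpectralEmbedding.
Context {R : realType}.

(** The values are sorted, so those at least [gam] occupy an initial segment of the indices. *)
Lemma spectral_rank_leP n (s : 'rV[R]_n) (gam : R) (i : 'I_n) :
  (forall i j : 'I_n, (i <= j)%N -> s 0 j <= s 0 i) ->
  (i < spectral_rank s gam)%N = (gam <= s 0 i).
Proof.
move=> smono; rewrite /spectral_rank.
have cardlt (k : nat) : (k <= n)%N -> #|[set j : 'I_n | (j < k)%N]%SET| = k.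
  move=> kn; rewrite -sum1_card (eq_bigl (fun j : 'I_n => (j < k)%N)); last first.
    by move=> j; rewrite inE.
  by rewrite -(big_ord_widen _ (fun=> 1%N)) // sum1_card card_ord.
apply/idP/idP => [|h].
  move=> hi; rewrite leNgt; apply: contraL hi => h; rewrite -leqNgt.
  rewrite -[leqRHS](cardlt i (ltnW (ltn_ord i))); apply: subset_leq_card.
  apply/fintype.subsetP => j; rewrite !inE => hj; rewrite ltnNge; apply/negP => /smono.
  by move=> /(le_trans hj) /(lt_le_trans h); rewrite ltxx.
rewrite -[i.+1](cardlt i.+1) //; apply: subset_leq_card; apply/fintype.subsetP => j.
by rewrite !inE ltnS => /smono; exact: le_trans.
Qed.

(** A case of Weyl's inequality. If [K.+1] singular values were at least [gam], the span of their
    left singular vectors would meet the left kernel of [M], of codimension at most [K], in some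
    [z != 0]; then [z *m A] would be at least [gam] times and at most [eta] times as long as [z]. *)
Lemma spectral_rank_le n K (A M U V : 'M[R]_n) (s : 'rV[R]_n) (gam eta : R) :
  is_svd A U s V -> (\rank M <= K)%N -> op_le (A - M) eta ->
  0 <= eta -> eta < gam -> (spectral_rank s gam <= K)%N.
Proof.
move=> [UU VV s0 smono defA] rM hE eta0 etag; rewrite leqNgt; apply/negP => Kr.
have rn : (spectral_rank s gam <= n)%N.
  by rewrite /spectral_rank -[leqRHS]card_ord max_card.
have Kn := leq_trans Kr rn.
pose W : 'M[R]_(K.+1, n) := pid_mx K.+1 *m U^T.
have WW : W *m W^T = 1%:M.
  by rewrite trmx_mul trmxK mulmxA -(mulmxA _ U^T) UU mulmx1 tr_pid_mx mul_pid_frame.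
have [g gW g0] : exists2 g : 'rV[R]_K.+1, g *m (W *m M) = 0 & g != 0.
  have : kermx (W *m M) != 0.
    rewrite kermx_eq0 /row_free neq_ltn ltnS; apply/orP; left.
    exact: leq_trans (mxrankM_maxr _ _) rM.
  by case/rowV0Pn => g /sub_kermxP gW g0; exists g.
pose z := g *m W.
have zM : z *m M = 0 by rewrite /z -mulmxA.
have nz : nsq z = nsq g by rewrite /z nsq_isometry.
have := hE z; rewrite mulmxBr zM subr0 nz.
rewrite defA !mulmxA nsq_isometry; last by rewrite trmxK.
rewrite /z /W !mulmxA -(mulmxA _ U^T) UU mulmx1 nsq_diag.
have gp0 (j : 'I_n) : (spectral_rank s gam <= j)%N -> (g *m pid_mx K.+1 : 'rV[R]_n) 0 j = 0.
  move=> hj; rewrite mxE big1 // => k _; rewrite !mxE.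
  case: eqP => [e|]; last by rewrite mulr0.
  by move: (leq_trans Kr hj); rewrite -e leqNgt ltn_ord.
have ng : nsq g = nsq (g *m pid_mx K.+1 : 'rV[R]_n).
  by rewrite nsq_isometry // tr_pid_mx mul_pid_frame.
have hlow : gam ^+ 2 * nsq g <=
    \sum_j (g *m pid_mx K.+1 : 'rV[R]_n) 0 j ^+ 2 * s 0 j ^+ 2.
  rewrite ng mulr_sumr; apply: ler_sum => j _; rewrite mulrC.
  have [hj|hj] := leqP (spectral_rank s gam) j; first by rewrite gp0 // expr0n /= !mul0r.
  rewrite ler_wpM2l ?sqr_ge0 // ler_sqr ?nnegrE ?s0 -?spectral_rank_leP //.
  exact: le_trans eta0 (ltW etag).
have ng0 : 0 < nsq g.
  rewrite lt_def nsq_ge0 andbT; apply: contraNneq g0 => /nsq0_eq0 ->; exact: eqxx.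
move=> /(le_trans hlow); rewrite ler_pM2r // ler_sqr ?nnegrE //; last first.
  exact: le_trans eta0 (ltW etag).
by rewrite leNgt etag.
Qed.

(** The part of [1_a M] outside the leading right singular directions of [A] is
    at most [gam + eta] times the norm of [1_a], because [A] is at most [gam]
    there; as the rows of [M] in a cluster coincide, each of them is the average. *)
Lemma cluster_row_tail n K (sigma : 'I_n -> 'I_K) (A M U V : 'M[R]_n)
    (s : 'rV[R]_n) (gam eta : R) (r : nat) (x : 'I_n) :
  U^T *m U = 1%:M -> V^T *m V = 1%:M -> A = U *m diag_mx s *m V^T ->
  (forall j : 'I_n, (r <= j)%N -> `|s 0 j| <= gam) ->
  op_le (A - M) eta ->
  (forall y, sigma y = sigma x -> row y M = row x M) ->
  \sum_(j < n | (r <= j)%N) (row x M *m V) 0 j ^+ 2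
    <= 2 * (gam ^+ 2 + eta ^+ 2) / #|cluster_set sigma (sigma x)|%:R.
Proof.
move=> UU VV defA hs hE hM; set Va := cluster_set sigma (sigma x).
have Va0 : 0 < #|Va|%:R :> R by rewrite ltr0n; apply/card_gt0P; exists x; rewrite inE.
pose one : 'rV[R]_n := \row_y (y \in Va)%:R.
have None : nsq one = #|Va|%:R.
  rewrite -sum1_card natr_sum [RHS]big_mkcond; apply: eq_bigr => y _; rewrite mxE.
  by case: (y \in Va); rewrite ?expr1n ?expr0n.
have rowE : row x M = #|Va|%:R^-1 *: (one *m M).
  apply/rowP => j; rewrite !mxE; apply: (canRL (mulKf (lt0r_neq0 Va0))).
  transitivity (\sum_(y in Va) M y j).
    rewrite -sum1_card natr_sum mulr_suml; apply: eq_bigr => y.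
    by rewrite inE => /eqP/hM/rowP/(_ j); rewrite !mxE mul1r.
  rewrite big_mkcond /=; apply: eq_bigr => y _; rewrite mxE.
  by case: ifP; rewrite ?mul1r ?mul0r.
have tailA : \sum_(j < n | (r <= j)%N) (one *m A *m V) 0 j ^+ 2 <= gam ^+ 2 * #|Va|%:R.
  rewrite defA !mulmxA -(mulmxA _ V^T) VV mulmx1 -None.
  rewrite -(nsq_isometry one (mulmx1C UU)).
  rewrite mulr_sumr big_mkcond /=; apply: ler_sum => j _; case: ifP => [hj|_].
    rewrite mul_mx_diag mxE exprMn mulrC ler_wpM2r ?sqr_ge0 //.
    by rewrite -[leLHS]real_normK ?num_real // ler_sqr ?nnegrE ?normr_ge0 ?hs // (le_trans _ (hs j hj)).
  by rewrite mulr_ge0 ?sqr_ge0.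
have tailE : \sum_(j < n | (r <= j)%N) (one *m (A - M) *m V) 0 j ^+ 2 <= eta ^+ 2 * #|Va|%:R.
  apply: le_trans (_ : nsq (one *m (A - M) *m V) <= _).
    by rewrite big_mkcond; apply: ler_sum => j _; case: ifP; rewrite ?sqr_ge0.
  by rewrite nsq_isometry ?(mulmx1C VV) // -None.
rewrite rowE -scalemxAl.
have -> : \sum_(j < n | (r <= j)%N) (#|Va|%:R^-1 *: (one *m M *m V)) 0 j ^+ 2
   = #|Va|%:R^-1 ^+ 2 * \sum_(j < n | (r <= j)%N) (one *m M *m V) 0 j ^+ 2.
  by rewrite mulr_sumr; apply: eq_bigr => j _; rewrite mxE exprMn.
have -> : 2 * (gam ^+ 2 + eta ^+ 2) / #|Va|%:R =
    #|Va|%:R^-1 ^+ 2 * (2 * (gam ^+ 2 + eta ^+ 2) * #|Va|%:R).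
  by field; exact: lt0r_neq0.
rewrite ler_wpM2l ?sqr_ge0 //.
apply: le_trans (_ : 2 * (gam ^+ 2 * #|Va|%:R) + 2 * (eta ^+ 2 * #|Va|%:R) <= _); last first.
  by rewrite le_eqVlt; apply/orP; left; apply/eqP; ring.
apply: le_trans (lerD (ler_wpM2l (ler0n _ 2) tailA) (ler_wpM2l (ler0n _ 2) tailE)).
rewrite !mulr_sumr -big_split /=; apply: ler_sum => j _.
have -> : (one *m (A - M) *m V) 0 j = (one *m A *m V) 0 j - (one *m M *m V) 0 j.
  by rewrite mulmxBr mulmxBl !mxE.
set a := (one *m A *m V) 0 j; set b := (one *m M *m V) 0 j.
have := sqr_ge0 (2 * a - b); nra.
Qed.

End SpectralEmbedding.

(** * From an operator norm bound to the number of clusters *)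

Section SpectralClustering.
Context {R : realType}.

(** [M] factors through [K] rows, one representative of each cluster, with a zero row for an empty
    cluster. *)
Lemma rank_block_mx n K (sigma : 'I_n -> 'I_K) (M : 'M[R]_n) :
  (forall x x' y, sigma x = sigma x' -> M x y = M x' y) -> (\rank M <= K)%N.
Proof.
move=> hM; pose S : 'M[R]_(n, K) := \matrix_(x, a) (sigma x == a)%:R.
pose B : 'M[R]_(K, n) :=
  \matrix_(a, y) (if [pick x | sigma x == a] is Some x then M x y else 0).
suff -> : M = S *m B by exact: leq_trans (mxrankM_maxl _ _) (rank_leq_col _).
apply/matrixP => x y; rewrite mxE (bigD1 (sigma x)) //= big1 => [|a ax].
  rewrite !mxE eqxx mul1r addr0; case: pickP => [x' /eqP e|/(_ x)]; last by rewrite eqxx.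
  exact/hM/esym.
by rewrite mxE eq_sym (negbTE ax) mul0r.
Qed.

(** The squared row errors add up to at most [2 * K * eta ^+ 2], so by Markov's inequality at most
    [8 * K * eta ^+ 2 / h ^+ 2] rows move by more than [h / 2]. The greedy loop wants [rho] above
    twice this number, whence the [16], and clusters that still have [rho] elements once these rows
    are removed; [n / kappa] bounds the cluster sizes from below. *)
Lemma clustering_output_spectral n K (sigma : 'I_n -> 'I_K) (A M U V : 'M[R]_n)
    (s : 'rV[R]_n) (gam eta h rho kappa : R) (m : nat) :
  (0 < K)%N -> (0 < n)%N ->
  is_svd A U s V ->
  (forall x x' y y', sigma x = sigma x' -> sigma y = sigma y' -> M x y = M x' y') ->
  op_le (A - M) eta -> op_le (A - M)^T eta ->
  0 <= eta -> eta < gam -> 0 < h -> 0 < kappa ->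
  (forall a, n%:R <= kappa * #|cluster_set sigma a|%:R) ->
  (forall x y, sigma x != sigma y ->
     16 * kappa * (gam ^+ 2 + eta ^+ 2) / n%:R + 10 * h ^+ 2 <
     nsq (row x M - row y M) + nsq (row x M^T - row y M^T)) ->
  16 * K%:R * eta ^+ 2 / h ^+ 2 < rho ->
  rho + 8 * K%:R * eta ^+ 2 / h ^+ 2 <= n%:R / kappa ->
  clustering_output (neighborhood (svd_embedding (spectral_rank s gam) U s V) h) rho m ->
  m = K.
Proof.
move=> K0 n0 svdA hM hE hEt eta0 etag h0 k0 hV hsep rho1 rho2.
have [UU VV s0 smono defA] := svdA.
set r := spectral_rank s gam.
have rn : (r <= n)%N by rewrite /r /spectral_rank -[leqRHS]card_ord max_card.
have rK : (r <= K)%N.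
  apply: spectral_rank_le svdA _ hE eta0 etag.
  by apply: (@rank_block_mx _ _ sigma) => x x' y e; exact: hM.
have nR : 0 < n%:R :> R by rewrite ltr0n.
set Xh := svd_embedding r U s V.
pose Xs : 'M[R]_(n, r + r) := row_mx (M *m V *m pid_mx r) (M^T *m U *m pid_mx r).
have At : A^T = V *m diag_mx s *m U^T.
  by rewrite defA !trmx_mul trmxK tr_diag_mx mulmxA.
have AV : A *m V = U *m diag_mx s by rewrite defA -!mulmxA VV mulmx1.
have AU : A^T *m U = V *m diag_mx s by rewrite At -!mulmxA UU mulmx1.
have frame (W : 'M[R]_n) : W^T *m W = 1%:M ->
    (W *m pid_mx r : 'M[R]_(n, r))^T *m (W *m pid_mx r : 'M[R]_(n, r)) = 1%:M.
  move=> hW; rewrite trmx_mul -mulmxA (mulmxA W^T) hW mul1mx tr_pid_mx.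
  exact: mul_pid_frame.
have XX : Xh - Xs = row_mx ((A - M) *m (V *m pid_mx r)) ((A - M)^T *m (U *m pid_mx r)).
  rewrite /Xh /svd_embedding /Xs opp_row_mx add_row_mx -AV -AU.
  by rewrite [(A - M)^T]linearB /= 2!mulmxBl !mulmxA.
have sumX : \sum_x nsq (row x (Xh - Xs)) <= 2 * K%:R * eta ^+ 2.
  rewrite XX; under eq_bigr do rewrite row_row_mx nsq_row_mx.
  rewrite big_split /=.
  have h1 := op_le_frame (E := A - M) hEt (frame _ VV).
  have h2 : op_le (A - M)^T^T eta by rewrite trmxK.
  have {h2} := op_le_frame h2 (frame _ UU); move: h1.
  have : r%:R * eta ^+ 2 <= K%:R * eta ^+ 2 by rewrite ler_wpM2r ?sqr_ge0 // ler_nat.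
  lra.
pose Bd := [set x | h ^+ 2 / 4 < nsq (row x (Xh - Xs))]%SET.
have h20 : 0 < h ^+ 2 by rewrite exprn_gt0.
have cardBd : #|Bd|%:R <= 8 * K%:R * eta ^+ 2 / h ^+ 2.
  rewrite ler_pdivlMr //.
  have : #|Bd|%:R * (h ^+ 2 / 4) <= 2 * K%:R * eta ^+ 2.
    apply: le_trans sumX; rewrite -sum1_card natr_sum mulr_suml big_mkcond /=.
    by apply: ler_sum => x _; case: ifPn => [|_]; rewrite ?nsq_ge0 // inE mul1r => /ltW.
  lra.
have Xsrow x : row x Xs = row_mx (row x M *m V *m pid_mx r) (row x M^T *m U *m pid_mx r).
  by rewrite row_row_mx !row_mul.
have rowM x y : sigma x = sigma y -> row x M = row y M.
  by move=> e; apply/rowP => j; rewrite !mxE; exact: hM.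
have rowMt x y : sigma x = sigma y -> row x M^T = row y M^T.
  by move=> e; apply/rowP => j; rewrite !mxE; exact: hM.
(* Dropping the directions beyond [r] costs [8 * kappa * (gam ^+ 2 + eta ^+ 2) / n] on each of the
   two sides: the tail bound for two rows, times 2 for the square of a difference. *)
have sepXs x y : sigma x != sigma y -> 10 * h ^+ 2 < nsq (row x Xs - row y Xs).
  move=> /hsep; rewrite !Xsrow opp_row_mx add_row_mx nsq_row_mx -!mulmxBl.
  have tail (A' M' U' V' : 'M[R]_n) : U'^T *m U' = 1%:M -> V'^T *m V' = 1%:M ->
      A' = U' *m diag_mx s *m V'^T -> op_le (A' - M') eta ->
      (forall x y, sigma x = sigma y -> row x M' = row y M') ->
      nsq (row x M' - row y M') - 8 * kappa * (gam ^+ 2 + eta ^+ 2) / n%:R <=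
      nsq ((row x M' - row y M') *m V' *m (pid_mx r : 'M[R]_(n, r))).
    move=> UU' VV' defA' hE' hM'.
    have sr (j : 'I_n) : (r <= j)%N -> `|s 0 j| <= gam.
      by move=> hj; rewrite ger0_norm // leNgt; apply/negP => /ltW; rewrite -spectral_rank_leP // ltnNge hj.
    have t1 z : \sum_(j < n | (r <= j)%N) (row z M' *m V') 0 j ^+ 2 <=
        2 * (kappa * (gam ^+ 2 + eta ^+ 2) / n%:R).
      apply: le_trans (cluster_row_tail UU' VV' defA' sr hE' (fun y e => hM' y z e)) _.
      have := hV (sigma z); set c := #|_|%:R => hc.
      have c0 : 0 < c by rewrite -(pmulr_rgt0 _ k0); exact: lt_le_trans hc.
      rewrite -mulrA ler_pM2l // ler_pdivrMr // mulrAC ler_pdivlMr //.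
      rewrite (mulrC kappa) -mulrA ler_wpM2l // addr_ge0 ?sqr_ge0 //.
    rewrite -(nsq_isometry (row x M' - row y M') (mulmx1C VV')).
    rewrite nsq_pid // {1}/nsq (bigID (fun j : 'I_n => (j < r)%N)) /=.
    rewrite -addrA -[leRHS]addr0 lerD2l subr_le0.
    under eq_bigl do rewrite -leqNgt.
    apply: le_trans (_ : \sum_(j < n | (r <= j)%N) (2 * (row x M' *m V') 0 j ^+ 2 +
        2 * (row y M' *m V') 0 j ^+ 2) <= _).
      apply: ler_sum => j _; rewrite mulmxBl !mxE.
      set a := \sum_k _; set b := \sum_k _; have := sqr_ge0 (a + b); nra.
    rewrite big_split /= -!mulr_sumr; have := t1 x; have := t1 y.
    lra.
  have := tail _ _ _ _ UU VV defA hE rowM.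
  have hE2 : op_le (A^T - M^T) eta by move: hEt; rewrite linearB.
  have := tail _ _ _ _ VV UU At hE2 rowMt.
  lra.
apply: (@clustering_output_good R n K sigma _ rho (~: Bd)) => //.
- move=> x y; rewrite !inE -!leNgt => hx hy sxy.
  rewrite l2norm_le ?(ltW h0) //.
  have Xsxy : row x Xs = row y Xs by rewrite !Xsrow (rowM _ _ sxy) (rowMt _ _ sxy).
  have -> : row x Xh - row y Xh = row x (Xh - Xs) - row y (Xh - Xs).
    by rewrite !linearB /= Xsxy; apply/rowP => j; rewrite !mxE; ring.
  apply: le_trans (nsqB _ _) _; lra.
- move=> z x y; rewrite !inE -!leNgt => hx hy.
  rewrite !l2norm_le ?(ltW h0) // => zx zy.
  apply/eqP; apply: contraT => /sepXs; apply: contraLR => _; rewrite -leNgt.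
  (* Two rows within [h] of a common one, each with error at most [h / 2]: the squared triangle
     inequality with factor 2, used twice, yields [4 * (1 / 4 + 1) * 2 = 10] times [h ^+ 2]. *)
  have -> : row x Xs - row y Xs = (row y (Xh - Xs) + (row z Xh - row y Xh)) -
      (row x (Xh - Xs) + (row z Xh - row x Xh)).
    by rewrite !linearB /=; apply/rowP => j; rewrite !mxE; ring.
  have := nsqB (row y (Xh - Xs) + (row z Xh - row y Xh)) (row x (Xh - Xs) + (row z Xh - row x Xh)).
  have := nsqD (row y (Xh - Xs)) (row z Xh - row y Xh).
  have := nsqD (row x (Xh - Xs)) (row z Xh - row x Xh).
  lra.
- rewrite finset.setCK -muln2 natrM; apply: le_lt_trans rho1; lra.
- move=> a; have := hV a; rewrite mulrC -ler_pdivrMr // => hVa.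
  have : #|cluster_set sigma a|%:R <= #|cluster_set sigma a :&: ~: Bd|%:R + #|Bd|%:R :> R.
    rewrite -natrD ler_nat -(cardsID Bd (cluster_set sigma a)) addnC -finset.setDE leq_add2l.
    exact: subset_leq_card (finset.subsetIr _ _).
  lra.
Qed.

End SpectralClustering.

(** * Heavy pairs: summation over level sets *)

Section HeavyPairs.
Context {R : realType}.

Lemma ln_le_sub1 (x : R) : 0 < x -> ln x <= x - 1.
Proof. by move=> x0; have := @le_ln1Dx R (x - 1); rewrite addrCA subrr addr0; apply; lra. Qed.

Lemma geometric_sum_le (L : nat) (x : R) : 0 <= x ->
  \sum_(i < L | 4 ^+ i <= x) 4 ^+ i <= 2 * x.
Proof.
move=> x0; elim: L => [|L IH]; first by rewrite big_ord0 mulr_ge0.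
rewrite big_mkcond big_ord_recr /= -big_mkcond /=; case: ifPn => [h|_]; last by rewrite addr0.
suff : \sum_(i < L | 4 ^+ i <= x) 4 ^+ i <= (4 ^+ L : R) by lra.
apply: le_trans (_ : \sum_(i < L) 4 ^+ i <= _).
  by rewrite big_mkcond; apply: ler_sum => i _; case: ifP; rewrite // exprn_ge0.
have : (4 - 1) * \sum_(i < L) 4 ^+ i = 4 ^+ L - 1 :> R by rewrite -subrX1.
have : 0 <= 4 ^+ L :> R by rewrite exprn_ge0.
lra.
Qed.

Lemma inv_geometric_sum_le (L : nat) (x : R) : 2 <= x -> \sum_(i < L) (x ^+ i)^-1 <= 2.
Proof.
move=> x2; apply: le_trans (_ : \sum_(i < L) (2 ^+ i)^-1 <= _).
  apply: ler_sum => i _; rewrite lef_pV2 ?posrE ?exprn_gt0 //; last lra.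
  by rewrite lerXn2r // nnegrE; lra.
have -> : \sum_(i < L) (2 ^+ i)^-1 = 2 - 2 * (2 ^+ L)^-1 :> R.
  elim: L => [|L IH]; first by rewrite big_ord0; field.
  by rewrite big_ord_recr /= IH exprS; field; rewrite expf_neq0.
by rewrite gerBl mulr_ge0 // invr_ge0 exprn_ge0.
Qed.

(** Here [s = 4 ^ i], [t = 4 ^ j] are the values of the two vectors on level sets of
    [m] and [k] indices carrying the total weight [e]. Each of the four terms on the
    right becomes [O(n * D)] when summed over all levels. *)
Lemma heavy_level_le (n m k D C2 C3 e : R) (i j : nat) :
  let s := 4 ^+ i in let t := 4 ^+ j in
  0 < n -> 0 < m -> 0 < k -> 1 <= D -> 0 <= e -> k * t ^+ 2 <= n ->
  D < 16 * s * t -> s < 4 * D * t -> expR 1 <= C2 -> 0 <= C3 ->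
  e <= C2 * D ^+ 2 * (m * k) / n \/
    e * ln (e * n / (D ^+ 2 * (m * k))) <= C3 * k * (1 + ln (n / k)) ->
  e * s * t <= 16 * C2 * D * (m * s ^+ 2) * (k * t ^+ 2) / n +
    (if s <= D then s else 0) * (C3 * (2 * (k * t ^+ 2) + n * (4 ^+ j)^-1)) +
    (if s <= 4 * D * t then s else 0) * (4 * C3 * (k * t)) +
    expR 1 * D * (m * s ^+ 2) * (2 ^+ j)^-1.
Proof.
move=> s t n0 m0 k0 D1 e0 ktn Dst sDt C2e C30 hdisc.
have s0 : 0 < s by rewrite exprn_gt0.
have t0 : 0 < t by rewrite exprn_gt0.
have t1 : 1 <= t by rewrite exprn_ege1 //; lra.
have D0 : 0 < D by lra.
have C20 : 0 < C2 by apply: lt_le_trans C2e; rewrite expR_gt0.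
have P1 : 0 <= 16 * C2 * D * (m * s ^+ 2) * (k * t ^+ 2) / n.
  by rewrite !mulr_ge0 ?invr_ge0 ?sqr_ge0 ?ltW.
have P2 : 0 <= (if s <= D then s else 0) * (C3 * (2 * (k * t ^+ 2) + n * (4 ^+ j)^-1)).
  rewrite mulr_ge0 //; first by case: ifP => // _; exact: ltW.
  by rewrite mulr_ge0 // addr_ge0 ?mulr_ge0 ?invr_ge0 ?sqr_ge0 ?exprn_ge0 ?ltW.
have P3 : 0 <= (if s <= 4 * D * t then s else 0) * (4 * C3 * (k * t)).
  rewrite mulr_ge0 //; first by case: ifP => // _; exact: ltW.
  by rewrite !mulr_ge0 // ltW.
have P4 : 0 <= expR 1 * D * (m * s ^+ 2) * (2 ^+ j)^-1.
  by rewrite !mulr_ge0 ?invr_ge0 ?sqr_ge0 ?exprn_ge0 ?expR_ge0 ?ltW.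
have add4 (x y1 y2 y3 y4 : R) : 0 <= y1 -> 0 <= y2 -> 0 <= y3 -> 0 <= y4 ->
    [|| x <= y1, x <= y2, x <= y3 | x <= y4] -> x <= y1 + y2 + y3 + y4.
  by move=> ? ? ? ? /or4P[]; lra.
have [hle|hgt] := leP e (C2 * D ^+ 2 * (m * k) / n).
  suff h : e * s * t <= 16 * C2 * D * (m * s ^+ 2) * (k * t ^+ 2) / n.
    by apply: add4 => //; rewrite h.
  apply: le_trans (_ : C2 * D ^+ 2 * (m * k) / n * s * t <= _).
    by rewrite ler_wpM2r ?(ltW t0) // ler_wpM2r ?(ltW s0).
  have -> : C2 * D ^+ 2 * (m * k) / n * s * t = (C2 * D * (m * k) / n * s * t) * D by ring.
  have -> : 16 * C2 * D * (m * s ^+ 2) * (k * t ^+ 2) / n =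
    (C2 * D * (m * k) / n * s * t) * (16 * s * t) by ring.
  by apply: ler_wpM2l; apply: ltW => //; rewrite !mulr_gt0 ?invr_gt0.
case: hdisc => [h|hd]; first by move: (lt_le_trans hgt h); rewrite ltxx.
set lam := e * n / (D ^+ 2 * (m * k)) in hd.
have DDmk : 0 < D ^+ 2 * (m * k) by rewrite !mulr_gt0 // exprn_gt0.
have lamC : C2 < lam.
  by rewrite /lam ltr_pdivlMr // [C2 * _]mulrA -ltr_pdivrMr.
have lam0 : 0 < lam by exact: lt_trans lamC.
have ln1 : 1 <= ln lam.
  rewrite -[1]expRK ler_ln ?posrE ?expR_gt0 //; exact: le_trans C2e (ltW lamC).
have lnt : ln t <= t - 1 by exact: ln_le_sub1.
set Z := 1 + ln (n / k) in hd *.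
have nk : t ^+ 2 <= n / k by rewrite ler_pdivlMr // mulrC.
have lnnk : 2 * ln t <= ln (n / k).
  rewrite mulr_natl -lnXn // ler_ln ?posrE ?exprn_gt0 // divr_gt0 //.
have lnt0 : 0 <= ln t by exact: ln_ge0.
(* For [s <= D], [1 <= ln lam] gives [e <= C3 * k * Z]. Writing [n / k] as [n / (k * t ^+ 2)] times
   [t ^+ 2] bounds [k * t * Z] by [n / t + 2 * k * t ^+ 2]. *)
case: (leP s D) P2 => [sD|Ds] P2.
  have eZ : e <= C3 * k * Z by apply: le_trans hd; rewrite -{1}[e]mulr1 ler_wpM2l.
  suff h : e * s * t <= s * (C3 * (2 * (k * t ^+ 2) + n * (4 ^+ j)^-1)).
    by apply: add4 => //; rewrite h ?orbT.
  have -> : e * s * t = s * (e * t) by ring.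
  rewrite ler_wpM2l ?(ltW s0) //.
  apply: le_trans (_ : C3 * k * Z * t <= _); first by rewrite ler_wpM2r ?(ltW t0).
  have -> : C3 * k * Z * t = C3 * (k * t * Z) by ring.
  rewrite ler_wpM2l //.
  have hw : ln (n / k) <= n / (k * t ^+ 2) - 1 + 2 * (t - 1).
    have -> : n / k = n / (k * t ^+ 2) * t ^+ 2 by field; rewrite !lt0r_neq0.
    rewrite lnM ?posrE ?exprn_gt0 ?divr_gt0 ?mulr_gt0 ?exprn_gt0 //.
    rewrite lerD // ?ln_le_sub1 ?divr_gt0 ?mulr_gt0 ?exprn_gt0 //.
    by rewrite lnXn // mulr2n; lra.
  apply: le_trans (_ : k * t * (n / (k * t ^+ 2) + 2 * t) <= _).
    by rewrite ler_wpM2l ?mulr_ge0 ?(ltW k0) ?(ltW t0) // /Z; lra.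
  rewrite le_eqVlt; apply/orP; left; apply/eqP; rewrite -/t.
  by field; rewrite !lt0r_neq0.
(* For [D < s] the two logarithms are compared. If [Z <= 4 * ln lam], they cancel and [e] is [O(k)];
   otherwise [lam] is small enough to be absorbed. *)
have [hq|hq] := leP Z (4 * ln lam).
  suff h : e * s * t <= s * (4 * C3 * (k * t)).
    by rewrite (ltW sDt) in P3 *; apply: add4 => //; rewrite h ?orbT.
  have e4 : e <= 4 * C3 * k.
    rewrite -(@ler_pM2r _ (ln lam)); last by lra.
    apply: le_trans hd _; have -> : 4 * C3 * k * ln lam = C3 * k * (4 * ln lam) by ring.
    by rewrite ler_wpM2l // mulr_ge0 ?(ltW k0).
  have -> : e * s * t = s * t * e by ring.
  have -> : s * (4 * C3 * (k * t)) = s * t * (4 * C3 * k) by ring.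
  by rewrite ler_wpM2l // mulr_ge0 ?(ltW s0) ?(ltW t0).
suff h : e * s * t <= expR 1 * D * (m * s ^+ 2) * (2 ^+ j)^-1.
  by apply: add4 => //; rewrite h !orbT.
have -> : e = lam * (D ^+ 2 * (m * k)) / n.
  by rewrite /lam; field; rewrite !lt0r_neq0.
(* With [L = ln (2 ^+ j)] the exponents require [3 * L + ln lam <= Z], which follows from
   [4 * L <= Z - 1] and [4 * ln lam < Z]. *)
have h1 : k * t * lam <= n * (expR 1 * (2 ^+ j)^-1).
  have -> : lam = expR (ln lam) by rewrite lnK.
  have -> : k = n * expR (1 - Z).
    rewrite /Z opprD addNKr expRN lnK ?posrE ?divr_gt0 //; field.
    by rewrite !lt0r_neq0.
  have t2 : t = expR (ln (2 ^+ j)) * expR (ln (2 ^+ j)).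
    by rewrite lnK ?posrE ?exprn_gt0 // -exprMn /t; congr (_ ^+ _); ring.
  have ln2 : ln t = 2 * ln (2 ^+ j).
    have -> : t = (2 ^+ j) ^+ 2 by rewrite -exprM mulnC exprM /t; congr (_ ^+ _); ring.
    by rewrite lnXn ?exprn_gt0 // mulr_natl.
  have -> : (2 ^+ j)^-1 = expR (- ln (2 ^+ j)) :> R.
    by rewrite expRN lnK // posrE exprn_gt0.
  rewrite [in X in X <= _]t2 -!mulrA ler_pM2l // -!expRD ler_expR.
  have : Z = 1 + ln (n / k) by [].
  lra.
have -> : lam * (D ^+ 2 * (m * k)) / n * s * t =
  (D * (m * s) / n) * D * (k * t * lam) by ring.
have -> : expR 1 * D * (m * s ^+ 2) * (2 ^+ j)^-1 =
  (D * (m * s) / n) * s * (n * (expR 1 * (2 ^+ j)^-1)).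
  by field; rewrite ?expf_neq0 ?lt0r_neq0.
have c0 : 0 <= D * (m * s) / n by apply: ltW; rewrite !mulr_gt0 ?invr_gt0.
apply: ler_pM => //; first by rewrite mulr_ge0 // ltW.
  by apply: ltW; rewrite mulr_gt0 // mulr_gt0.
by apply: ler_wpM2l => //; exact: ltW.
Qed.

(** The first of the four terms sums to a product of the two total weights. In the second and third,
    the cutoffs on [4 ^+ i] make the sum over [i] geometric, hence comparable to its largest term;
    in the fourth the series in [j] converges. *)
Lemma heavy_levels_le (L : nat) (n D C2 C3 : R) (m k : 'I_L -> nat)
    (e : 'I_L -> 'I_L -> R) (J : 'I_L -> 'I_L -> bool) :
  0 < n -> 1 <= D -> expR 1 <= C2 -> 0 <= C3 -> (forall i j, 0 <= e i j) ->
  \sum_i (m i)%:R * (4 ^+ i) ^+ 2 <= n -> \sum_j (k j)%:R * (4 ^+ j) ^+ 2 <= n ->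
  (forall i j, J i j ->
     [/\ (0 < m i)%N, (0 < k j)%N, D < 16 * 4 ^+ i * 4 ^+ j, 4 ^+ i < 4 * D * 4 ^+ j &
       e i j <= C2 * D ^+ 2 * ((m i)%:R * (k j)%:R) / n \/
       e i j * ln (e i j * n / (D ^+ 2 * ((m i)%:R * (k j)%:R)))
         <= C3 * (k j)%:R * (1 + ln (n / (k j)%:R))]) ->
  \sum_i \sum_(j | J i j) e i j * 4 ^+ i * 4 ^+ j
    <= (16 * C2 + 40 * C3 + 2 * expR 1) * D * n.
Proof.
move=> n0 D1 C2e C30 e0 hm hk hJ.
have D0 : 0 < D by lra.
have C20 : 0 < C2 by apply: lt_le_trans C2e; rewrite expR_gt0.
pose s (i : 'I_L) : R := 4 ^+ i.
have s0 i : 0 < s i by rewrite exprn_gt0.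
have ms0 i : 0 <= (m i)%:R * s i ^+ 2 by rewrite mulr_ge0 // sqr_ge0.
have ks0 i : 0 <= (k i)%:R * s i ^+ 2 by rewrite mulr_ge0 // sqr_ge0.
pose T1 i j := 16 * C2 * D * ((m i)%:R * s i ^+ 2) * ((k j)%:R * s j ^+ 2) / n.
pose T2 i j := (if s i <= D then s i else 0) * (C3 * (2 * ((k j)%:R * s j ^+ 2) + n * (4 ^+ j)^-1)).
pose T3 i j := (if s i <= 4 * D * s j then s i else 0) * (4 * C3 * ((k j)%:R * s j)).
pose T4 i (j : 'I_L) := expR 1 * D * ((m i)%:R * s i ^+ 2) * (2 ^+ j)^-1.
apply: le_trans (_ : \sum_i \sum_j (T1 i j + T2 i j + T3 i j + T4 i j) <= _).
  apply: ler_sum => i _; rewrite big_mkcond; apply: ler_sum => j _; case: ifP => [hij|_].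
    have [m0 k0 h1 h2 h3] := hJ i j hij.
    apply: heavy_level_le; rewrite ?ltr0n //.
    apply: le_trans hk; rewrite (bigD1 j) //= lerDl sumr_ge0 //.
  have if0 (c : bool) : 0 <= (if c then s i else 0) by case: c => //; exact: ltW.
  apply: addr_ge0; [apply: addr_ge0; [apply: addr_ge0|]|].
  - by rewrite /T1 !mulr_ge0 ?invr_ge0 ?(ltW (s0 _)) ?(ltW C20) ?(ltW D0) ?(ltW n0).
  - rewrite /T2 mulr_ge0 // mulr_ge0 // addr_ge0 //; first by rewrite mulr_ge0.
    by rewrite mulr_ge0 ?invr_ge0 ?exprn_ge0 ?(ltW n0).
  - by rewrite /T3 mulr_ge0 // !mulr_ge0 // ltW.
  - by rewrite /T4 !mulr_ge0 ?(ltW (s0 _)) ?invr_ge0 ?exprn_ge0 ?expR_ge0 ?(ltW D0).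
under eq_bigr do rewrite !big_split /=.
rewrite !big_split /=.
have B1 : \sum_i \sum_j T1 i j <= 16 * C2 * D * n.
  have -> : \sum_i \sum_j T1 i j =
      16 * C2 * D / n * ((\sum_i (m i)%:R * s i ^+ 2) * (\sum_j (k j)%:R * s j ^+ 2)).
    rewrite mulr_suml mulr_sumr; apply: eq_bigr => i _; rewrite !mulr_sumr.
    by apply: eq_bigr => j _; rewrite /T1; ring.
  have -> : 16 * C2 * D * n = 16 * C2 * D / n * (n * n) by field; rewrite lt0r_neq0.
  rewrite ler_wpM2l ?mulr_ge0 ?invr_ge0 ?(ltW C20) ?(ltW D0) ?(ltW n0) //.
  by rewrite ler_pM // sumr_ge0.
have B2 : \sum_i \sum_j T2 i j <= 8 * C3 * D * n.
  have -> : \sum_i \sum_j T2 i j = (\sum_(i | s i <= D) s i) *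
      (C3 * (2 * (\sum_j (k j)%:R * s j ^+ 2) + n * \sum_j (4 ^+ (j : 'I_L))^-1)).
    rewrite [in RHS]big_mkcond mulr_suml; apply: eq_bigr => i _; rewrite !mulr_sumr -big_split /=.
    by rewrite !mulr_sumr.
  have -> : 8 * C3 * D * n = 2 * D * (C3 * (2 * n + n * 2)) by ring.
  have h4 := @inv_geometric_sum_le L 4 ltac:(lra).
  have h4' : 0 <= \sum_(j < L) (4 ^+ j)^-1 :> R by apply: sumr_ge0 => j _; rewrite invr_ge0 exprn_ge0.
  have hk0 : 0 <= \sum_j (k j)%:R * s j ^+ 2 by apply: sumr_ge0.
  apply: ler_pM.
  - by apply: sumr_ge0 => i _; exact: ltW.
  - by rewrite mulr_ge0 // addr_ge0 // mulr_ge0 // ltW.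
  - by apply: geometric_sum_le; exact: ltW.
  - rewrite ler_wpM2l // lerD //; first by rewrite ler_pM2l.
    by rewrite ler_pM2l.
have B3 : \sum_i \sum_j T3 i j <= 32 * C3 * D * n.
  rewrite exchange_big /=.
  apply: le_trans (_ : \sum_j 32 * C3 * D * ((k j)%:R * s j ^+ 2) <= _); last first.
    by rewrite -mulr_sumr ler_wpM2l // !mulr_ge0 // ltW.
  apply: ler_sum => j _; rewrite -mulr_suml -big_mkcond /=.
  apply: le_trans (_ : 2 * (4 * D * s j) * (4 * C3 * ((k j)%:R * s j)) <= _); last first.
    by rewrite le_eqVlt; apply/orP; left; apply/eqP; ring.
  rewrite ler_wpM2r ?mulr_ge0 ?(ltW (s0 _)) //.
  by apply: geometric_sum_le; rewrite !mulr_ge0 // ltW.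
have B4 : \sum_i \sum_j T4 i j <= 2 * expR 1 * D * n.
  have -> : \sum_i \sum_j T4 i j =
      expR 1 * D * ((\sum_i (m i)%:R * s i ^+ 2) * \sum_j (2 ^+ (j : 'I_L))^-1).
    rewrite mulr_suml mulr_sumr; apply: eq_bigr => i _; rewrite !mulr_sumr.
    by apply: eq_bigr => j _; rewrite /T4; ring.
  have -> : 2 * expR 1 * D * n = expR 1 * D * (n * 2) by ring.
  rewrite ler_wpM2l ?mulr_ge0 ?expR_ge0 ?(ltW D0) // ler_pM //.
  - exact: sumr_ge0.
  - by apply: sumr_ge0 => j _; rewrite invr_ge0 exprn_ge0.
  - by apply: inv_geometric_sum_le; lra.
lra.
Qed.

End HeavyPairs.

(** * Heavy pairs: degrees and discrepancy *)

Section HeavySum.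
Context {R : realType}.

Definition weight_between n (N : 'M[R]_n) (A B : {set 'I_n}) : R :=
  \sum_(x in A) \sum_(y in B) N x y.

Lemma weight_between_tr n (N : 'M[R]_n) A B : weight_between N^T A B = weight_between N B A.
Proof. by rewrite /weight_between exchange_big; do 2!(apply: eq_bigr => ? _); rewrite mxE. Qed.

(** The discrepancy property of Feige and Ofek: between any two sets, [N] has either
    [O(1)] times the expected weight or little weight compared to their sizes. *)
Definition discrepancy n (N : 'M[R]_n) (D C2 C3 : R) : Prop :=
  forall A B : {set 'I_n}, (0 < #|A|)%N -> (#|A| <= #|B|)%N ->
    let e := weight_between N A B in
    e <= C2 * D ^+ 2 * (#|A|%:R * #|B|%:R) / n%:R \/
    e * ln (e * n%:R / (D ^+ 2 * (#|A|%:R * #|B|%:R)))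
      <= C3 * #|B|%:R * (1 + ln (n%:R / #|B|%:R)).

Lemma level_exists (L : nat) (v : R) : 1 <= v -> v < 4 ^+ L ->
  exists i : 'I_L, 4 ^+ i <= v < 4 ^+ i.+1.
Proof.
move=> v1; elim: L => [|L IH]; first by rewrite expr0 ltNge v1.
have [h _|h hL] := ltP v (4 ^+ L); last by exists ord_max; rewrite h.
by have [i hi] := IH h; exists (widen_ord (leqnSn L) i).
Qed.

Lemma level_sq_sum_le n (a : 'I_n -> R) (L : nat) : (forall x, 0 <= a x) ->
  \sum_(i < L) #|[set x | 4 ^+ i <= a x < 4 ^+ i.+1]%SET|%:R * (4 ^+ i) ^+ 2
    <= \sum_x a x ^+ 2.
Proof.
move=> a0.
under eq_bigr => i _ do rewrite -sum1_card natr_sum mulr_suml big_mkcond.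
rewrite exchange_big; apply: ler_sum => x _; rewrite -big_mkcond /=.
under eq_bigr do rewrite mul1r.
have [i0 hi0|h] := pickP [pred i : 'I_L | x \in [set x | 4 ^+ i <= a x < 4 ^+ i.+1]%SET]; last first.
  by rewrite big_pred0 ?sqr_ge0.
rewrite /= inE in hi0; have /andP[hi1 hi2] := hi0.
rewrite (bigD1 i0) /=; last by rewrite inE.
rewrite big1 ?addr0; last first.
  move=> i; rewrite inE => /andP[/andP[h1 h2]]; apply: contraNeq => _.
  have h4 : (1 : R) < 4 by lra.
  have := le_lt_trans h1 hi2; have := le_lt_trans hi1 h2.
  rewrite !ltr_eXn2l // !ltnS => k1 k2; apply/eqP/val_inj/eqP.
  by rewrite eqn_leq k1 k2.
by rewrite ler_sqr ?nnegrE ?exprn_ge0.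
Qed.

(** If one of [a x], [b y] is at least [D] times the other, their product is at most the larger
    square over [D], and the degree bound suffices. Otherwise both are at least 1 and are rounded
    down to powers of 4, at the cost of a factor 16. The level sets are then handled through [N] or
    [N^T], so that the smaller one comes first in the discrepancy property; these two sums make the
    32. *)
Lemma heavy_sum_le n (N : 'M[R]_n) (D C1 C2 C3 : R) (a b : 'I_n -> R) :
  (0 < n)%N -> 1 <= D -> 0 <= C1 -> expR 1 <= C2 -> 0 <= C3 ->
  (forall x y, 0 <= N x y) -> (forall x, 0 <= a x) -> (forall x, 0 <= b x) ->
  \sum_x a x ^+ 2 <= n%:R -> \sum_x b x ^+ 2 <= n%:R ->
  (forall x, 0 < a x -> \sum_y N x y <= C1 * D ^+ 2) ->
  (forall y, 0 < b y -> \sum_x N x y <= C1 * D ^+ 2) ->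
  discrepancy N D C2 C3 -> discrepancy N^T D C2 C3 ->
  \sum_x \sum_(y | D < a x * b y) a x * b y * N x y
    <= (2 * C1 + 32 * (16 * C2 + 40 * C3 + 2 * expR 1)) * D * n%:R.
Proof.
move=> n0 D1 C10 C2e C30 N0 a0 b0 ha hb hrow hcol hd hdt.
have D0 : 0 < D by lra.
have nR : 0 < n%:R :> R by rewrite ltr0n.
pose A (v : 'I_n -> R) (i : 'I_n) := [set x | 4 ^+ i <= v x < 4 ^+ i.+1]%SET.
pose J (i j : 'I_n) := [&& D < 16 * 4 ^+ i * 4 ^+ j, 4 ^+ i < 4 * D * 4 ^+ j,
  4 ^+ j < 4 * D * 4 ^+ i, (0 < #|A a i|)%N & (0 < #|A b j|)%N].
pose J1 i j := J i j && (#|A a i| <= #|A b j|)%N.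
pose J2 i j := J i j && (#|A b j| <= #|A a i|)%N.
pose w (i j : 'I_n) x y := 16 * (if (x \in A a i) && (y \in A b j) then N x y else 0) * 4 ^+ i * 4 ^+ j.
have w0 i j x y : 0 <= w i j x y.
  by rewrite /w !mulr_ge0 ?exprn_ge0 //; case: ifP.
pose S1 x y := \sum_i \sum_(j | J1 i j) w i j x y.
pose S2 x y := \sum_j \sum_(i | J2 i j) w i j x y.
have S10 x y : 0 <= S1 x y by apply: sumr_ge0 => i _; apply: sumr_ge0.
have S20 x y : 0 <= S2 x y by apply: sumr_ge0 => i _; apply: sumr_ge0.
have sqlt (v : 'I_n -> R) x : (forall x, 0 <= v x) -> \sum_x v x ^+ 2 <= n%:R -> v x < 4 ^+ n.
  move=> v0 hv; rewrite ltNge; apply/negP => h.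
  have h2 : n%:R < 4 ^+ n :> R by rewrite -natrX ltr_nat ltn_expl.
  have h3 : v x ^+ 2 <= n%:R.
    by apply: le_trans hv; rewrite (bigD1 x) //= lerDl sumr_ge0 // => y _; rewrite sqr_ge0.
  have h4 : 1 <= (4 : R) ^+ n by rewrite exprn_ege1 //; lra.
  have : v x <= v x ^+ 2 by rewrite expr2 ler_peMr //; exact: le_trans h4 h.
  lra.
have point x y : D < a x * b y ->
    a x * b y * N x y <= a x ^+ 2 / D * N x y + b y ^+ 2 / D * N x y + (S1 x y + S2 x y).
  move=> hD; have q1 : 0 <= a x ^+ 2 / D * N x y by rewrite !mulr_ge0 ?invr_ge0 ?sqr_ge0 ?(ltW D0).
  have q2 : 0 <= b y ^+ 2 / D * N x y by rewrite !mulr_ge0 ?invr_ge0 ?sqr_ge0 ?(ltW D0).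
  have := S10 x y; have := S20 x y => q3 q4.
  have [h|h1] := leP (b y * D) (a x).
    suff : a x * b y * N x y <= a x ^+ 2 / D * N x y by lra.
    by rewrite ler_wpM2r // expr2 -mulrA ler_wpM2l // ler_pdivlMr.
  have [h|h2] := leP (a x * D) (b y).
    suff : a x * b y * N x y <= b y ^+ 2 / D * N x y by lra.
    by rewrite ler_wpM2r // expr2 mulrC -mulrA ler_wpM2l // ler_pdivlMr.
  have ax0 : 0 < a x.
    by rewrite lt_def a0 andbT; apply: contraTneq hD => ->; rewrite mul0r -leNgt ltW.
  have by0 : 0 < b y.
    by rewrite lt_def b0 andbT; apply: contraTneq hD => ->; rewrite mulr0 -leNgt ltW.
  have a1 : 1 <= a x.
    rewrite leNgt; apply/negP => h; have := ltr_pM2l ax0 (b y) (a x * D).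
    rewrite h2 => /esym; have : a x * (a x * D) <= D by nra.
    lra.
  have b1 : 1 <= b y.
    rewrite leNgt; apply/negP => h; have := ltr_pM2r by0 (a x) (b y * D).
    rewrite h1 => /esym; have : b y * D * b y <= D by nra.
    lra.
  have [i hi] := level_exists a1 (sqlt a x a0 ha).
  have [j hj] := level_exists b1 (sqlt b y b0 hb).
  have xA : x \in A a i by rewrite inE.
  have yB : y \in A b j by rewrite inE.
  move: (hi) (hj); rewrite !exprS => /andP[i1 i2] /andP[j1 j2].
  have s0 : 0 < (4 : R) ^+ i by rewrite exprn_gt0.
  have t0 : 0 < (4 : R) ^+ j by rewrite exprn_gt0.
  have ab16 : a x * b y <= 16 * 4 ^+ i * 4 ^+ j.
    apply: le_trans (_ : (4 * 4 ^+ i) * (4 * 4 ^+ j) <= _);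
      last by rewrite le_eqVlt; apply/orP; left; apply/eqP; ring.
    by apply: ler_pM => //; exact: ltW.
  have hJ : J i j.
    apply/and5P; split; first exact: lt_le_trans ab16.
    - apply: le_lt_trans i1 _; apply: lt_trans h1 _; nra.
    - apply: le_lt_trans j1 _; apply: lt_trans h2 _; nra.
    - by apply/card_gt0P; exists x.
    - by apply/card_gt0P; exists y.
  have hw : a x * b y * N x y <= w i j x y.
    rewrite /w xA yB /=; have -> : 16 * N x y * 4 ^+ i * 4 ^+ j = 16 * 4 ^+ i * 4 ^+ j * N x y by ring.
    by rewrite ler_wpM2r.
  have [m1|/ltnW m2] := leqP #|A a i| #|A b j|.
    suff : w i j x y <= S1 x y by lra.
    rewrite /S1 (bigD1 i) //= (bigD1 j) /= ?/J1 ?hJ //= -addrA lerDl.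
    by rewrite addr_ge0 //; do ?[apply: sumr_ge0 => ? _].
  suff : w i j x y <= S2 x y by lra.
  rewrite /S2 (bigD1 j) //= (bigD1 i) /= ?/J2 ?hJ //= -addrA lerDl.
  by rewrite addr_ge0 //; do ?[apply: sumr_ge0 => ? _].
apply: le_trans (_ : \sum_x \sum_y (a x ^+ 2 / D * N x y + b y ^+ 2 / D * N x y + (S1 x y + S2 x y)) <= _).
  apply: ler_sum => x _; rewrite big_mkcond; apply: ler_sum => y _; case: ifP => [/point //|_].
  by rewrite !addr_ge0 // !mulr_ge0 ?invr_ge0 ?sqr_ge0 ?(ltW D0).
have deg (N' : 'M[R]_n) (v : 'I_n -> R) : (forall x, 0 <= v x) -> \sum_x v x ^+ 2 <= n%:R ->
    (forall x, 0 < v x -> \sum_y N' x y <= C1 * D ^+ 2) ->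
    \sum_x \sum_y v x ^+ 2 / D * N' x y <= C1 * D * n%:R.
  move=> v0 hv hN'; apply: le_trans (_ : \sum_x v x ^+ 2 * (C1 * D) <= _); last first.
    by rewrite -mulr_suml mulrC ler_wpM2l // mulr_ge0 // ltW.
  apply: ler_sum => x _; rewrite -mulr_sumr.
  have := v0 x; rewrite le_eqVlt => /orP[/eqP <-|vx]; first by rewrite expr0n /= !mul0r.
  have -> : C1 * D = D^-1 * (C1 * D ^+ 2) by field; rewrite lt0r_neq0.
  rewrite -mulrA ler_wpM2l ?sqr_ge0 // ler_wpM2l ?invr_ge0 ?(ltW D0) //; exact: hN'.
have B1 := deg N a a0 ha hrow.
have B2 : \sum_x \sum_y b y ^+ 2 / D * N x y <= C1 * D * n%:R.
  rewrite exchange_big /=.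
  have := deg N^T b b0 hb; under [X in X <= _]eq_bigr do under eq_bigr do rewrite mxE.
  by apply => y /hcol; under [X in _ -> X <= _]eq_bigr do rewrite mxE.
have ha' := le_trans (level_sq_sum_le n a0) ha.
have hb' := le_trans (level_sq_sum_le n b0) hb.
have we0 (N' : 'M[R]_n) X Y : (forall x y, 0 <= N' x y) -> 0 <= weight_between N' X Y.
  by move=> h; apply: sumr_ge0 => x _; apply: sumr_ge0.
have sumw i j : \sum_x \sum_y w i j x y = 16 * (weight_between N (A a i) (A b j) * 4 ^+ i * 4 ^+ j).
  rewrite /weight_between [in RHS]big_mkcond /= !mulr_suml mulr_sumr; apply: eq_bigr => x _.
  case: ifP => hx.
    rewrite [in RHS]big_mkcond /= !mulr_suml mulr_sumr; apply: eq_bigr => y _.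
    by rewrite /w hx /=; case: ifP => _; ring.
  by rewrite !mul0r mulr0 big1 // => y _; rewrite /w hx /= mulr0 !mul0r.
have B3 : \sum_x \sum_y S1 x y <= 16 * ((16 * C2 + 40 * C3 + 2 * expR 1) * D * n%:R).
  have -> : \sum_x \sum_y S1 x y = 16 * \sum_i \sum_(j | J1 i j)
      weight_between N (A a i) (A b j) * 4 ^+ i * 4 ^+ j.
    rewrite /S1; under eq_bigr do rewrite exchange_big /=.
    rewrite exchange_big mulr_sumr /=; apply: eq_bigr => i _.
    under eq_bigr do rewrite exchange_big /=.
    rewrite exchange_big mulr_sumr /=; apply: eq_bigr => j _; exact: sumw.
  rewrite ler_pM2l //.
  apply: (heavy_levels_le nR D1 C2e C30 (fun i j => we0 N _ _ N0) ha' hb') => i j.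
  move=> /andP[/and5P[h1 h2 h3 h4 h5] h6]; split=> //; exact: hd.
have B4 : \sum_x \sum_y S2 x y <= 16 * ((16 * C2 + 40 * C3 + 2 * expR 1) * D * n%:R).
  have -> : \sum_x \sum_y S2 x y = 16 * \sum_j \sum_(i | J2 i j)
      weight_between N^T (A b j) (A a i) * 4 ^+ j * 4 ^+ i.
    rewrite /S2; under eq_bigr do rewrite exchange_big /=.
    rewrite exchange_big mulr_sumr /=; apply: eq_bigr => j _.
    under eq_bigr do rewrite exchange_big /=.
    rewrite exchange_big mulr_sumr /=; apply: eq_bigr => i _; rewrite sumw.
    rewrite -!mulrA [4 ^+ i * _]mulrC; congr (_ * (_ * _)).
    exact/esym/weight_between_tr.
  rewrite ler_pM2l //.
  have Nt0 x y : 0 <= N^T x y by rewrite mxE.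
  apply: (heavy_levels_le (J := fun j i => J2 i j) nR D1 C2e C30 (fun i j => we0 N^T _ _ Nt0) hb' ha') => j i.
  move=> /andP[/and5P[h1 h2 h3 h4 h5] h6]; split=> //; last exact: hdt.
  by rewrite mulrAC.
under eq_bigr do rewrite !big_split /=.
rewrite !big_split /=; lra.
Qed.

End HeavySum.

(** * Operator bounds from a finite net *)

Section Net.
Context {R : realType}.

Definition bilin n (E : 'M[R]_n) (u v : 'I_n -> R) : R :=
  \sum_x \sum_y u x * v y * E x y.

Lemma bilinDl n (E : 'M[R]_n) (u1 u2 v : 'I_n -> R) :
  bilin E (fun x => u1 x + u2 x) v = bilin E u1 v + bilin E u2 v.
Proof.
rewrite /bilin -big_split; apply: eq_bigr => x _; rewrite -big_split.
by apply: eq_bigr => y _; rewrite !mulrDl.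
Qed.

Lemma bilinDr n (E : 'M[R]_n) (u v1 v2 : 'I_n -> R) :
  bilin E u (fun x => v1 x + v2 x) = bilin E u v1 + bilin E u v2.
Proof.
rewrite /bilin -big_split; apply: eq_bigr => x _; rewrite -big_split.
by apply: eq_bigr => y _; rewrite mulrDr mulrDl.
Qed.

Lemma bilinZl n (E : 'M[R]_n) (c : R) (u v : 'I_n -> R) :
  bilin E (fun x => c * u x) v = c * bilin E u v.
Proof.
rewrite /bilin mulr_sumr; apply: eq_bigr => x _; rewrite mulr_sumr.
by apply: eq_bigr => y _; rewrite !mulrA.
Qed.

Lemma bilin_tr n (E : 'M[R]_n) (u v : 'I_n -> R) : bilin E^T u v = bilin E v u.
Proof.
rewrite /bilin exchange_big; apply: eq_bigr => x _; apply: eq_bigr => y _.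
by rewrite mxE [u y * _]mulrC.
Qed.

Lemma bilinZr n (E : 'M[R]_n) (c : R) (u v : 'I_n -> R) :
  bilin E u (fun x => c * v x) = c * bilin E u v.
Proof. by rewrite -bilin_tr bilinZl bilin_tr. Qed.

(** Lattice of mesh [1 / (4 * sqrt n)], each coordinate coded by a sign and a magnitude. In the unit
    ball magnitudes are at most [4 * sqrt n], hence at most [4 * n]; [in_ball] is the condition of
    norm at most 1 with denominators cleared. *)
Definition grid (n : nat) : finType := {ffun 'I_n -> bool * 'I_(4 * n).+1}.

Definition grid_vec n (g : grid n) (x : 'I_n) : R :=
  (-1) ^+ (g x).1 * ((g x).2%:R / (4 * Num.sqrt n%:R)).

Definition in_ball n (g : grid n) : bool := (\sum_x (g x).2 ^ 2 <= 16 * n)%N.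

(** Since [k <= k ^ 2], each grid point of the ball has weight at least
    [2 ^- (16 n)] when every coordinate [k] is weighted by [2 ^- k]. *)
Lemma card_ball n : #|[set g : grid n | in_ball g]%SET|%:R <= (2 : R) ^+ (18 * n).
Proof.
have -> : (2 : R) ^+ (18 * n) = 2 ^+ (16 * n) * \prod_(x < n) (4 : R).
  rewrite prodr_const card_ord (_ : 18 * n = 16 * n + 2 * n)%N; last lia.
  by rewrite exprD; congr (_ * _); rewrite exprM -natrX.
have sum4 : \sum_(bk : bool * 'I_(4 * n).+1) (2 ^+ bk.2)^-1 <= 4 :> R.
  rewrite -(pair_bigA _ (fun (b : bool) (k : 'I_(4 * n).+1) => (2 ^+ k)^-1)) /= big_bool /=.
  have := @inv_geometric_sum_le R (4 * n).+1 2 (lexx _); lra.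
apply: le_trans (_ : 2 ^+ (16 * n) * \prod_(x < n)
    \sum_(bk : bool * 'I_(4 * n).+1) (2 ^+ bk.2)^-1 <= _); last first.
  rewrite ler_wpM2l ?exprn_ge0 //; apply: ler_prod => x _.
  by rewrite sum4 andbT; apply: sumr_ge0 => bk _; rewrite invr_ge0 exprn_ge0.
rewrite bigA_distr_bigA /= mulr_sumr -sum1_card natr_sum big_mkcond /=.
apply: ler_sum => g _; rewrite inE prodfV -expr_sum; case: ifP => [hg|_]; last first.
  by rewrite mulr_ge0 ?invr_ge0 ?exprn_ge0.
rewrite ler_pdivlMr ?exprn_gt0 // mul1r ler_eXn2l ?ltr1n //.
apply: leq_trans hg; apply: leq_sum => x _; case: (nat_of_ord _) => // k.
by rewrite expnS leq_pmulr.
Qed.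

Lemma grid_vec_sq_sum n (g : grid n) : (0 < n)%N -> in_ball g ->
  \sum_x grid_vec g x ^+ 2 <= 1.
Proof.
move=> n0 hg; have nR : 0 < n%:R :> R by rewrite ltr0n.
have -> : \sum_x grid_vec g x ^+ 2 = (\sum_x (g x).2 ^ 2)%N%:R / (16 * n%:R).
  rewrite natr_sum mulr_suml; apply: eq_bigr => x _.
  rewrite /grid_vec exprMn -exprM mulnC exprM sqrrN expr1n expr1n mul1r expr_div_n natrX.
  by rewrite [(4 * _) ^+ 2]exprMn sqr_sqrtr ?ler0n // -[4 ^+ 2]natrX.
by rewrite ler_pdivrMr ?mulr_gt0 // mul1r -natrM ler_nat.
Qed.

(** Coordinates are rounded towards 0, which keeps the point in the ball; each of the [n] errors is
    at most [1 / (4 * sqrt n)]. *)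
Lemma grid_approx n (u : 'I_n -> R) : (0 < n)%N -> \sum_x u x ^+ 2 <= 1 ->
  exists2 g : grid n, in_ball g & \sum_x (u x - grid_vec g x) ^+ 2 <= 16^-1.
Proof.
move=> n0 hu; have nR : 0 < n%:R :> R by rewrite ltr0n.
set q := 4 * Num.sqrt n%:R : R.
have q0 : 0 < q by rewrite mulr_gt0 // sqrtr_gt0.
have q2 : q ^+ 2 = 16 * n%:R by rewrite exprMn sqr_sqrtr ?ler0n // -natrX.
have ux x : `|u x| <= 1.
  rewrite -(@expr_le1 _ 2) ?normr_ge0 // real_normK ?num_real //.
  by apply: le_trans hu; rewrite (bigD1 x) //= lerDl sumr_ge0 // => y _; rewrite sqr_ge0.
pose k x := Num.truncn (`|u x| * q).
have uq0 x : 0 <= `|u x| * q by rewrite mulr_ge0 // ltW.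
have kle x : (k x)%:R <= `|u x| * q by rewrite /k truncn_le.
have kgt x : `|u x| * q < (k x)%:R + 1 by have := truncnS_gt (`|u x| * q); rewrite -natr1.
have kn x : (k x < (4 * n).+1)%N.
  rewrite ltnS -(ler_nat R); apply: le_trans (kle x) _.
  apply: le_trans (_ : q <= _); first by rewrite ler_piMl // ltW.
  rewrite -ler_sqr ?nnegrE ?(ltW q0) // q2 natrM exprMn -natrX ler_wpM2l //.
  by rewrite expr2 ler_peMr ?ler0n // ler1n.
exists [ffun x => (u x < 0, Ordinal (kn x))].
  rewrite /in_ball -(ler_nat R) natr_sum natrM -q2.
  apply: le_trans (_ : \sum_x (u x ^+ 2 * q ^+ 2) <= _); last first.
    by rewrite -mulr_suml ler_piMl // sqr_ge0.
  apply: ler_sum => x _; rewrite ffunE /= natrX -exprMn.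
  rewrite -[leRHS]real_normK ?num_real // normrM (gtr0_norm q0).
  by rewrite ler_sqr ?nnegrE.
apply: le_trans (_ : \sum_(x < n) q^-1 ^+ 2 <= _); last first.
  rewrite sumr_const card_ord exprVn q2 -[X in X <= _]mulr_natr invfM -mulrA mulVf ?mulr1 //.
  exact: lt0r_neq0.
apply: ler_sum => x _; rewrite /grid_vec ffunE /= -/q.
have uE : u x = (-1) ^+ (u x < 0)%R * `|u x| by exact: numEsign.
rewrite {1}uE -mulrBr exprMn -exprM mulnC exprM sqrrN !expr1n mul1r.
have := kle x; rewrite -ler_pdivrMr // => h1.
have := kgt x; rewrite -ltr_pdivlMr // mulrDl mul1r => h2.
rewrite ler_sqr ?nnegrE ?invr_ge0 ?(ltW q0) //; lra.
Qed.

(** For the supremum [S] over the ball, approximating both vectors within 1/4 gives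
    [S <= eta + S / 4 + S / 4]. The proof iterates this inequality from the crude bound [B], halving
    the excess each time, instead of forming a supremum. *)
Lemma bilin_net n (E : 'M[R]_n) (eta : R) : (0 < n)%N ->
  (forall g1 g2 : grid n, in_ball g1 -> in_ball g2 ->
     bilin E (grid_vec g1) (grid_vec g2) <= eta) ->
  forall u v, \sum_x u x ^+ 2 <= 1 -> \sum_x v x ^+ 2 <= 1 -> bilin E u v <= 2 * eta.
Proof.
move=> n0 hg.
have eta0 : 0 <= eta.
  pose z : grid n := [ffun=> (false, ord0)].
  have z0 : in_ball z by rewrite /in_ball big1 // => x _; rewrite ffunE.
  apply: le_trans (hg z z z0 z0); rewrite /bilin le_eqVlt; apply/orP; left; apply/eqP.
  by rewrite big1 // => x _; rewrite big1 // => y _; rewrite /grid_vec ffunE /= !(mul0r, mulr0).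
pose B := \sum_x \sum_y `|E x y|.
have step k : forall u v, \sum_x u x ^+ 2 <= 1 -> \sum_x v x ^+ 2 <= 1 ->
    bilin E u v <= 2 * eta + B / 2 ^+ k.
  elim: k => [|k IH] u v hu hv.
    apply: le_trans (_ : B <= _); last by rewrite expr0 divr1 lerDr mulr_ge0.
    have le1 (w : 'I_n -> R) x : \sum_x w x ^+ 2 <= 1 -> `|w x| <= 1.
      move=> hw; rewrite -(@expr_le1 _ 2) ?normr_ge0 // real_normK ?num_real //.
      by apply: le_trans hw; rewrite (bigD1 x) //= lerDl sumr_ge0 // => y _; rewrite sqr_ge0.
    apply: ler_sum => x _; apply: ler_sum => y _; apply: le_trans (ler_norm _) _.
    by rewrite !normrM ler_piMl // mulr_ile1 // le1.
  have [g1 b1 d1] := grid_approx n0 hu; have [g2 b2 d2] := grid_approx n0 hv.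
  have s1 := grid_vec_sq_sum n0 b1.
  set u' := grid_vec g1 in d1 s1; set v' := grid_vec g2 in d2.
  have small (w w' : 'I_n -> R) : \sum_x (w x - w' x) ^+ 2 <= 16^-1 ->
      \sum_x (4 * (w x - w' x)) ^+ 2 <= 1.
    by under [in X in _ -> X]eq_bigr do rewrite exprMn; rewrite -mulr_sumr => h; lra.
  have e1 := IH _ _ (small _ _ d1) hv; have e2 := IH _ _ s1 (small _ _ d2).
  rewrite bilinZl in e1; rewrite bilinZr in e2.
  have -> : bilin E u v = bilin E (fun x => u' x + (u x - u' x)) v.
    by congr bilin; apply/funext => x; rewrite addrC subrK.
  rewrite bilinDl.
  have -> : bilin E u' v = bilin E u' (fun x => v' x + (v x - v' x)).
    by congr bilin; apply/funext => x; rewrite addrC subrK.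
  rewrite bilinDr; have := hg g1 g2 b1 b2; rewrite -/u' -/v'.
  have -> : B / 2 ^+ k.+1 = B / 2 ^+ k / 2 by rewrite exprS invfM mulrA mulrAC.
  lra.
move=> u v hu hv; rewrite leNgt; apply/negP => h.
set c := bilin E u v in h; have c0 : 0 < c - 2 * eta by rewrite subr_gt0.
have [B0|B0] := leP B 0.
  have := step 0%N u v hu hv; rewrite expr0 divr1 -/c; lra.
pose k := Num.truncn (B / (c - 2 * eta)).
have := step k.+1 u v hu hv; rewrite -/c leNgt => /negP; apply.
rewrite addrC -ltrBrDr ltr_pdivrMr ?exprn_gt0 // mulrC -ltr_pdivrMr //.
apply: lt_trans (truncnS_gt _) _; rewrite -natrX ltr_nat; exact: ltn_expl.
Qed.

(** The form is tested at the normalizations of [z] and [z *m E]. *)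
Lemma op_le_bilin n (E : 'M[R]_n) (c : R) : 0 <= c ->
  (forall u v, \sum_x u x ^+ 2 <= 1 -> \sum_x v x ^+ 2 <= 1 -> bilin E u v <= c) ->
  op_le E c.
Proof.
move=> c0 h z; set w := z *m E.
have [z0|zn] := eqVneq (nsq z) 0.
  by rewrite z0 mulr0 /w (nsq0_eq0 z0) mul0mx /nsq big1 // => j _; rewrite mxE expr0n.
have [->|wn] := eqVneq (nsq w) 0; first by rewrite mulr_ge0 ?sqr_ge0 ?nsq_ge0.
have pos (y : 'rV[R]_n) : nsq y != 0 -> 0 < Num.sqrt (nsq y).
  by move=> y0; rewrite sqrtr_gt0 lt_def y0 nsq_ge0.
have unit (y : 'rV[R]_n) : nsq y != 0 -> \sum_x ((Num.sqrt (nsq y))^-1 * y 0 x) ^+ 2 <= 1.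
  move=> y0; under eq_bigr do rewrite exprMn.
  by rewrite -mulr_sumr -/(nsq y) exprVn sqr_sqrtr ?nsq_ge0 // mulVf.
have := h _ _ (unit _ zn) (unit _ wn); rewrite bilinZl bilinZr.
have -> : bilin E (z 0) (w 0) = nsq w.
  rewrite /bilin exchange_big; apply: eq_bigr => y _.
  under eq_bigr do rewrite mulrAC; rewrite -mulr_suml expr2; congr (_ * _).
  by rewrite mxE.
rewrite ler_pdivrMl ?pos // -{2}(sqr_sqrtr (nsq_ge0 w)) expr2 mulKf ?lt0r_neq0 ?pos //.
move=> hsq; rewrite -(sqr_sqrtr (nsq_ge0 w)) -[nsq z]sqr_sqrtr ?nsq_ge0 // -exprMn.
by rewrite ler_sqr ?nnegrE ?mulr_ge0 ?sqrtr_ge0 // mulrC.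
Qed.

End Net.

(** * Expectations over finite paths *)

Section PathExpectation.
Context {R : realType} (n : nat).
Implicit Types (mu : 'rV[R]_n) (P : 'M[R]_n) (F G : seq 'I_n -> R).

(** [path_exp P l x F] is the expectation of [F [:: X_1; ...; X_l]] for the
    chain with transition matrix [P] started at [X_0 = x]. *)
Fixpoint path_exp P (l : nat) (x : 'I_n) F : R :=
  if l is l'.+1 then \sum_y P x y * path_exp P l' y (fun s => F (y :: s))
  else F [::].

Lemma path_exp_le P l x F G : (forall x y, 0 <= P x y) -> (forall s, F s <= G s) ->
  path_exp P l x F <= path_exp P l x G.
Proof.
move=> P0; elim: l x F G => [|l IH] x F G h //=.
by apply: ler_sum => y _; rewrite ler_wpM2l // IH.
Qed.

Lemma path_exp_sum P l x (I : Type) (r : seq I) (Q : pred I) (F : I -> seq 'I_n -> R) :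
  path_exp P l x (fun s => \sum_(i <- r | Q i) F i s) =
  \sum_(i <- r | Q i) path_exp P l x (F i).
Proof.
elim: l x F => [|l IH] x F //=; rewrite exchange_big /=; apply: eq_bigr => y _.
by rewrite IH mulr_sumr.
Qed.

Lemma path_expZ P l x (c : R) F :
  path_exp P l x (fun s => c * F s) = c * path_exp P l x F.
Proof.
elim: l x F => [|l IH] x F //=; rewrite mulr_sumr; apply: eq_bigr => y _.
by rewrite IH mulrCA.
Qed.

Lemma path_expD P l x F G :
  path_exp P l x (fun s => F s + G s) = path_exp P l x F + path_exp P l x G.
Proof.
elim: l x F G => [|l IH] x F G //=; rewrite -big_split; apply: eq_bigr => y _.
by rewrite IH mulrDr.
Qed.

Lemma path_exp_cst P l x (c : R) : stochastic P -> path_exp P l x (fun=> c) = c.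
Proof.
move=> [_ P1]; elim: l x => [|l IH] x //=.
by under eq_bigr do rewrite IH; rewrite -mulr_suml P1 mul1r.
Qed.

Definition chain_exp (mu : 'rV[R]_n) P l (F : 'I_n -> seq 'I_n -> R) : R :=
  \sum_x mu 0 x * path_exp P l x (F x).

Lemma chain_exp_le mu P l (F G : 'I_n -> seq 'I_n -> R) :
  (forall x, 0 <= mu 0 x) -> (forall x y, 0 <= P x y) ->
  (forall x s, F x s <= G x s) -> chain_exp mu P l F <= chain_exp mu P l G.
Proof. by move=> mu0 P0 h; apply: ler_sum => x _; rewrite ler_wpM2l // path_exp_le. Qed.

Lemma chain_exp_sum mu P l (I : Type) (r : seq I) (Q : pred I)
    (F : I -> 'I_n -> seq 'I_n -> R) :
  chain_exp mu P l (fun x s => \sum_(i <- r | Q i) F i x s) =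
  \sum_(i <- r | Q i) chain_exp mu P l (F i).
Proof.
rewrite /chain_exp exchange_big; apply: eq_bigr => x _ /=.
by rewrite path_exp_sum mulr_sumr.
Qed.

Lemma chain_expZ mu P l (c : R) (F : 'I_n -> seq 'I_n -> R) :
  chain_exp mu P l (fun x s => c * F x s) = c * chain_exp mu P l F.
Proof.
by rewrite /chain_exp mulr_sumr; apply: eq_bigr => x _; rewrite path_expZ mulrCA.
Qed.

Lemma chain_expD mu P l (F G : 'I_n -> seq 'I_n -> R) :
  chain_exp mu P l (fun x s => F x s + G x s) = chain_exp mu P l F + chain_exp mu P l G.
Proof.
by rewrite /chain_exp -big_split; apply: eq_bigr => x _; rewrite path_expD mulrDr.
Qed.

Lemma chain_exp_cst mu P l (c : R) : \sum_x mu 0 x = 1 -> stochastic P ->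
  chain_exp mu P l (fun _ _ => c) = c.
Proof.
move=> mu1 hP; rewrite /chain_exp.
by under eq_bigr do rewrite path_exp_cst //; rewrite -mulr_suml mu1 mul1r.
Qed.

Fixpoint path_sum (f : 'I_n -> 'I_n -> R) (x : 'I_n) (s : seq 'I_n) : R :=
  if s is y :: s' then f x y + path_sum f y s' else 0.

(** Transition counts of the path [x :: s] in a form suited to induction on [s]; [count_mx_path]
    identifies them with [count_mx]. *)
Definition path_count (x : 'I_n) (s : seq 'I_n) : 'M[R]_n :=
  \matrix_(a, b) path_sum (fun x y => ((x == a) && (y == b))%:R) x s.

Lemma path_sumE f x s : path_sum f x s = \sum_a \sum_b f a b * path_count x s a b.
Proof.
elim: s x => [|y s IH] x /=.
  by rewrite big1 // => a _; rewrite big1 // => b _; rewrite mxE mulr0.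
under eq_bigr do under eq_bigr do rewrite mxE /= mulrDr.
rewrite IH; under [RHS]eq_bigr do rewrite big_split /=.
rewrite big_split /=; congr (_ + _); last first.
  by apply: eq_bigr => a _; apply: eq_bigr => b _; rewrite mxE.
rewrite (bigD1 x) //= (bigD1 y) //= !eqxx mulr1 big1 ?addr0 => [|b /negbTE yb]; last first.
  by rewrite [y == b]eq_sym yb mulr0.
rewrite big1 ?addr0 // => a /negbTE xa; rewrite big1 // => b _.
by rewrite [x == a]eq_sym xa mulr0.
Qed.

Lemma path_sum_natr (f : 'I_n -> 'I_n -> nat) x s :
  exists k : nat, path_sum (fun x y => (f x y)%:R) x s = k%:R.
Proof.
elim: s x => [|y s IH] x /=; first by exists 0%N.
by have [k ->] := IH y; exists (f x y + k)%N; rewrite natrD.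
Qed.

Lemma path_count_ge0 x s a b : 0 <= path_count x s a b.
Proof.
rewrite mxE; have [k ->] := path_sum_natr (fun x y => ((x == a) && (y == b))) x s.
exact: ler0n.
Qed.

(** Product over every second transition, beginning with the first one when [odd] is true. No two of
    its factors involve the same time. *)
Fixpoint alternate_prod (odd : bool) (w : 'I_n -> 'I_n -> R) (x : 'I_n)
    (s : seq 'I_n) : R :=
  if s is y :: s' then (if odd then w x y else 1) * alternate_prod (~~ odd) w y s'
  else 1.

Lemma expR_path_sum f (theta : R) x s : expR (theta * path_sum f x s) =
  alternate_prod true (fun x y => expR (theta * f x y)) x s *
  alternate_prod false (fun x y => expR (theta * f x y)) x s.
Proof.
elim: s x => [|y s IH] x /=; first by rewrite mulr0 expR0 mulr1.
by rewrite mulrDr expRD IH; ring.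
Qed.

Lemma alternate_prod_sqr b w x s :
  alternate_prod b w x s ^+ 2 = alternate_prod b (fun x y => w x y ^+ 2) x s.
Proof.
elim: s b x => [|y s IH] b x /=; first by rewrite expr1n.
by rewrite exprMn IH; case: b; rewrite ?expr1n.
Qed.

End PathExpectation.

(** * Exponential moments of path sums *)

Section BlockMoment.
Context {R : realType} (n K : nat) (sigma : 'I_n -> 'I_K) (p : 'M[R]_K) (pi : 'rV[R]_K).
Hypothesis p_stoch : stochastic p.
Hypothesis pi_ge0 : forall i, 0 <= pi 0 i.
Hypothesis pi_sum1 : \sum_i pi 0 i = 1.
Hypothesis cluster_gt0 : forall a, (0 < #|cluster_set sigma a|)%N.

Let P := bmc_transition sigma p.
Let mu := bmc_stationary sigma pi.
Let V a := cluster_set sigma a.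

Lemma cluster_natr_gt0 a : 0 < #|V a|%:R :> R.
Proof. by rewrite ltr0n. Qed.

Lemma bmc_transition_ge0 x y : 0 <= P x y.
Proof. by case: p_stoch => p0 _; rewrite mxE divr_ge0. Qed.

Lemma bmc_stationary_ge0 x : 0 <= mu 0 x.
Proof. by rewrite mxE divr_ge0. Qed.

Lemma sum_clusters (g : 'I_K -> R) (G : 'I_n -> R) :
  \sum_y g (sigma y) / #|V (sigma y)|%:R * G y =
  \sum_b g b * ((\sum_(y in V b) G y) / #|V b|%:R).
Proof.
rewrite (partition_big sigma xpredT) //=; apply: eq_bigr => b _.
rewrite mulr_suml mulr_sumr; apply: eq_big => [y|y /eqP ->]; first by rewrite inE.
by rewrite -mulrA [_^-1 * _]mulrC.
Qed.

Lemma bmc_transition_sum x (G : 'I_n -> R) :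
  \sum_y P x y * G y = \sum_b p (sigma x) b * ((\sum_(y in V b) G y) / #|V b|%:R).
Proof. by rewrite -sum_clusters; apply: eq_bigr => y _; rewrite mxE. Qed.

Lemma bmc_stationary_sum (G : 'I_n -> R) :
  \sum_x mu 0 x * G x = \sum_b pi 0 b * ((\sum_(y in V b) G y) / #|V b|%:R).
Proof. by rewrite -sum_clusters; apply: eq_bigr => y _; rewrite mxE. Qed.

Lemma cluster_mean_cst a : (\sum_(y in V a) 1) / #|V a|%:R = 1 :> R.
Proof. by rewrite sumr_const divff // lt0r_neq0 // cluster_natr_gt0. Qed.

Lemma bmc_transition_stochastic : stochastic P.
Proof.
split=> [x y|x]; first exact: bmc_transition_ge0.
have := bmc_transition_sum x (fun=> 1); under eq_bigr do rewrite mulr1; move=> ->.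
by under eq_bigr do rewrite cluster_mean_cst mulr1; case: p_stoch.
Qed.

Lemma bmc_stationary_sum1 : \sum_x mu 0 x = 1.
Proof.
have := bmc_stationary_sum (fun=> 1); under eq_bigr do rewrite mulr1; move=> ->.
by under eq_bigr do rewrite cluster_mean_cst mulr1.
Qed.

Lemma convex_le (q : 'I_K -> R) (G : 'I_K -> R) (c : R) : (forall b, 0 <= q b) ->
  \sum_b q b = 1 -> (forall b, G b <= c) -> \sum_b q b * G b <= c.
Proof.
move=> q0 q1 h; rewrite -[leRHS]mul1r -q1 mulr_suml.
by apply: ler_sum => b _; rewrite ler_wpM2l.
Qed.

(** Given the clusters visited, the states are independent and uniform on those
    clusters; hence every second transition contributes a factor at most [c]. *)
Lemma alternate_prod_exp_le (w : 'I_n -> 'I_n -> R) (c : R) l :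
  1 <= c -> (forall x y, 0 <= w x y) ->
  (forall a b, \sum_(x in V a) \sum_(y in V b) w x y <= c * (#|V a|%:R * #|V b|%:R)) ->
  (forall a, (\sum_(x in V a) path_exp P l x (alternate_prod true w x)) / #|V a|%:R <= c ^+ l)
  /\ (forall x, path_exp P l x (alternate_prod false w x) <= c ^+ l).
Proof.
move=> c1 w0 hw; have [p0 p1] := p_stoch; have c0 : 0 <= c by lra.
(* The first statement averages over a cluster because its first factor involves [x] itself; the
   second can fix [x], since the next state is uniform on its cluster. *)
elim: l => [|l [IHe IHo]].
  split=> [a|x] //=; by rewrite cluster_mean_cst expr0.
have cl : c ^+ l <= c ^+ l.+1 by rewrite exprS ler_peMl ?exprn_ge0.
have expE b x : path_exp P l.+1 x (alternate_prod b w x) =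
    \sum_y P x y * ((if b then w x y else 1) * path_exp P l y (alternate_prod (~~ b) w y)).
  by rewrite /=; apply: eq_bigr => y _; rewrite path_expZ.
split=> [a|x]; last first.
  rewrite expE; under eq_bigr do rewrite /= mul1r.
  rewrite bmc_transition_sum; apply: le_trans cl.
  by apply: (@convex_le (p (sigma x))) => // b; exact: IHe.
under eq_bigr do rewrite expE bmc_transition_sum /=.
have -> : \sum_(x in V a) \sum_b p (sigma x) b *
      ((\sum_(y in V b) w x y * path_exp P l y (alternate_prod false w y)) / #|V b|%:R) =
    \sum_b p a b * (\sum_(x in V a)
      ((\sum_(y in V b) w x y * path_exp P l y (alternate_prod false w y)) / #|V b|%:R)).
  rewrite exchange_big /=; apply: eq_bigr => b _; rewrite mulr_sumr.
  by apply: eq_bigr => x; rewrite inE => /eqP ->.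
rewrite mulr_suml; under eq_bigr do rewrite -mulrA.
apply: (@convex_le (p a)) => // b.
rewrite ler_pdivrMr ?cluster_natr_gt0 // -mulr_suml ler_pdivrMr ?cluster_natr_gt0 //.
apply: le_trans (_ : c ^+ l * (c * (#|V a|%:R * #|V b|%:R)) <= _); last first.
  by rewrite le_eqVlt; apply/orP; left; apply/eqP; rewrite exprS; ring.
apply: le_trans (ler_wpM2l _ (hw a b)); last by rewrite exprn_ge0.
rewrite mulr_sumr; apply: ler_sum => x _; rewrite mulr_sumr; apply: ler_sum => y _.
by rewrite mulrC ler_wpM2r.
Qed.

(** Adjacent transitions share a state, so their factors cannot be averaged separately. Splitting by
    parity removes this at the price of doubling [theta] in the hypothesis. *)
Lemma block_mgf_le (f : 'I_n -> 'I_n -> R) (theta c : R) l : 1 <= c ->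
  (forall a b, \sum_(x in V a) \sum_(y in V b) expR (2 * theta * f x y)
     <= c * (#|V a|%:R * #|V b|%:R)) ->
  chain_exp mu P l (fun x s => expR (theta * path_sum f x s)) <= c ^+ l.
Proof.
move=> c1 hf; pose w x y := expR (2 * theta * f x y).
have wE x y : expR (theta * f x y) ^+ 2 = w x y.
  by rewrite /w -expRM_natl mulrA.
have [he ho] := alternate_prod_exp_le l c1 (fun x y => expR_ge0 _ : 0 <= w x y) hf.
apply: le_trans (_ : chain_exp mu P l (fun x s => 2^-1 * alternate_prod true w x s +
    2^-1 * alternate_prod false w x s) <= _).
  apply: chain_exp_le => [||x s]; [exact: bmc_stationary_ge0|exact: bmc_transition_ge0|].
  (* AM-GM separates the transitions of even and of odd index. *)
  rewrite expR_path_sum.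
  have sq b : alternate_prod b w x s =
      alternate_prod b (fun x y => expR (theta * f x y)) x s ^+ 2.
    rewrite alternate_prod_sqr; congr alternate_prod; apply/funext => a; apply/funext => b'.
    by rewrite wE.
  rewrite !sq; set A := alternate_prod _ _ _ _; set B := alternate_prod _ _ _ _.
  have := sqr_ge0 (A - B); lra.
rewrite chain_expD !chain_expZ.
have E1 : chain_exp mu P l (alternate_prod true w) <= c ^+ l.
  rewrite /chain_exp bmc_stationary_sum; exact: (@convex_le (pi 0)).
have E2 : chain_exp mu P l (alternate_prod false w) <= c ^+ l.
  rewrite /chain_exp bmc_stationary_sum; apply: (@convex_le (pi 0)) => // b.
  rewrite ler_pdivrMr ?cluster_natr_gt0 // -sum1_card natr_sum mulr_sumr.
  by apply: ler_sum => x _; rewrite mulr1.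
lra.
Qed.

Definition chain_prob l (Q : 'I_n -> seq 'I_n -> bool) : R :=
  chain_exp mu P l (fun x s => (Q x s)%:R).

Lemma chain_prob_le_exp l (Q : 'I_n -> seq 'I_n -> bool) F :
  (forall x s, 0 <= F x s) -> (forall x s, Q x s -> 1 <= F x s) ->
  chain_prob l Q <= chain_exp mu P l F.
Proof.
move=> F0 h; apply: chain_exp_le => [||x s].
- exact: bmc_stationary_ge0.
- exact: bmc_transition_ge0.
- by have := h x s; case: (Q x s) => // ->.
Qed.

Lemma chain_prob_union l (I : Type) (r : seq I) (S : pred I)
    (Q : I -> 'I_n -> seq 'I_n -> bool) (Q' : 'I_n -> seq 'I_n -> bool) :
  (forall x s, Q' x s -> has (fun i => S i && Q i x s) r) ->
  chain_prob l Q' <= \sum_(i <- r | S i) chain_prob l (Q i).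
Proof.
move=> h; rewrite /chain_prob -chain_exp_sum; apply: chain_prob_le_exp => x s.
  exact: sumr_ge0.
move=> /h; elim: r {h} => [//|i r IH] /=; rewrite big_cons.
case: (S i) => //= /orP[->|/IH h]; last by rewrite (le_trans h) // lerDr.
by rewrite lerDl; apply: sumr_ge0.
Qed.

Lemma block_chernoff (f : 'I_n -> 'I_n -> R) (theta c t : R) l :
  0 <= theta -> 0 <= c ->
  (forall a b, \sum_(x in V a) \sum_(y in V b) expR (2 * theta * f x y)
     <= (1 + c) * (#|V a|%:R * #|V b|%:R)) ->
  chain_prob l (fun x s => t <= path_sum f x s) <= expR (l%:R * c - theta * t).
Proof.
move=> th0 c0 hf.
apply: le_trans (_ : chain_exp mu P l (fun x s =>
    expR (- (theta * t)) * expR (theta * path_sum f x s)) <= _).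
  apply: chain_prob_le_exp => x s; first by rewrite mulr_ge0 ?expR_ge0.
  move=> ht; rewrite -expRD -expR0 ler_expR addrC subr_ge0 ler_wpM2l //.
rewrite chain_expZ expRD mulrC ler_wpM2r ?expR_ge0 //.
apply: le_trans (block_mgf_le l _ hf) _; first by rewrite lerDl.
by rewrite expRM_natl lerXn2r ?nnegrE ?expR_ge0 ?expR_ge1Dx // addr_ge0.
Qed.

End BlockMoment.

(** * Exponential inequalities and the number of small sets *)

Section ExponentialBounds.
Context {R : realType}.

(** Inverting [1 - z <= expR (- z)] leaves [(1 - z)^-1], which is at most the quadratic on this
    range. *)
Lemma expR_le_quadratic (z : R) : `|z| <= 2^-1 -> expR z <= 1 + z + 2 * z ^+ 2.
Proof.
rewrite ler_norml => /andP[z1 z2].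
have h : 1 - z <= expR (- z) by have := expR_ge1Dx (- z).
have z0 : 0 < 1 - z by lra.
apply: le_trans (_ : (1 - z)^-1 <= _).
  by rewrite -[z in expR z]opprK expRN lef_pV2 ?posrE ?expR_gt0.
rewrite -div1r ler_pdivrMr //; have := sqr_ge0 z; nra.
Qed.

Lemma expR1_le4 : expR 1 <= 4 :> R.
Proof.
have h := @expR_le_quadratic 2^-1; rewrite ger0_norm ?invr_ge0 // in h.
have {}h := h (lexx _).
have -> : expR 1 = expR 2^-1 ^+ 2 :> R by rewrite -expRM_natl divff.
have -> : (4 : R) = 2 ^+ 2 by rewrite -natrX.
by rewrite ler_sqr ?nnegrE ?expR_ge0 //; lra.
Qed.

(** With [w = b / n <= 1], each of these sets has weight [w ^+ #|A| >= w ^+ b], while all subsets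
    together weigh [(1 + w) ^+ n <= expR b]. *)
Lemma card_small_sets n b : (0 < b <= n)%N ->
  #|[set A : {set 'I_n} | (#|A| <= b)%N]%SET|%:R <= expR (b%:R * (1 + ln (n%:R / b%:R))) :> R.
Proof.
move=> /andP[b0 bn]; have n0 := leq_trans b0 bn.
have bR : 0 < b%:R :> R by rewrite ltr0n.
have nR : 0 < n%:R :> R by rewrite ltr0n.
pose w := b%:R / n%:R : R.
have w0 : 0 < w by rewrite divr_gt0.
have w1 : w <= 1 by rewrite ler_pdivrMr // mul1r ler_nat.
have -> : expR (b%:R * (1 + ln (n%:R / b%:R))) = expR b%:R / w ^+ b.
  rewrite mulrDr mulr1 expRD; congr (_ * _).
  by rewrite expRM_natl lnK ?posrE ?divr_gt0 // -exprVn invf_div.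
rewrite ler_pdivlMr ?exprn_gt0 //.
apply: le_trans (_ : (1 + w) ^+ n <= _); last first.
  have -> : b%:R = n%:R * w by rewrite /w mulrC divfK // lt0r_neq0.
  rewrite expRM_natl; apply: lerXn2r; rewrite ?nnegrE ?expR_ge0 ?expR_ge1Dx //.
  by rewrite addr_ge0 // ltW.
have -> : (1 + w) ^+ n = \sum_(A : {set 'I_n}) w ^+ #|A|.
  rewrite -[n in LHS]card_ord -prodr_const addrC.
  rewrite (bigA_distr _ _ (fun=> w) (fun=> 1)); apply: eq_bigr => A _.
  by rewrite -big_mkcond prodr_const.
rewrite -sum1_card natr_sum mulr_suml big_mkcond; apply: ler_sum => A _.
rewrite inE; case: ifP => [hA|_]; last by rewrite exprn_ge0 // ltW.
by rewrite mul1r ler_wiXn2l // ltW.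
Qed.

End ExponentialBounds.

(** * Tails for degrees and for the discrepancy property *)

Section Concentration.
Context {R : realType} (n K : nat) (sigma : 'I_n -> 'I_K) (p : 'M[R]_K) (pi : 'rV[R]_K).
Variables (l : nat) (D kappa : R).
Hypothesis n_gt0 : (0 < n)%N.
Hypothesis p_stoch : stochastic p.
Hypothesis pi_ge0 : forall i, 0 <= pi 0 i.
Hypothesis pi_sum1 : \sum_i pi 0 i = 1.
Hypothesis kappa_gt0 : 0 < kappa.
Hypothesis cluster_large : forall a, n%:R <= kappa * #|cluster_set sigma a|%:R.
Hypothesis D_ge1 : 1 <= D.
Hypothesis D_sqr : n%:R * D ^+ 2 = l%:R.

Let V a := cluster_set sigma a.
Let prob := chain_prob sigma p pi l.
Let cnt x s := path_count (R := R) x s : 'M[R]_n.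

Let nR : 0 < n%:R :> R. Proof. by rewrite ltr0n. Qed.
Let D_gt0 : 0 < D. Proof. exact: lt_le_trans ltr01 D_ge1. Qed.

Lemma cluster_nonempty a : (0 < #|V a|)%N.
Proof. by rewrite -(ltr0n R) -(pmulr_rgt0 _ kappa_gt0); exact: lt_le_trans (cluster_large a). Qed.

Let VR a : 0 < #|V a|%:R :> R. Proof. by rewrite ltr0n cluster_nonempty. Qed.

Let VV a b : n%:R ^+ 2 <= kappa ^+ 2 * (#|V a|%:R * #|V b|%:R) :> R.
Proof.
have -> : kappa ^+ 2 * (#|V a|%:R * #|V b|%:R) = (kappa * #|V a|%:R) * (kappa * #|V b|%:R) by ring.
by rewrite expr2 ler_pM // cluster_large.
Qed.

Lemma block_sum_le (F : 'I_n -> 'I_n -> R) a b : (forall x y, 0 <= F x y) ->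
  \sum_(x in V a) \sum_(y in V b) F x y <= \sum_x \sum_y F x y.
Proof.
move=> F0; rewrite [leLHS]big_mkcond; apply: ler_sum => x _; case: ifP => _.
  by rewrite [leLHS]big_mkcond; apply: ler_sum => y _; case: ifP.
exact: sumr_ge0.
Qed.

Lemma block_cst_sum a b : \sum_(x in V a) \sum_(y in V b) 1 = #|V a|%:R * #|V b|%:R :> R.
Proof.
under eq_bigr do rewrite sumr_const.
by rewrite sumr_const -[LHS]mulr_natl.
Qed.

(** Chernoff's bound for counting the transitions selected by [f]: on any block,
    [kappa ^+ 2 * M / n ^+ 2] bounds the density of [f]. *)
Lemma counting_tail (f : 'I_n -> 'I_n -> bool) (theta M t : R) :
  0 <= theta -> \sum_x \sum_y (f x y)%:R <= M ->
  prob (fun x s => t <= path_sum (fun x y => (f x y)%:R) x s)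
  <= expR (l%:R * (kappa ^+ 2 * (expR (2 * theta) - 1) * M / n%:R ^+ 2) - theta * t).
Proof.
move=> th0 hM.
have e0 : 0 <= expR (2 * theta) - 1 by rewrite subr_ge0 -expR0 ler_expR mulr_ge0.
have M0 : 0 <= M by apply: le_trans hM; apply: sumr_ge0 => x _; apply: sumr_ge0.
apply: block_chernoff => //; first exact: cluster_nonempty.
  by rewrite !mulr_ge0 ?invr_ge0 ?sqr_ge0 ?(ltW kappa_gt0).
move=> a b; apply: le_trans (_ : \sum_(x in V a) \sum_(y in V b)
    (1 + (expR (2 * theta) - 1) * (f x y)%:R) <= _).
  apply: ler_sum => x _; apply: ler_sum => y _; case: (f x y); rewrite ?mulr1 ?mulr0 ?expR0; lra.
under eq_bigr do rewrite big_split /= -mulr_sumr.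
rewrite big_split /= -mulr_sumr block_cst_sum [leRHS]mulrDl mul1r lerD2l.
apply: le_trans (_ : (expR (2 * theta) - 1) * M <= _).
  by rewrite ler_wpM2l //; apply: le_trans hM; apply: block_sum_le.
have -> : kappa ^+ 2 * (expR (2 * theta) - 1) * M / n%:R ^+ 2 * (#|V a|%:R * #|V b|%:R) =
   (expR (2 * theta) - 1) * M * (kappa ^+ 2 * (#|V a|%:R * #|V b|%:R) / n%:R ^+ 2) by ring.
by rewrite ler_peMr ?mulr_ge0 // ler_pdivlMr ?exprn_gt0 // mul1r VV.
Qed.

Let C1 : R := 6 * kappa ^+ 2 + 4.

(** At [theta = 1 / 2], [expR 1 <= 4] bounds the exponent by [3 * kappa ^+ 2 * D ^+ 2 - C1 * D ^+ 2
    / 2]; [C1] is chosen to make this [- 2 * D ^+ 2]. *)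
Lemma degree_tail y :
  prob (fun x s => C1 * D ^+ 2 <= \sum_a cnt x s a y) <= expR (- (2 * D ^+ 2)).
Proof.
have -> : prob (fun x s => C1 * D ^+ 2 <= \sum_a cnt x s a y) =
    prob (fun x s => C1 * D ^+ 2 <= path_sum (fun _ b => (b == y)%:R) x s).
  congr chain_prob; apply/funext => x; apply/funext => s; rewrite path_sumE.
  congr (_ <= _); apply: eq_bigr => a _; rewrite (bigD1 y) //= eqxx mul1r big1 ?addr0 //.
  by move=> b /negbTE ->; rewrite mul0r.
apply: le_trans (@counting_tail (fun _ b => b == y) 2^-1 n%:R _ _ _) _.
- by rewrite invr_ge0.
- apply: le_trans (_ : \sum_(x < n) 1 <= _); last by rewrite sumr_const card_ord.
  apply: ler_sum => x _; rewrite (bigD1 y) //= eqxx big1 ?addr0 // => b /negbTE.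
  by move=> ->.
rewrite ler_expR divff // -D_sqr.
have -> : n%:R * D ^+ 2 * (kappa ^+ 2 * (expR 1 - 1) * n%:R / n%:R ^+ 2) =
  D ^+ 2 * kappa ^+ 2 * (expR 1 - 1) by field; rewrite lt0r_neq0.
have : expR 1 <= 4 :> R := expR1_le4; have : 0 <= D ^+ 2 * kappa ^+ 2 by rewrite mulr_ge0 ?sqr_ge0.
rewrite /C1; nra.
Qed.

(** Markov's inequality: the mean number of such states is at most [n * expR (- 2 * D ^+ 2)]. The
    threshold is, up to rounding, the number of states that trimming removes. *)
Lemma high_degree_tail :
  prob (fun x s => n%:R * expR (- D ^+ 2) <
    #|[set y | C1 * D ^+ 2 <= \sum_a cnt x s a y]%SET|%:R) <= expR (- D ^+ 2).
Proof.
set q := n%:R * expR (- D ^+ 2).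
have q0 : 0 < q by rewrite mulr_gt0 ?expR_gt0.
pose Q y x s := C1 * D ^+ 2 <= \sum_a cnt x s a y.
apply: le_trans (_ : chain_exp (bmc_stationary sigma pi) (bmc_transition sigma p) l
   (fun x s => q^-1 * \sum_y (Q y x s)%:R) <= _).
  apply: chain_prob_le_exp => // x s; first by rewrite mulr_ge0 ?invr_ge0 ?(ltW q0) ?sumr_ge0.
  move=> /ltW h; rewrite ler_pdivlMl // mulr1; apply: le_trans h _.
  rewrite -sum1_card natr_sum big_mkcond /=; apply: ler_sum => y _.
  by rewrite inE -/(Q y x s); case: (Q y x s).
rewrite chain_expZ chain_exp_sum ler_pdivrMl //.
apply: le_trans (_ : \sum_(y < n) expR (- (2 * D ^+ 2)) <= _).
  by apply: ler_sum => y _; exact: degree_tail.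
rewrite sumr_const card_ord /q -mulrA -expRD -[leLHS]mulr_natl.
by rewrite (_ : - D ^+ 2 + - D ^+ 2 = - (2 * D ^+ 2)) //; ring.
Qed.

Let C2 : R := expR (4 * kappa ^+ 2).

(** Failure of both alternatives of [discrepancy], with [b] in place of
    [#|B| * (1 + ln (n / #|B|))]. Leaving [b] free lets the transposed case be the same event with
    the two sets exchanged. *)
Definition dense_pair (N : 'M[R]_n) (C3 : R) (A B : {set 'I_n}) (b : R) : bool :=
  let e := weight_between N A B in
  (C2 * D ^+ 2 * (#|A|%:R * #|B|%:R) / n%:R < e) &&
  (C3 * b < e * ln (e * n%:R / (D ^+ 2 * (#|A|%:R * #|B|%:R)))).

(** Chernoff's bound at [theta = L / 2], [L = ln (m0 / mu)], has exponent at most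
    [kappa ^+ 2 * m0 - m0 * L / 2]. The choice of [C2] ensures [4 * kappa ^+ 2 <= L], so this is at
    most [- m0 * L / 4], which the second condition on a bad value bounds by [- C3 * b / 4]. *)
Lemma dense_pair_tail (A B : {set 'I_n}) (C3 b : R) : (0 < #|A|)%N -> (0 < #|B|)%N ->
  prob (fun x s => dense_pair (cnt x s) C3 A B b) <= expR (- (C3 * b / 4)).
Proof.
move=> A0 B0; have AR : 0 < #|A|%:R :> R by rewrite ltr0n.
have BR : 0 < #|B|%:R :> R by rewrite ltr0n.
pose f x y := (x \in A) && (y \in B).
have eE x s : weight_between (cnt x s) A B = path_sum (fun x y => (f x y)%:R) x s.
  rewrite path_sumE /weight_between big_mkcond; apply: eq_bigr => a _; rewrite /f.
  case: (a \in A) => /=; last by rewrite big1 // => y _; rewrite mul0r.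
  by rewrite big_mkcond; apply: eq_bigr => y _; case: (y \in B); rewrite ?mul1r ?mul0r.
set mu := D ^+ 2 * (#|A|%:R * #|B|%:R) / n%:R.
have mu0 : 0 < mu by rewrite !mulr_gt0 ?invr_gt0 ?exprn_gt0.
pose bad (m : nat) := (C2 * mu < m%:R) && (C3 * b < m%:R * ln (m%:R / mu)).
have badE x s (m : nat) : weight_between (cnt x s) A B = m%:R ->
    dense_pair (cnt x s) C3 A B b = bad m.
  rewrite /dense_pair => ->; rewrite /bad /mu !mulrA; congr (_ && (_ < _ * ln _)).
  by field; rewrite !lt0r_neq0.
have [ex|nex] := pselect (exists m, bad m); last first.
  apply: le_trans (expR_ge0 _).
  rewrite (_ : (fun x s => _) = (fun _ _ => false)); last first.
    apply/funext => x; apply/funext => s; apply/negbTE/negP.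
    have [m hm] := path_sum_natr (R := R) f x s.
    by rewrite (badE _ _ m) ?eE // => hb; apply: nex; exists m.
  by rewrite /prob /chain_prob /chain_exp big1 // => x _; rewrite path_exp_cst ?mulr0 //;
    exact/bmc_transition_stochastic/cluster_nonempty.
(* Taking the least bad value [m0] turns the event into an upper tail without using
   that [m * ln (m / mu)] is monotone in [m]. *)
pose m0 := ex_minn ex.
have [bad0 min0] : bad m0 /\ forall m, bad m -> (m0 <= m)%N by rewrite /m0; case: ex_minnP.
have /andP[b1 b2] := bad0.
have m0R : 0 < m0%:R :> R by apply: lt_trans b1; exact: mulr_gt0 (expR_gt0 _) mu0.
set L := ln (m0%:R / mu) in b2.
have L4 : 4 * kappa ^+ 2 <= L.
  rewrite -[leLHS]expRK ler_ln ?posrE ?expR_gt0 ?(divr_gt0 m0R mu0) //.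
  by rewrite ler_pdivlMr // ltW.
have k20 : 0 <= kappa ^+ 2 by rewrite sqr_ge0.
apply: le_trans (_ : prob (fun x s => m0%:R <= path_sum (fun x y => (f x y)%:R) x s :> R) <= _).
  apply: chain_prob_le_exp => // x s hd; rewrite ler1n lt0b.
  have [m hm] := path_sum_natr (R := R) f x s.
  by rewrite hm ler_nat min0 // -(badE x s) ?eE.
apply: le_trans (@counting_tail f (L / 2) (#|A|%:R * #|B|%:R) _ _ _) _.
- by rewrite divr_ge0 // (le_trans _ L4) // mulr_ge0.
- rewrite -sum1_card -[#|B|]sum1_card !natr_sum [in leRHS]big_mkcond mulr_suml.
  apply: ler_sum => x _; rewrite [in leRHS]big_mkcond mulr_sumr; apply: ler_sum => y _.
  by rewrite /f; case: (x \in A); case: (y \in B); rewrite ?mulr1 ?mulr0.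
rewrite ler_expR (_ : 2 * (L / 2) = L); last by field.
rewrite lnK ?posrE ?(divr_gt0 m0R mu0) // -D_sqr.
have -> : n%:R * D ^+ 2 * (kappa ^+ 2 * (m0%:R / mu - 1) * (#|A|%:R * #|B|%:R) / n%:R ^+ 2) =
   kappa ^+ 2 * m0%:R - kappa ^+ 2 * mu.
  by rewrite /mu; field; rewrite !lt0r_neq0.
have : 0 <= kappa ^+ 2 * mu by rewrite mulr_ge0 // ltW.
have : m0%:R * (4 * kappa ^+ 2) <= m0%:R * L by rewrite ler_pM2l.
lra.
Qed.

(** Union bound. For [b = #|B|] the constant 24 gives the tail [expR (- 6 * Z b)]; the choices of
    [A] and of [B] cost a factor [expR (Z b)] each, and what remains is below [expR (- 2 * Z b)],
    hence below [n ^- 2]. Summing over the [n] sizes leaves [1 / n] for each of [N] and [N^T]. *)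
Lemma discrepancy_tail :
  prob (fun x s => ~~ `[< discrepancy (cnt x s) D C2 24 >]
     || ~~ `[< discrepancy (cnt x s)^T D C2 24 >]) <= 2 / n%:R.
Proof.
pose Z b := b%:R * (1 + ln (n%:R / b%:R)) : R.
pose g (b : nat) := expR (- (6 * Z b)).
pose S (AB : {set 'I_n} * {set 'I_n}) := (0 < #|AB.1|)%N && (#|AB.1| <= #|AB.2|)%N.
pose Q (AB : {set 'I_n} * {set 'I_n}) x s := dense_pair (cnt x s) 24 AB.1 AB.2 (Z #|AB.2|).
pose Q' (AB : {set 'I_n} * {set 'I_n}) x s := dense_pair (cnt x s) 24 AB.2 AB.1 (Z #|AB.2|).
have notdisc (N : 'M[R]_n) : ~ discrepancy N D C2 24 ->
    exists AB, S AB && dense_pair N 24 AB.1 AB.2 (Z #|AB.2|).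
  move=> h; apply: contrapT => hn; apply: h => A B A0 AB /=.
  have [h1|h1] := leP (weight_between N A B) (C2 * D ^+ 2 * (#|A|%:R * #|B|%:R) / n%:R); first by left.
  right; rewrite leNgt; apply/negP => h2; apply: hn; exists (A, B).
  by rewrite /S /= A0 AB /= /dense_pair h1 /= /Z mulrA.
have sumle : \sum_(AB | S AB) g #|AB.2| <= n%:R^-1.
  rewrite -(pair_big_dep xpredT (fun A B : {set 'I_n} => (0 < #|A|)%N && (#|A| <= #|B|)%N)
      (fun A B : {set 'I_n} => g #|B|)) /= (exchange_big_dep xpredT) //=.
  have Zn (b : nat) : (0 < b <= n)%N -> expR (- Z b) <= n%:R^-1.
    move=> /andP[b0 bn]; have bR : 0 < b%:R :> R by rewrite ltr0n.
    rewrite expRN lef_pV2 ?posrE ?expR_gt0 // -[leLHS]lnK ?posrE // ler_expR.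
    rewrite -[n%:R in leLHS](divfK (lt0r_neq0 bR)) lnM ?posrE ?divr_gt0 //.
    rewrite /Z mulrDr mulr1 addrC; apply: lerD.
      by apply: le_trans (ln_le_sub1 bR) _; lra.
    by rewrite ler_peMl ?ler1n // ln_ge0 // ler_pdivlMr // mul1r ler_nat.
  apply: le_trans (_ : \sum_(B : {set 'I_n} | (0 < #|B|)%N) expR (- (5 * Z #|B|)) <= _).
    rewrite [leRHS]big_mkcond; apply: ler_sum => B _; case: ifPn => [B0|]; last first.
      by rewrite -eqn0Ngt => /eqP B0; rewrite big1 // => A; rewrite B0; case: (#|A|).
    have hB : (0 < #|B| <= n)%N by rewrite B0 -[leqRHS]card_ord max_card.
    apply: le_trans (_ : #|[set A : {set 'I_n} | (#|A| <= #|B|)%N]%SET|%:R * g #|B| <= _).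
      rewrite -sum1_card natr_sum mulr_suml [leLHS]big_mkcond [leRHS]big_mkcond.
      apply: ler_sum => A _; rewrite inE mul1r; case: (#|A| <= #|B|)%N; rewrite ?andbT ?andbF //.
      by case: ifP => // _; exact: expR_ge0.
    apply: le_trans (ler_wpM2r (expR_ge0 _) (card_small_sets hB)) _.
    by rewrite -/(Z #|B|) -expRD ler_expR; lra.
  rewrite (partition_big (fun B : {set 'I_n} => (inord #|B| : 'I_n.+1)) xpredT) //=.
  have cB (B : {set 'I_n}) : (#|B| < n.+1)%N by rewrite ltnS -[leqRHS]card_ord max_card.
  apply: le_trans (_ : \sum_(b < n.+1) (if (0 < b)%N then n%:R^-1 * n%:R^-1 else 0) <= _).
    apply: ler_sum => b _; case: ifPn => [b0|]; last first.
      rewrite -eqn0Ngt => /eqP b0; rewrite big1 // => B /andP[B0 /eqP/(congr1 val)].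
      by rewrite /= inordK // b0 => e; rewrite e in B0.
    have hb : (0 < b <= n)%N by rewrite b0 -ltnS ltn_ord.
    apply: le_trans (_ : #|[set A : {set 'I_n} | (#|A| <= b)%N]%SET|%:R * expR (- (5 * Z b)) <= _).
      rewrite -sum1_card natr_sum mulr_suml [leLHS]big_mkcond [leRHS]big_mkcond.
      apply: ler_sum => B _; rewrite inE mul1r; case: ifPn => [/andP[_ /eqP/(congr1 val)]|_].
        by rewrite /= inordK // => ->; rewrite leqnn.
      by case: ifP => // _; exact: expR_ge0.
    apply: le_trans (ler_wpM2r (expR_ge0 _) (card_small_sets hb)) _.
    rewrite -/(Z b) -expRD; have := Zn _ hb => hz.
    apply: le_trans (_ : expR (- Z b) * expR (- Z b) <= _); last by rewrite ler_pM ?expR_ge0.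
    have z0 : 0 <= Z b.
      rewrite mulr_ge0 // addr_ge0 // ln_ge0 // ler_pdivlMr ?ltr0n // mul1r ler_nat.
      by case/andP: hb.
    rewrite -expRD ler_expR; lra.
  rewrite big_ord_recl /= add0r; under eq_bigr do rewrite /=.
  rewrite sumr_const card_ord -[leLHS]mulr_natl mulrA divff ?mul1r //; exact: lt0r_neq0.
have pairs : \sum_(AB | S AB) prob (Q AB) + \sum_(AB | S AB) prob (Q' AB) <= 2 / n%:R.
  have tail AB : S AB -> prob (Q AB) <= g #|AB.2| /\ prob (Q' AB) <= g #|AB.2|.
    case: AB => A B /andP[/= A0 AB]; have B0 := leq_trans A0 AB.
    have -> : g #|B| = expR (- (24 * Z #|B| / 4)) by congr (expR (- _)); field.
    by split; exact: dense_pair_tail.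
  have t1 : \sum_(AB | S AB) prob (Q AB) <= n%:R^-1.
    by apply: le_trans sumle; apply: ler_sum => AB /tail[].
  have t2 : \sum_(AB | S AB) prob (Q' AB) <= n%:R^-1.
    by apply: le_trans sumle; apply: ler_sum => AB /tail[].
  lra.
apply: le_trans pairs; apply: le_trans (_ : prob (fun x s => ~~ `[< discrepancy (cnt x s) D C2 24 >]) +
    prob (fun x s => ~~ `[< discrepancy (cnt x s)^T D C2 24 >]) <= _).
  rewrite /prob /chain_prob -chain_expD; apply: chain_prob_le_exp => // x s.
  by case/orP => ->; rewrite ?lerDl ?lerDr.
apply: lerD; apply: chain_prob_union => // x s /asboolPn /notdisc [AB hAB]; apply/hasP; exists AB => //.
move: hAB; rewrite /Q' /dense_pair weight_between_tr /= => /andP[-> /=].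
by rewrite [#|AB.2|%:R * #|AB.1|%:R]mulrC.
Qed.

End Concentration.

(** * Averages over blocks *)

Section BlockMean.
Context {R : realType} (n K : nat) (sigma : 'I_n -> 'I_K).
Implicit Types (N F : 'M[R]_n).

(** The orthogonal projection onto the vectors constant on clusters. Multiplying by it on both sides
    averages over blocks, and its symmetry makes this operation self-adjoint. *)
Definition averaging_mx : 'M[R]_n :=
  \matrix_(x, y) ((sigma y == sigma x)%:R / #|cluster_set sigma (sigma x)|%:R).

Definition block_mean N : 'M[R]_n := averaging_mx *m N *m averaging_mx.

Lemma averaging_mxT : averaging_mx^T = averaging_mx.
Proof.
apply/matrixP => x y; rewrite !mxE [sigma x == _]eq_sym.
by case: eqP => [->//|_]; rewrite !mul0r.
Qed.

Lemma trace_mulT N F : \tr (F^T *m N) = \sum_x \sum_y F x y * N x y.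
Proof.
rewrite /mxtrace exchange_big; apply: eq_bigr => y _; rewrite mxE.
by apply: eq_bigr => x _; rewrite mxE.
Qed.

Lemma block_mean_adjoint N F :
  \sum_x \sum_y block_mean F x y * N x y = \sum_x \sum_y F x y * block_mean N x y.
Proof.
rewrite -!trace_mulT /block_mean !trmx_mul averaging_mxT.
by rewrite -!mulmxA mxtrace_mulC !mulmxA.
Qed.

Lemma block_meanE N x y : block_mean N x y =
  weight_between N (cluster_set sigma (sigma x)) (cluster_set sigma (sigma y)) /
  (#|cluster_set sigma (sigma x)|%:R * #|cluster_set sigma (sigma y)|%:R).
Proof.
rewrite /block_mean -mulmxA mxE /weight_between mulr_suml [in RHS]big_mkcond /=.
apply: eq_bigr => x' _; rewrite !mxE inE; case: (sigma x' == _); last by rewrite !mul0r.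
rewrite mul1r mulrC; rewrite mulr_suml [in RHS]big_mkcond mulr_suml; apply: eq_bigr => y' _.
rewrite -[averaging_mx in LHS]averaging_mxT !mxE inE; case: (sigma y' == _); last by rewrite !(mul0r, mulr0).
by rewrite mul1r -mulrA invfM [_^-1 * _]mulrC.
Qed.

Lemma block_mean_cluster N x x' y y' : sigma x = sigma x' -> sigma y = sigma y' ->
  block_mean N x y = block_mean N x' y'.
Proof. by move=> ex ey; rewrite !block_meanE ex ey. Qed.

Hypothesis cluster_gt0 : forall a, (0 < #|cluster_set sigma a|)%N.
Let V a := cluster_set sigma a.
Let VR a : 0 < #|V a|%:R :> R. Proof. by rewrite ltr0n. Qed.

Lemma block_mean_sum0 N a b :
  \sum_(x in V a) \sum_(y in V b) (N x y - block_mean N x y) = 0.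
Proof.
under eq_bigr do rewrite sumrB; rewrite sumrB -/(weight_between N (V a) (V b)).
set S := weight_between N (V a) (V b).
have -> : \sum_(x in V a) \sum_(y in V b) block_mean N x y =
    \sum_(x in V a) \sum_(y in V b) S / (#|V a|%:R * #|V b|%:R).
  apply: eq_bigr => x; rewrite inE => /eqP hx; apply: eq_bigr => y; rewrite inE => /eqP hy.
  by rewrite block_meanE hx hy.
under eq_bigr do rewrite sumr_const.
rewrite sumr_const -mulrnA -[X in _ - X]mulr_natl natrM.
apply/eqP; rewrite subr_eq0; apply/eqP; field.
by rewrite !lt0r_neq0 // VR.
Qed.

(** On a block the deviation is orthogonal to constants, so subtracting the mean lowers the sum of
    squares. *)
Lemma block_mean_sq_sum N a b :
  \sum_(x in V a) \sum_(y in V b) (N x y - block_mean N x y) ^+ 2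
    <= \sum_(x in V a) \sum_(y in V b) N x y ^+ 2.
Proof.
pose m := weight_between N (V a) (V b) / (#|V a|%:R * #|V b|%:R).
have mE x y : x \in V a -> y \in V b -> block_mean N x y = m.
  by rewrite !inE => /eqP hx /eqP hy; rewrite block_meanE hx hy.
have h0 : \sum_(x in V a) \sum_(y in V b) 2 * m * (N x y - block_mean N x y) = 0.
  under eq_bigr do rewrite -mulr_sumr; by rewrite -mulr_sumr block_mean_sum0 mulr0.
apply: le_trans (_ : \sum_(x in V a) \sum_(y in V b) (N x y - block_mean N x y) ^+ 2 +
    \sum_(x in V a) \sum_(y in V b) 2 * m * (N x y - block_mean N x y) <= _).
  by rewrite h0 addr0.
rewrite -big_split; apply: ler_sum => x hx; rewrite -big_split.
apply: ler_sum => y hy /=; rewrite mE //; have := sqr_ge0 m; nra.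
Qed.

Lemma block_mean_norm_le N (B : R) x y :
  (forall x y, `|N x y| <= B) -> `|block_mean N x y| <= B.
Proof.
move=> h; rewrite block_meanE normrM normfV normrM !normr_nat.
rewrite ler_pdivrMr ?mulr_gt0 ?VR //.
apply: le_trans (ler_norm_sum _ _ _) _.
rewrite -[#|cluster_set _ (sigma x)|]sum1_card natr_sum !mulr_suml mulr_sumr.
apply: ler_sum => x' _; apply: le_trans (ler_norm_sum _ _ _) _.
rewrite mul1r -sum1_card natr_sum mulr_sumr.
by apply: ler_sum => y' _; rewrite mulr1.
Qed.

End BlockMean.

(** * Concentration on light pairs *)

Section LightPairs.
Context {R : realType} (n K : nat) (sigma : 'I_n -> 'I_K) (p : 'M[R]_K) (pi : 'rV[R]_K).
Variables (l : nat) (D kappa : R).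
Hypothesis n_gt0 : (0 < n)%N.
Hypothesis p_stoch : stochastic p.
Hypothesis pi_ge0 : forall i, 0 <= pi 0 i.
Hypothesis pi_sum1 : \sum_i pi 0 i = 1.
Hypothesis kappa_gt0 : 0 < kappa.
Hypothesis cluster_large : forall a, n%:R <= kappa * #|cluster_set sigma a|%:R.
Hypothesis D_ge1 : 1 <= D.
Hypothesis D_sqr : n%:R * D ^+ 2 = l%:R.

Let V a := cluster_set sigma a.
Let prob := chain_prob sigma p pi l.
Let nR : 0 < n%:R :> R. Proof. by rewrite ltr0n. Qed.
Let D_gt0 : 0 < D. Proof. exact: lt_le_trans ltr01 D_ge1. Qed.
Let cl0 a : (0 < #|V a|)%N.
Proof. exact: (@cluster_nonempty _ _ _ _ kappa). Qed.
Let CL : R := kappa ^+ 2 + 296.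

Definition light_mx (u v : 'I_n -> R) : 'M[R]_n :=
  \matrix_(x, y) (if n%:R * (`|u x| * `|v y|) <= D then u x * v y else 0).

Definition light_dev (u v : 'I_n -> R) (N : 'M[R]_n) : R :=
  \sum_x \sum_y light_mx u v x y * (N - block_mean sigma N) x y.

(** Entries of [h] are at most [2 * D / n], so [theta = n / (8 * D)] keeps [2 * theta * h] within
    1/2, the range of the quadratic bound. The linear term sums to 0 on blocks, and the norms of [u]
    and [v] control the quadratic one. Since [296 = 8 * 37], the exponent is exactly [- 37 * n]. *)
Lemma light_tail (u v : 'I_n -> R) :
  \sum_x u x ^+ 2 <= 1 -> \sum_x v x ^+ 2 <= 1 ->
  prob (fun x s => CL * D <= light_dev u v (path_count x s)) <= expR (- (37 * n%:R)).
Proof.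
move=> hu hv; set F := light_mx u v.
pose h x y := F x y - block_mean sigma F x y.
have -> : prob (fun x s => CL * D <= light_dev u v (path_count x s)) =
    prob (fun x s => CL * D <= path_sum h x s).
  congr chain_prob; apply/funext => x; apply/funext => s; congr (_ <= _).
  rewrite path_sumE /light_dev -/F /h.
  under [RHS]eq_bigr do (under eq_bigr do rewrite mulrBl; rewrite sumrB).
  rewrite sumrB block_mean_adjoint -sumrB; apply: eq_bigr => a _; rewrite -sumrB.
  by apply: eq_bigr => b _; rewrite !mxE mulrBr.
have FD x y : `|F x y| <= D / n%:R.
  rewrite mxE; case: ifP => [hxy|_]; last by rewrite normr0 divr_ge0 ?ler0n ?(ltW D_gt0).
  by rewrite ler_pdivlMr // mulrC normrM.
have hD x y : `|h x y| <= 2 * (D / n%:R).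
  apply: le_trans (ler_normB _ _) _; have := FD x y.
  have := block_mean_norm_le cl0 x y FD; lra.
pose theta := n%:R / (8 * D).
have th0 : 0 <= theta by rewrite /theta divr_ge0 ?mulr_ge0 ?ler0n ?(ltW D_gt0).
pose c := kappa ^+ 2 / (8 * D ^+ 2).
have c0 : 0 <= c by apply: divr_ge0; rewrite ?sqr_ge0 // mulr_ge0 ?sqr_ge0.
apply: le_trans (@block_chernoff _ _ _ _ _ _ p_stoch pi_ge0 pi_sum1 cl0 h theta c (CL * D) l th0 c0 _) _.
  move=> a b; pose q x y := 1 + 2 * theta * h x y + 8 * theta ^+ 2 * h x y ^+ 2.
  apply: le_trans (_ : \sum_(x in V a) \sum_(y in V b) q x y <= _).
    apply: ler_sum => x _; apply: ler_sum => y _; apply: le_trans (expR_le_quadratic _) _.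
      have th2 : 0 <= 2 * theta by lra.
      rewrite normrM (ger0_norm th2); apply: le_trans (ler_wpM2l th2 (hD x y)) _.
      rewrite /theta le_eqVlt; apply/orP; left; apply/eqP; field.
      by rewrite !lt0r_neq0.
    by rewrite /q exprMn; lra.
  have -> : \sum_(x in V a) \sum_(y in V b) q x y = #|V a|%:R * #|V b|%:R +
      8 * theta ^+ 2 * \sum_(x in V a) \sum_(y in V b) h x y ^+ 2.
    under eq_bigr do rewrite !big_split /= -!mulr_sumr.
    rewrite !big_split /= -!mulr_sumr block_cst_sum block_mean_sum0 //.
    by rewrite mulr0 addr0.
  rewrite [leRHS]mulrDl mul1r lerD2l.
  have hsum : \sum_(x in V a) \sum_(y in V b) h x y ^+ 2 <= 1.
    apply: le_trans (block_mean_sq_sum cl0 F a b) _.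
    apply: le_trans (block_sum_le _ _ _ _) _; first by move=> x y; rewrite sqr_ge0.
    apply: le_trans (_ : \sum_x \sum_y u x ^+ 2 * v y ^+ 2 <= _).
      apply: ler_sum => x _; apply: ler_sum => y _; rewrite mxE -exprMn; case: ifP => // _.
      by rewrite expr0n /= sqr_ge0.
    under eq_bigr do rewrite -mulr_sumr; rewrite -mulr_suml.
    by rewrite mulr_ile1 // sumr_ge0 // => x _; rewrite sqr_ge0.
  apply: le_trans (_ : 8 * theta ^+ 2 * 1 <= _).
    by rewrite ler_wpM2l // mulr_ge0 ?sqr_ge0.
  have VV : n%:R ^+ 2 <= kappa ^+ 2 * (#|V a|%:R * #|V b|%:R) :> R.
    have -> : kappa ^+ 2 * (#|V a|%:R * #|V b|%:R) = (kappa * #|V a|%:R) * (kappa * #|V b|%:R) by ring.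
    by rewrite expr2 ler_pM // cluster_large.
  have -> : 8 * theta ^+ 2 * 1 = n%:R ^+ 2 / (8 * D ^+ 2).
    by rewrite /theta; field; rewrite lt0r_neq0.
  have -> : c * (#|V a|%:R * #|V b|%:R) = kappa ^+ 2 * (#|V a|%:R * #|V b|%:R) / (8 * D ^+ 2).
    by rewrite /c; ring.
  by rewrite ler_wpM2r // invr_ge0 mulr_ge0 ?sqr_ge0.
rewrite ler_expR -D_sqr /c /theta /CL le_eqVlt; apply/orP; left; apply/eqP; field.
by rewrite lt0r_neq0.
Qed.

Definition light_event (N : 'M[R]_n) : bool :=
  [exists gg : grid n * grid n, [&& in_ball gg.1, in_ball gg.2 &
     CL * D <= light_dev (grid_vec gg.1) (grid_vec gg.2) N]].

(** Each of the two net points costs [expR (18 * n)], and [37 = 2 * 18 + 1]. *)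
Lemma light_event_tail : prob (fun x s => light_event (path_count x s)) <= expR (- n%:R).
Proof.
pose S (gg : grid n * grid n) := in_ball gg.1 && in_ball gg.2.
pose Q (gg : grid n * grid n) x s :=
  CL * D <= light_dev (grid_vec gg.1) (grid_vec gg.2) (path_count x s).
apply: le_trans (_ : \sum_(gg | S gg) prob (Q gg) <= _).
  apply: chain_prob_union => // x s /existsP[gg /and3P[h1 h2 h3]].
  by apply/hasP; exists gg; rewrite ?mem_index_enum // /S h1 h2.
apply: le_trans (_ : \sum_(gg | S gg) expR (- (37 * n%:R)) <= _).
  apply: ler_sum => gg /andP[h1 h2].
  by apply: light_tail; exact: grid_vec_sq_sum.
rewrite -(pair_big (@in_ball n) (@in_ball n) (fun _ _ => expR (- (37 * n%:R)))) /=.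
have cb (c : R) : \sum_(g : grid n | in_ball g) c = #|[set g : grid n | in_ball g]%SET|%:R * c.
  by rewrite sumr_const -[LHS]mulr_natl; congr (_%:R * _); apply: eq_card => g; rewrite inE.
rewrite !cb.
have h2 : (2 : R) ^+ (18 * n) <= expR (18 * n%:R).
  rewrite -natrM -[X in expR X]mulr1 expRM_natl; apply: lerXn2r; rewrite ?nnegrE ?expR_ge0 //.
  by have := @expR_ge1Dx R 1; lra.
have hc := le_trans (card_ball n) h2.
apply: le_trans (_ : expR (18 * n%:R) * (expR (18 * n%:R) * expR (- (37 * n%:R))) <= _).
  by rewrite !ler_pM ?mulr_ge0 ?expR_ge0.
by rewrite -!expRD ler_expR; lra.
Qed.

End LightPairs.

(** * The Poisson equation of the cluster chain *)

Section PoissonEquation.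
Context {R : realType} (K : nat) (p : 'M[R]_K) (pi : 'rV[R]_K).
Hypothesis p_stoch : stochastic p.
Hypothesis p_irr : irreducible_mx p.
Hypothesis pi_stat : stationary_distribution p pi.

(** Maximum principle: the value at a maximum [i0] is the average of [h] under row [i0] of [p ^+ t],
    so it is attained at every state reachable from [i0] in [t] steps. *)
Lemma harmonic_cst (h : 'cV[R]_K) : p *m h = h -> forall i j, h i 0 = h j 0.
Proof.
have [p0 p1] := p_stoch => ph i j.
have pow (v : 'cV[R]_K) t : p *m v = v -> p ^+ t *m v = v.
  by move=> pv; elim: t => [|t IH]; rewrite ?expr0 ?mul1mx // exprS -mulmxE -mulmxA IH pv.
have pow0 t k l : 0 <= (p ^+ t) k l.
  elim: t k l => [|t IH] k l; first by rewrite expr0 mxE ler0n.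
  by rewrite exprS -mulmxE mxE sumr_ge0 // => m _; rewrite mulr_ge0.
have one : p *m const_mx 1 = const_mx 1 :> 'cV[R]_K.
  by apply/colP => k; rewrite !mxE -[RHS](p1 k); apply: eq_bigr => m _; rewrite mxE mulr1.
have [i0 hi0] : exists i0, forall k, h k 0 <= h i0 0.
  by case: (@arg_maxP _ _ _ i xpredT (fun k => h k 0) isT) => i0 _ H; exists i0 => k; exact: H.
suff eq0 k : h k 0 = h i0 0 by rewrite !eq0.
have [t ht] := p_irr i0 k.
have /colP/(_ i0) := pow h t ph; rewrite mxE => e1.
have /colP/(_ i0) := pow _ t one; rewrite !mxE => e2.
have : \sum_l (p ^+ t) i0 l * (h i0 0 - h l 0) = 0.
  under eq_bigr do rewrite mulrBr; rewrite sumrB e1 -mulr_suml.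
  have -> : \sum_l (p ^+ t) i0 l = 1.
    by rewrite -[RHS]e2; apply: eq_bigr => l _; rewrite mxE mulr1.
  by rewrite mul1r subrr.
move=> /eqP; rewrite psumr_eq0; last by move=> l _; rewrite mulr_ge0 ?subr_ge0.
move=> /allP/(_ k); rewrite mem_index_enum => /(_ isT) /=.
by rewrite mulf_eq0 (gt_eqF ht) /= subr_eq0 => /eqP.
Qed.

(** [A] is the inverse of the fundamental matrix of the chain. If [A] kills [v], then [pi *m A = pi]
    gives [pi *m v = 0]; so [v] is harmonic, hence constant, hence 0. *)
Lemma poisson_solution (f : 'cV[R]_K) : pi *m f = 0 -> exists g : 'cV[R]_K, g - p *m g = f.
Proof.
have [pi0 pi1 pip] := pi_stat => pif.
pose A := 1%:M - p + const_mx 1 *m pi : 'M[R]_K.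
have pi_one : pi *m const_mx 1 = 1%:M :> 'M[R]_1.
  apply/matrixP => i j; rewrite !ord1 !mxE eqxx; apply: etrans pi1.
  by apply: eq_bigr => k _; rewrite mxE mulr1.
have piA (g : 'cV[R]_K) : pi *m (A *m g) = pi *m g.
  rewrite mulmxA /A mulmxDr mulmxBr mulmx1 pip subrr add0r mulmxA pi_one mul1mx //.
have Ag (g : 'cV[R]_K) : pi *m g = 0 -> A *m g = g - p *m g.
  by move=> h; rewrite /A mulmxDl mulmxBl mul1mx -mulmxA h mulmx0 addr0.
have Au : A \in unitmx.
  rewrite -unitmx_tr -row_free_unit; apply: inj_row_free => v vA.
  have Av : A *m v^T = 0 by apply: trmx_inj; rewrite trmx_mul trmxK vA trmx0.
  have piv : pi *m v^T = 0 by rewrite -piA Av mulmx0.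
  have : v^T - p *m v^T = 0 by rewrite -Ag.
  move=> /eqP; rewrite subr_eq0 => /eqP/esym/harmonic_cst hc.
  apply/rowP => i; rewrite mxE.
  have vE : v^T = (const_mx 1 : 'cV[R]_K) *m (const_mx (v 0 i) : 'M[R]_1).
    apply/colP => k; rewrite (hc k i) !mxE big_ord1 !mxE mul1r //.
  move: piv; rewrite vE mulmxA pi_one mul1mx => /matrixP/(_ 0 0).
  by rewrite !mxE.
have AK : A *m (invmx A *m f) = f by rewrite mulmxA mulmxV // mul1mx.
by exists (invmx A *m f); rewrite -Ag // -piA AK.
Qed.

End PoissonEquation.

(** * Law of large numbers for transitions between clusters *)

Section LawOfLargeNumbers.
Context {R : realType}.

(** The increments are centred given the current state, so conditioning on the first step makes the
    cross term vanish. *)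
Lemma path_sum_martingale n (P : 'M[R]_n) (phi : 'I_n -> 'I_n -> R) (M : R) l x :
  stochastic P -> (forall x, \sum_y P x y * phi x y = 0) ->
  (forall x y, `|phi x y| <= M) ->
  path_exp P l x (path_sum phi x) = 0 /\
  path_exp P l x (fun s => path_sum phi x s ^+ 2) <= l%:R * M ^+ 2.
Proof.
move=> hP phi0 phiM; have [P0 P1] := hP.
elim: l x => [|l IH] x; first by rewrite /= expr0n /= mul0r.
split=> /=.
  transitivity (\sum_y P x y * phi x y) => //; apply: eq_bigr => y _; congr (_ * _).
  by rewrite path_expD path_exp_cst // (IH y).1 addr0.
have step y : path_exp P l y (fun s => (phi x y + path_sum phi y s) ^+ 2) =
    phi x y ^+ 2 + path_exp P l y (fun s => path_sum phi y s ^+ 2).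
  rewrite (_ : (fun s => _) = fun s => phi x y ^+ 2 + (2 * phi x y * path_sum phi y s +
    path_sum phi y s ^+ 2)); last by apply/funext => s; ring.
  by rewrite path_expD path_exp_cst // path_expD path_expZ (IH y).1 mulr0 add0r.
apply: le_trans (_ : \sum_y P x y * (M ^+ 2 + l%:R * M ^+ 2) <= _); last first.
  by rewrite -mulr_suml P1 mul1r -natr1 mulrDl mul1r addrC.
apply: ler_sum => y _; rewrite ler_wpM2l // step lerD ?(IH y).2 //.
rewrite -[leLHS]real_normK ?num_real // ler_sqr ?nnegrE //.
exact: le_trans (phiM x y).
Qed.

(** The constant is uniform in [n] and [sigma] because the corrector [g] lives on the [K]-state
    chain. Chebyshev's inequality is applied to a martingale plus a boundary term of size at most
    [2 * G], which accounts for [8 * G ^+ 2]. *)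
Lemma transition_count_lln K (p : 'M[R]_K) (pi : 'rV[R]_K) (a b : 'I_K) :
  stochastic p -> irreducible_mx p -> stationary_distribution p pi ->
  exists C : R, forall n (sigma : 'I_n -> 'I_K) l (eps : R),
    (forall a, (0 < #|cluster_set sigma a|)%N) -> (0 < l)%N -> 0 < eps ->
    chain_prob sigma p pi l (fun x s => eps * l%:R <=
      `|weight_between (path_count x s) (cluster_set sigma a) (cluster_set sigma b)
        - l%:R * (pi 0 a * p a b)|) <= C / (l%:R * eps ^+ 2).
Proof.
move=> p_stoch p_irr pi_stat; have [pi0 pi1 pip] := pi_stat; have [p0 p1] := p_stoch.
pose f : 'cV[R]_K := \col_i ((i == a)%:R - pi 0 a).
have [g hg] : exists g : 'cV[R]_K, g - p *m g = f.
  apply: (poisson_solution p_stoch p_irr pi_stat); apply/matrixP => i j.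
  rewrite !ord1 !mxE; under eq_bigr do rewrite mxE mulrBr.
  rewrite sumrB -mulr_suml pi1 mul1r (bigD1 a) //= eqxx mulr1 big1 ?addr0 ?subrr //.
  by move=> k /negbTE ->; rewrite mulr0.
pose G := \sum_k `|g k 0|.
have gG k : `|g k 0| <= G by rewrite /G (bigD1 k) //= lerDl sumr_ge0.
have pg k : (p *m g) k 0 = g k 0 - (k == a)%:R + pi 0 a.
  have /colP/(_ k) := hg; rewrite [LHS]mxE [X in _ + X]mxE [RHS]mxE; lra.
have pab1 : p a b <= 1 by rewrite -(p1 a) (bigD1 b) //= lerDl sumr_ge0.
pose M := 4 + 2 * G.
exists (2 * M ^+ 2 + 8 * G ^+ 2) => n sigma l eps cl0 l0 eps0.
have lR : 0 < l%:R :> R by rewrite ltr0n.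
set V := cluster_set sigma.
(* The increments of the martingale obtained by adding the coboundary of [p a b *: g]
   to the centred count. *)
pose phi x y : R := (sigma x == a)%:R * ((sigma y == b)%:R - p a b) +
  p a b * (g (sigma y) 0 - (p *m g) (sigma x) 0).
have phiM x y : `|phi x y| <= M.
  rewrite /phi pg; have := gG (sigma x); have := gG (sigma y).
  have pa1 : pi 0 a <= 1 by rewrite -pi1 (bigD1 a) //= lerDl sumr_ge0.
  have pa0 := pi0 a; have := p0 a b => pab0.
  rewrite !ler_norml => /andP[h1 h2] /andP[h3 h4].
  by case: (sigma x == a); case: (sigma y == b); rewrite /M /=; apply/andP; split; nra.
have P_stoch : stochastic (bmc_transition sigma p) by apply: bmc_transition_stochastic.
have phi0 x : \sum_y bmc_transition sigma p x y * phi x y = 0.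
  rewrite (bmc_transition_sum _ _ _ (phi x)).
  have mean c : (\sum_(y in cluster_set sigma c) phi x y) / #|cluster_set sigma c|%:R =
      (sigma x == a)%:R * ((c == b)%:R - p a b) + p a b * (g c 0 - (p *m g) (sigma x) 0).
    have cR : #|cluster_set sigma c|%:R != 0 :> R by rewrite pnatr_eq0 -lt0n.
    apply: (canLR (mulfK cR)); rewrite -sum1_card natr_sum mulr_sumr.
    by apply: eq_bigr => y; rewrite inE => /eqP hy; rewrite mulr1 /phi hy.
  under eq_bigr do rewrite mean mulrDr.
  rewrite big_split /=.
  under eq_bigr do rewrite mulrCA; rewrite -mulr_sumr.
  under [X in _ + X]eq_bigr do rewrite mulrCA; rewrite -mulr_sumr.
  under eq_bigr do rewrite mulrBr; under [X in _ + _ * X]eq_bigr do rewrite mulrBr.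
  rewrite !sumrB -!mulr_suml p1 !mul1r.
  have -> : \sum_i p (sigma x) i * g i 0 = (p *m g) (sigma x) 0 by rewrite mxE.
  rewrite subrr mulr0 addr0 (bigD1 b) //= eqxx mulr1 big1 ?addr0; last first.
    by move=> k /negbTE ->; rewrite mulr0.
  by case: eqP => [->|_]; rewrite ?subrr ?mulr0 ?mul0r.
have telescope x s : weight_between (path_count x s) (V a) (V b) - (size s)%:R * (pi 0 a * p a b) =
    path_sum phi x s - p a b * (g (sigma (last x s)) 0 - g (sigma x) 0).
  have -> : weight_between (path_count x s) (V a) (V b) =
      path_sum (fun x y => ((sigma x == a) && (sigma y == b))%:R : R) x s.
    rewrite path_sumE /weight_between big_mkcond; apply: eq_bigr => x' _; rewrite inE.
    case: (sigma x' == a) => /=; last by rewrite big1 // => y _; rewrite mul0r.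
    by rewrite big_mkcond; apply: eq_bigr => y _; rewrite inE; case: (sigma y == b); rewrite ?mul1r ?mul0r.
  elim: s x => [|y s IH] x /=; first by rewrite mul0r !subrr mulr0 subrr.
  move: (IH y); rewrite /phi pg -natr1 => e.
  set T := path_sum _ y s in e *; set T' := path_sum phi y s in e *.
  have -> : T = T' - p a b * (g (sigma (last y s)) 0 - g (sigma y) 0) + (size s)%:R * (pi 0 a * p a b).
    by rewrite -e subrK.
  by case: (sigma x == a); case: (sigma y == b); rewrite /=; ring.
rewrite /chain_prob.
have [P0 _] := P_stoch.
have mu0 x : 0 <= bmc_stationary sigma pi 0 x by apply: bmc_stationary_ge0.
have mu1 : \sum_x bmc_stationary sigma pi 0 x = 1 by apply: bmc_stationary_sum1.
apply: le_trans (_ : \sum_x bmc_stationary sigma pi 0 x *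
    ((2 * M ^+ 2 + 8 * G ^+ 2) / (l%:R * eps ^+ 2)) <= _); last first.
  by rewrite -mulr_suml mu1 mul1r.
apply: ler_sum => x _; rewrite ler_wpM2l //.
have q0 : 0 < (eps * l%:R) ^+ 2 by rewrite exprn_gt0 // mulr_gt0.
have -> : path_exp (bmc_transition sigma p) l x (fun s => (eps * l%:R <=
      `|weight_between (path_count x s) (V a) (V b) - l%:R * (pi 0 a * p a b)|)%R%:R) =
    path_exp (bmc_transition sigma p) l x (fun s => (eps * l%:R <=
      `|path_sum phi x s - p a b * (g (sigma (last x s)) 0 - g (sigma x) 0)|)%R%:R).
  (* [path_exp] evaluates its argument only at sequences of length [l], where [telescope] can be
     used with [size s = l]. *)
  have size_eq l' y (F F' : seq 'I_n -> R) : (forall s, size s = l' -> F s = F' s) ->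
      path_exp (bmc_transition sigma p) l' y F = path_exp (bmc_transition sigma p) l' y F'.
    elim: l' y F F' => [|l' IH] y F F' h /=; first exact: h.
    by apply: eq_bigr => z _; rewrite (IH z _ (fun s => F' (z :: s))) // => s hs; rewrite h //= hs.
  by apply: size_eq => s hs; rewrite -telescope hs.
apply: le_trans (_ : path_exp (bmc_transition sigma p) l x (fun s =>
    ((eps * l%:R) ^+ 2)^-1 * (2 * path_sum phi x s ^+ 2 + 8 * G ^+ 2)) <= _).
  apply: path_exp_le => // s; case: (boolP (eps * l%:R <= _)) => h; last first.
    by rewrite mulr_ge0 ?invr_ge0 ?(ltW q0) // addr_ge0 // mulr_ge0 ?sqr_ge0.
  rewrite ler_pdivlMl // mulr1.
  apply: le_trans (_ : `|path_sum phi x s - p a b * (g (sigma (last x s)) 0 - g (sigma x) 0)| ^+ 2 <= _).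
    by rewrite ler_sqr ?nnegrE // mulr_ge0 // ltW.
  rewrite real_normK ?num_real //.
  have := gG (sigma (last x s)); have := gG (sigma x); rewrite !ler_norml.
  set w := g _ _ - g _ _ => /andP[h1 h2] /andP[h3 h4].
  have hw : (p a b * w) ^+ 2 <= (2 * G) ^+ 2.
    have pab0 := p0 a b; have w1 : `|w| <= 2 * G by rewrite ler_norml; apply/andP; split; rewrite /w; lra.
    rewrite -[leLHS]real_normK ?num_real // ler_sqr ?nnegrE ?(le_trans (normr_ge0 _) w1) //.
    rewrite normrM ger0_norm //; apply: le_trans w1; exact: ler_piMl.
  have := sqr_ge0 (path_sum phi x s + p a b * w); nra.
rewrite path_expZ path_expD path_expZ path_exp_cst //.
have [_ hv] := path_sum_martingale l x P_stoch phi0 phiM.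
rewrite ler_pdivrMl //.
have -> : (eps * l%:R) ^+ 2 * ((2 * M ^+ 2 + 8 * G ^+ 2) / (l%:R * eps ^+ 2)) =
   l%:R * (2 * M ^+ 2 + 8 * G ^+ 2) by field; rewrite !lt0r_neq0.
have : 8 * G ^+ 2 <= l%:R * (8 * G ^+ 2) by rewrite ler_peMl ?ler1n // mulr_ge0 ?sqr_ge0.
lra.
Qed.

End LawOfLargeNumbers.

(** * Operator norm of the trimmed, centred counts *)

Section TrimmedNorm.
Context {R : realType} (n K : nat) (sigma : 'I_n -> 'I_K).

(** A path leaves a state at most once more often than it enters it. Thus trimming by column sums
    also controls the row sums. *)
Lemma path_out_le_in (x : 'I_n) s a :
  \sum_b path_count x s a b <= \sum_b path_count (R := R) x s b a + 1.
Proof.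
have out : \sum_b path_count (R := R) x s a b = path_sum (fun x _ => (x == a)%:R) x s.
  rewrite path_sumE [RHS](bigD1 a) //= eqxx [X in _ = _ + X]big1 ?addr0; last first.
    by move=> c /negbTE ->; rewrite big1 // => b _; rewrite mul0r.
  by apply: eq_bigr => b _; rewrite mul1r.
have inn : \sum_b path_count (R := R) x s b a = path_sum (fun _ y => (y == a)%:R) x s.
  rewrite path_sumE; apply: eq_bigr => b _; rewrite (bigD1 a) //= eqxx mul1r big1 ?addr0 //.
  by move=> c /negbTE ->; rewrite mul0r.
rewrite out inn => {out inn}.
have : path_sum (fun x _ => (x == a)%:R) x s + (last x s == a)%:R =
    path_sum (fun _ y => (y == a)%:R) x s + (x == a)%:R :> R.
  by elim: s x => [|y s IH] x //=; rewrite -!addrA IH; ring.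
have h1 : 0 <= (last x s == a)%:R :> R by [].
have h2 : (x == a)%:R <= 1 :> R by case: (x == a).
lra.
Qed.

Lemma path_count_total (x : 'I_n) s :
  \sum_a \sum_b path_count x s a b = (size s)%:R :> R.
Proof.
transitivity (path_sum (fun _ _ => 1 : R) x s).
  by rewrite path_sumE; apply: eq_bigr => a _; apply: eq_bigr => b _; rewrite mul1r.
by elim: s x => [|y s IH] x //=; rewrite IH -natr1 addrC.
Qed.

Variables (N : 'M[R]_n) (G : {set 'I_n}) (D kappa C1 C2 C3 CL : R).
Hypothesis n_gt0 : (0 < n)%N.
Hypothesis kappa_gt0 : 0 < kappa.
Hypothesis cluster_large : forall a, n%:R <= kappa * #|cluster_set sigma a|%:R.
Hypothesis D_ge1 : 1 <= D.
Hypothesis N_ge0 : forall x y, 0 <= N x y.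
Hypothesis N_total : \sum_x \sum_y N x y <= n%:R * D ^+ 2.
Hypothesis C1_ge0 : 0 <= C1.
Hypothesis C2_ge : expR 1 <= C2.
Hypothesis C3_ge0 : 0 <= C3.
Hypothesis light_small : forall g1 g2 : grid n, in_ball g1 -> in_ball g2 ->
  light_dev sigma D (grid_vec g1) (grid_vec g2) N <= CL * D.
Hypothesis N_disc : discrepancy N D C2 C3.
Hypothesis N_discT : discrepancy N^T D C2 C3.
Hypothesis col_small : forall y, y \notin G -> \sum_x N x y <= C1 * D ^+ 2.
Hypothesis row_small : forall x, x \notin G -> \sum_y N x y <= C1 * D ^+ 2.
Hypothesis G_small : #|G|%:R <= n%:R * expR (- D ^+ 2).

Let nR : 0 < n%:R :> R. Proof. by rewrite ltr0n. Qed.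
Let D_gt0 : 0 < D. Proof. exact: lt_le_trans ltr01 D_ge1. Qed.
Let M := block_mean sigma N.

Lemma block_mean_bound x y : 0 <= M x y <= kappa ^+ 2 * D ^+ 2 / n%:R.
Proof.
rewrite /M block_meanE; set a := sigma x; set b := sigma y.
have VR c : 0 < #|cluster_set sigma c|%:R :> R.
  by rewrite -(pmulr_rgt0 _ kappa_gt0); exact: lt_le_trans (cluster_large c).
have w0 A B : 0 <= weight_between N A B by apply: sumr_ge0 => *; apply: sumr_ge0.
apply/andP; split; first by rewrite divr_ge0 // mulr_ge0.
rewrite ler_pdivrMr ?mulr_gt0 //.
have h1 : weight_between N (cluster_set sigma a) (cluster_set sigma b) <= n%:R * D ^+ 2.
  by apply: le_trans N_total; apply: block_sum_le.
apply: le_trans h1 _.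
have h2 : n%:R * n%:R <= (kappa * #|cluster_set sigma a|%:R) * (kappa * #|cluster_set sigma b|%:R).
  by rewrite ler_pM.
have -> : kappa ^+ 2 * D ^+ 2 / n%:R * (#|cluster_set sigma a|%:R * #|cluster_set sigma b|%:R) =
    D ^+ 2 / n%:R * ((kappa * #|cluster_set sigma a|%:R) * (kappa * #|cluster_set sigma b|%:R)) by ring.
apply: le_trans (ler_wpM2l _ h2); last by rewrite divr_ge0 ?sqr_ge0.
by rewrite le_eqVlt; apply/orP; left; apply/eqP; field; rewrite lt0r_neq0.
Qed.

Let Ch := 2 * C1 + 32 * (16 * C2 + 40 * C3 + 2 * expR 1).

(** Scaling both vectors by [sqrt n] turns the heavy pairs of [N] into those of [heavy_sum_le]. For
    [M], a heavy pair has [D / n < |u x| * |v y|], which converts the entry bound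
    [kappa ^+ 2 * D ^+ 2 / n] into [kappa ^+ 2 * D] times a product of squares. *)
Lemma bilin_off_trimmed (u v : 'I_n -> R) :
  \sum_x u x ^+ 2 <= 1 -> \sum_x v x ^+ 2 <= 1 ->
  (forall x, x \in G -> u x = 0) -> (forall x, x \in G -> v x = 0) ->
  bilin (N - M) u v <= light_dev sigma D u v N + (Ch + kappa ^+ 2) * D.
Proof.
move=> hu hv uG vG.
pose sq := Num.sqrt n%:R : R.
have sq0 : 0 < sq by rewrite sqrtr_gt0.
have sq2 : sq * sq = n%:R by rewrite -expr2 sqr_sqrtr ?ler0n.
pose a x := sq * `|u x|; pose b x := sq * `|v x|.
have ab x y : a x * b y = n%:R * (`|u x| * `|v y|) by rewrite /a /b -sq2; ring.
have heavy : \sum_x \sum_(y | D < a x * b y) a x * b y * N x y <= Ch * D * n%:R.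
  have sqn (w : 'I_n -> R) : \sum_x w x ^+ 2 <= 1 -> \sum_x (sq * `|w x|) ^+ 2 <= n%:R.
    move=> hw; under eq_bigr do rewrite exprMn real_normK ?num_real // expr2 sq2.
    by rewrite -mulr_sumr ler_piMr.
  have off (w : 'I_n -> R) x : (forall x, x \in G -> w x = 0) -> 0 < sq * `|w x| -> x \notin G.
    by move=> wG; apply: contraTN => /wG ->; rewrite normr0 mulr0 ltxx.
  apply: heavy_sum_le => //.
  - by move=> x; rewrite /a /b mulr_ge0 // ltW.
  - by move=> x; rewrite /a /b mulr_ge0 // ltW.
  - exact: sqn.
  - exact: sqn.
  - by move=> x /(off _ _ uG); exact: row_small.
  - by move=> x /(off _ _ vG); exact: col_small.
have point x y : u x * v y * (N - M) x y <= light_mx D u v x y * (N - M) x y +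
    ((if D < a x * b y then n%:R^-1 * (a x * b y * N x y) else 0) +
     kappa ^+ 2 * D * (u x ^+ 2 * v y ^+ 2)).
  have q0 : 0 <= kappa ^+ 2 * D * (u x ^+ 2 * v y ^+ 2).
    exact: mulr_ge0 (mulr_ge0 (sqr_ge0 _) (ltW D_gt0)) (mulr_ge0 (sqr_ge0 _) (sqr_ge0 _)).
  rewrite [light_mx _ _ _ _ _]mxE -ab.
  have [h|h] := leP (a x * b y) D; first by rewrite add0r lerDl.
  rewrite mul0r add0r ab -[n%:R * _ * N x y]mulrA mulKf ?lt0r_neq0 //.
  have [m0 m1] := andP (block_mean_bound x y).
  rewrite [(N - M) x y]mxE [(- M) x y]mxE mulrBr.
  have h1 : u x * v y * N x y <= `|u x| * `|v y| * N x y.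
    by rewrite ler_wpM2r // -normrM ler_norm.
  have h2 : - (u x * v y * M x y) <= `|u x| * `|v y| * M x y.
    by rewrite -mulNr ler_wpM2r // -normrM -normrN ler_norm.
  suff : `|u x| * `|v y| * M x y <= kappa ^+ 2 * D * (u x ^+ 2 * v y ^+ 2) by lra.
  rewrite -[u x ^+ 2]real_normK ?num_real // -[v y ^+ 2]real_normK ?num_real //.
  set w := `|u x| * `|v y|; have w0 : 0 <= w by rewrite mulr_ge0.
  apply: le_trans (ler_wpM2l w0 m1) _.
  rewrite -[`|u x| ^+ 2 * _]exprMn -/w.
  have -> : w * (kappa ^+ 2 * D ^+ 2 / n%:R) = (kappa ^+ 2 * D * w) * (D / n%:R) by ring.
  have -> : kappa ^+ 2 * D * w ^+ 2 = (kappa ^+ 2 * D * w) * w by ring.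
  rewrite ler_wpM2l //; first exact: mulr_ge0 (mulr_ge0 (sqr_ge0 _) (ltW D_gt0)) w0.
  by rewrite ler_pdivrMr // mulrC; move: h; rewrite ab => /ltW.
apply: le_trans (_ : \sum_x \sum_y (light_mx D u v x y * (N - M) x y +
    ((if D < a x * b y then n%:R^-1 * (a x * b y * N x y) else 0) +
     kappa ^+ 2 * D * (u x ^+ 2 * v y ^+ 2))) <= _).
  by apply: ler_sum => x _; apply: ler_sum => y _; exact: point.
under eq_bigr do rewrite !big_split /=.
rewrite !big_split /= lerD2l mulrDl lerD //.
  under eq_bigr do rewrite -big_mkcond -mulr_sumr.
  by rewrite -mulr_sumr ler_pdivrMl // mulrC.
under eq_bigr do rewrite -!mulr_sumr.
rewrite -!mulr_sumr -mulr_suml -[leRHS]mulr1 ler_wpM2l ?mulr_ge0 ?sqr_ge0 ?(ltW D_gt0) ?(ltW kappa_gt0) //.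
by rewrite mulr_ile1 // sumr_ge0 // => x _; rewrite sqr_ge0.
Qed.

Let c0 := 2 * (CL + Ch + kappa ^+ 2) + 2 * kappa ^+ 2.

(** [M] averages the untrimmed counts and so stays constant on blocks, which leaves the error [Mr]
    on the rows and columns in [G]. As these are few, its norm is of order
    [D ^+ 2 * expR (- D ^+ 2 / 2)], which is [O(D)]. Elsewhere the net applies, since erasing the
    coordinates in [G] keeps a grid point in the ball. *)
Lemma trimmed_bilin_le (u v : 'I_n -> R) :
  \sum_x u x ^+ 2 <= 1 -> \sum_x v x ^+ 2 <= 1 ->
  bilin (trim_mx N G - M) u v <= c0 * D.
Proof.
pose E0 := trim_mx (N - M) G.
have net : forall u v, \sum_x u x ^+ 2 <= 1 -> \sum_x v x ^+ 2 <= 1 ->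
    bilin E0 u v <= 2 * ((CL + Ch + kappa ^+ 2) * D).
  apply: bilin_net => // g1 g2 b1 b2.
  pose off (g : grid n) : grid n := [ffun x => if x \in G then (false, ord0) else g x].
  have offE g x : grid_vec (off g) x = if x \in G then 0 else grid_vec g x :> R.
    by rewrite /grid_vec ffunE; case: ifP; rewrite //= mul0r mulr0.
  have offb g : in_ball g -> in_ball (off g).
    move=> hg; apply: leq_trans hg; apply: leq_sum => x _; rewrite ffunE.
    by case: ifP.
  have -> : bilin E0 (grid_vec g1) (grid_vec g2) =
      bilin (N - M) (grid_vec (off g1)) (grid_vec (off g2)).
    apply: eq_bigr => x _; apply: eq_bigr => y _; rewrite /E0 /trim_mx mxE !offE.
    by case: (x \in G); case: (y \in G); rewrite /= ?(mul0r, mulr0).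
  apply: le_trans (bilin_off_trimmed _ _ _ _) _.
  - by apply: grid_vec_sq_sum => //; exact: offb.
  - by apply: grid_vec_sq_sum => //; exact: offb.
  - by move=> x xG; rewrite offE xG.
  - by move=> x xG; rewrite offE xG.
  have := light_small (offb _ b1) (offb _ b2); lra.
move=> hu hv; pose Mr : 'M[R]_n := \matrix_(x, y) (if (x \notin G) && (y \notin G) then 0 else M x y).
have -> : bilin (trim_mx N G - M) u v = bilin E0 u v - bilin Mr u v.
  rewrite /bilin -sumrB; apply: eq_bigr => x _; rewrite -sumrB; apply: eq_bigr => y _.
  by rewrite !mxE; case: ifP => _; ring.
have {net} := net u v hu hv.
suff : - bilin Mr u v <= 2 * kappa ^+ 2 * D by rewrite /c0; lra.
(* The weight in AM-GM that balances the at most [n * al ^+ 2] rows in [G] against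
   all [n] columns. *)
pose al := expR (- (D ^+ 2 / 2)) : R.
have al0 : 0 < al by rewrite expR_gt0.
have alD : al * D <= 1.
  rewrite /al expRN mulrC ler_pdivrMr ?expR_gt0 // mul1r.
  apply: le_trans (expR_ge1Dx _); have := sqr_ge0 (D - 1); nra.
have G2 : #|G|%:R <= n%:R * al ^+ 2.
  apply: le_trans G_small _; rewrite /al -expRM_natl.
  by rewrite (_ : 2%:R * - (D ^+ 2 / 2) = - D ^+ 2) //; field.
pose B := kappa ^+ 2 * D ^+ 2 / n%:R.
have B0 : 0 <= B by rewrite /B divr_ge0 // mulr_ge0 ?sqr_ge0.
pose T (u v : 'I_n -> R) x y := (if x \in G then B / 2 * (al * u x ^+ 2 + al^-1 * v y ^+ 2) else 0).
have T0 u' v' x y : 0 <= T u' v' x y.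
  rewrite /T; case: ifP => // _; apply: mulr_ge0; first by rewrite divr_ge0.
  by apply: addr_ge0; apply: mulr_ge0; rewrite ?invr_ge0 ?sqr_ge0 // ltW.
have Tsum u' v' : \sum_x u' x ^+ 2 <= 1 -> \sum_x v' x ^+ 2 <= 1 ->
    \sum_x \sum_y T u' v' x y <= B * (al * n%:R).
  move=> hu' hv'.
  apply: le_trans (_ : \sum_(x in G) (B / 2 * (al * n%:R * u' x ^+ 2 + al^-1)) <= _).
    rewrite [leRHS]big_mkcond; apply: ler_sum => x _; rewrite /T; case: ifP => _; last by rewrite big1.
    rewrite -mulr_sumr; apply: ler_wpM2l; first exact: divr_ge0.
    rewrite big_split /= lerD //.
      by rewrite sumr_const card_ord -[leLHS]mulr_natl mulrCA mulrA.
    by rewrite -mulr_sumr ler_piMr // invr_ge0 ltW.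
  rewrite -mulr_sumr big_split /= -mulr_sumr sumr_const.
  have h1 : \sum_(x in G) u' x ^+ 2 <= 1.
    apply: le_trans hu'; rewrite [leLHS]big_mkcond; apply: ler_sum => x _.
    by case: ifP => // _; rewrite sqr_ge0.
  have h2 : al^-1 *+ #|G| <= al * n%:R.
    rewrite -[leLHS]mulr_natl ler_pdivrMr //; apply: le_trans G2 _.
    by rewrite le_eqVlt; apply/orP; left; apply/eqP; ring.
  have h3 : al * n%:R * \sum_(x in G) u' x ^+ 2 <= al * n%:R.
    by rewrite ler_piMr // mulr_ge0 // ltW.
  apply: le_trans (_ : B / 2 * (al * n%:R + al * n%:R) <= _).
    by apply: ler_wpM2l; [exact: divr_ge0|exact: lerD].
  by rewrite le_eqVlt; apply/orP; left; apply/eqP; field.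
have amgm (s t : R) : `|s| * `|t| <= 2^-1 * (al * s ^+ 2 + al^-1 * t ^+ 2).
  rewrite -[s ^+ 2]real_normK ?num_real // -[t ^+ 2]real_normK ?num_real //.
  have -> : 2^-1 * (al * `|s| ^+ 2 + al^-1 * `|t| ^+ 2) =
      `|s| * `|t| + (2 * al)^-1 * (al * `|s| - `|t|) ^+ 2 by field; rewrite lt0r_neq0.
  by rewrite lerDl mulr_ge0 ?sqr_ge0 // invr_ge0 mulr_ge0 // ltW.
apply: le_trans (_ : \sum_x \sum_y (T u v x y + T v u y x) <= _).
  rewrite /bilin -sumrN; apply: ler_sum => x _; rewrite -sumrN; apply: ler_sum => y _.
  have [m0 m1] := andP (block_mean_bound x y); rewrite -/B in m1.
  rewrite [Mr x y]mxE; case: ifPn => [_|]; first by rewrite mulr0 oppr0 addr_ge0.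
  rewrite negb_and !negbK => hG.
  apply: le_trans (_ : `|u x| * `|v y| * B <= _).
    rewrite -mulNr; apply: le_trans (_ : `|u x| * `|v y| * M x y <= _).
      by rewrite ler_wpM2r // -normrM -normrN ler_norm.
    by rewrite ler_wpM2l // mulr_ge0.
  case/orP: hG => hG; rewrite mulrC.
    apply: le_trans (_ : T u v x y <= _); last by rewrite lerDl.
    by rewrite /T hG -mulrA ler_wpM2l.
  apply: le_trans (_ : T v u y x <= _); last by rewrite lerDr.
  by rewrite /T hG -mulrA ler_wpM2l // [`|u x| * _]mulrC.
under eq_bigr do rewrite big_split /=.
rewrite big_split /= [X in _ + X]exchange_big /=.
apply: le_trans (lerD (Tsum u v hu hv) (Tsum v u hv hu)) _.
have -> : B * (al * n%:R) + B * (al * n%:R) = 2 * kappa ^+ 2 * D * (al * D).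
  by rewrite /B; field; rewrite lt0r_neq0.
by rewrite ler_piMr // !mulr_ge0 ?sqr_ge0 ?(ltW D_gt0) ?(ltW kappa_gt0).
Qed.

Lemma trimmed_op_le : 0 <= CL ->
  op_le (trim_mx N G - M) (c0 * D) /\ op_le (trim_mx N G - M)^T (c0 * D).
Proof.
move=> CL0; have e0 := expR_ge0 (1 : R).
have c00 : 0 <= c0 * D.
  apply: mulr_ge0; last exact: ltW.
  have := sqr_ge0 kappa; rewrite /c0 /Ch; move: C1_ge0 C2_ge C3_ge0; lra.
split; apply: op_le_bilin => // u v hu hv; first exact: trimmed_bilin_le.
by rewrite bilin_tr; exact: trimmed_bilin_le.
Qed.

End TrimmedNorm.

(** * From sums over paths to the probability space *)

Section Trajectories.
Context {R : realType}.

Lemma count_mx_path n (X : nat -> nat) (x : 'I_n) (s : seq 'I_n) :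
  (forall t, (t <= size s)%N -> X t = nth x (x :: s) t) ->
  count_mx n (size s) X = path_count x s :> 'M[R]_n.
Proof.
move=> hX; apply/matrixP => a b; rewrite !mxE.
elim: s x X hX => [|y s IH] x X hX; first by rewrite big_ord0.
rewrite big_ord_recl natrD /=; congr (_ + _).
  by rewrite (hX 0%N) // (hX 1%N).
rewrite -(IH y (fun t => X t.+1)) //.
move=> t ht; rewrite (hX t.+1) // -[LHS]/(nat_of_ord (nth x (y :: s) t)).
by congr nat_of_ord; exact: set_nth_default.
Qed.

Context {d : measure_display} {Omega : measurableType d} (Pr : probability Omega R).

Lemma sum_probability_le (I : eqType) (r : seq I) (F : I -> set Omega) (H : set Omega) :
  uniq r -> measurable H -> (forall i, measurable (F i)) -> (forall i, F i `<=` H) ->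
  (forall i j w, F i w -> F j w -> i = j) ->
  (\sum_(i <- r) Pr (F i) <= Pr H)%E.
Proof.
move=> ur mH mF FH inj.
have mU s : measurable (\big[setU/set0]_(i <- s) F i).
  by elim: s => [|i s IH]; rewrite ?big_nil // big_cons; exact: measurableU.
have UH s : \big[setU/set0]_(i <- s) F i `<=` H.
  by elim: s => [|i s IH]; rewrite ?big_nil // big_cons subUset.
suff -> : (\sum_(i <- r) Pr (F i) = Pr (\big[setU/set0]_(i <- r) F i))%E.
  by apply: le_measure; rewrite ?inE.
elim: r ur => [|i r IH] /=; first by rewrite !big_nil measure0.
move=> /andP[ir /IH e]; rewrite !big_cons measureU //; first by congr (_ + _)%E.
apply/seteqP; split => // w [wi].
elim: r ir {IH e} => [|j r IH]; rewrite ?big_nil // big_cons inE negb_or => /andP[ij jr].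
by case=> [/(inj _ _ _ wi) e|/IH]; [rewrite e eqxx in ij|exact].
Qed.

Variables (n : nat) (mu : 'rV[R]_n) (P : 'M[R]_n) (X : nat -> Omega -> nat).
Hypothesis X_meas : forall t k, measurable [set w | X t w = k].
Hypothesis X_chain : is_markov_chain Pr mu P X.

Definition cylinder (x : 'I_n) (s : seq 'I_n) : set Omega :=
  [set w | forall t, (t <= size s)%N -> X t w = nth x (x :: s) t].

Lemma measurable_cylinder x s : measurable (cylinder x s).
Proof.
have -> : cylinder x s = \bigcap_(t in [set t | (t <= size s)%N])
    [set w | X t w = nth x (x :: s) t] by [].
by apply: bigcap_measurable => [|t _]; [exists 0%N|exact: X_meas].
Qed.

Lemma probability_cylinder_rcons x s y :
  Pr (cylinder x (rcons s y)) = (Pr (cylinder x s) * (P (last x s) y)%:E)%E.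
Proof.
have cylE s' : Pr (cylinder x s') =
    (mu 0 x * \prod_(t < size s') P (nth x (x :: s') t) (nth x (x :: s') t.+1))%:E.
  exact: X_chain (size s') (nth x (x :: s')).
rewrite !cylE -EFinM size_rcons big_ord_recr /= -!mulrA; congr (_ * (_ * _))%:E.
  apply: eq_bigr => t _; congr (P _ _); last by rewrite nth_rcons ltn_ord.
  by case: t => [[|t]] //= ht; rewrite nth_rcons (ltnW ht).
congr (P _ _); last by rewrite nth_rcons ltnn eqxx.
by rewrite -rcons_cons nth_rcons /= ltnSn; exact: (nth_last x (x :: s)).
Qed.

Lemma cylinder_rcons_sub x s y : cylinder x (rcons s y) `<=` cylinder x s.
Proof.
move=> w hw t ht; rewrite hw ?size_rcons 1?ltnW //.
by case: t ht => //= t ht; rewrite nth_rcons ht.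
Qed.

Lemma cylinder_rcons_last x s y w : cylinder x (rcons s y) w -> X (size s).+1 w = y.
Proof. by move=> /(_ (size s).+1); rewrite size_rcons => -> //=; rewrite nth_rcons ltnn eqxx. Qed.

(** Induction on the number of steps still to come: extending a cylinder by one state multiplies its
    probability by an entry of [P], and different extensions are disjoint. At full length the
    cylinders selected by [Q] lie in [G]. *)
Lemma chain_prob_le_probability l (Q : 'I_n -> seq 'I_n -> bool) (G : set Omega) :
  measurable G ->
  (forall x s w, size s = l -> cylinder x s w -> Q x s -> G w) ->
  ((chain_exp mu P l (fun x s => (Q x s)%:R))%:E <= Pr G)%E.
Proof.
move=> mG hG.
have step k x s : (size s + k = l)%N ->
    (Pr (cylinder x s) * (path_exp P k (last x s) (fun s' => (Q x (s ++ s'))%:R))%:E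
      <= Pr (cylinder x s `&` G))%E.
  elim: k s => [|k IH] s /=.
    rewrite addn0 cats0 => hs; case: (boolP (Q x s)) => hQ; last by rewrite mule0.
    rewrite mule1; apply: le_measure; rewrite ?inE //.
    - exact: measurable_cylinder.
    - by apply: measurableI => //; exact: measurable_cylinder.
    - by move=> w hw; split=> //; exact: hG hw hQ.
  rewrite addnS => hs; rewrite -sumEFin fin_num_sume_distrr; last 2 first.
  - exact: fin_num_measure (measurable_cylinder _ _).
  - by move=> i j _ _.
  apply: le_trans (_ : \sum_y Pr (cylinder x (rcons s y) `&` G) <= _)%E; last first.
    apply: sum_probability_le.
    - exact: index_enum_uniq.
    - by apply: measurableI => //; exact: measurable_cylinder.
    - by move=> y; apply: measurableI => //; exact: measurable_cylinder.
    - by move=> y w [/cylinder_rcons_sub hw Gw]; split.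
    - move=> y z w [/cylinder_rcons_last hy _] [/cylinder_rcons_last hz _].
      exact: val_inj (etrans (esym hy) hz).
  apply: lee_sum => y _; rewrite EFinM muleA -probability_cylinder_rcons.
  have := IH (rcons s y); rewrite size_rcons addSn => /(_ hs); rewrite last_rcons.
  by rewrite (_ : (fun s' => (Q x (rcons s y ++ s'))%:R) = fun s' => (Q x (s ++ y :: s'))%:R);
    last by apply/funext => s'; rewrite cat_rcons.
apply: le_trans (_ : \sum_x Pr (cylinder x [::] `&` G) <= _)%E; last first.
  apply: sum_probability_le => //.
  - exact: index_enum_uniq.
  - by move=> y; apply: measurableI => //; exact: measurable_cylinder.
  - move=> y z w [/(_ 0%N isT) /= hy _] [/(_ 0%N isT) /= hz _]; exact: val_inj (etrans (esym hy) hz).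
rewrite /chain_exp -sumEFin; apply: lee_sum => x _.
have := step l x [::] erefl; rewrite EFinM; congr (_ * _ <= _)%E.
have := X_chain 0%N (fun=> x); rewrite big_ord0 mulr1 => <-; congr (Pr _).
apply/seteqP; split=> w hw t; rewrite ?leqn0 => /eqP -> /=.
  exact: hw 0%N isT.
exact: hw 0%N isT.
Qed.

End Trajectories.

(** * Separation of clusters from positive information *)

Section Separation.
Context {R : realType}.

(** The compared quantities are the limits of the rows and columns of the block average, up to a
    scale that depends only on the cluster [k]. *)
Definition distinguishable K (alpha pi : 'rV[R]_K) (p : 'M[R]_K) (delta : R) : Prop :=
  forall i j : 'I_K, i != j -> exists k,
    delta <= `|pi 0 i * p i k / alpha 0 i - pi 0 j * p j k / alpha 0 j| \/
    delta <= `|pi 0 k * p k i / alpha 0 i - pi 0 k * p k j / alpha 0 j|.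

(** Summing the row equalities over [k] gives equal ratios of [pi] to [alpha]. Every logarithm with
    a nonzero coefficient is then taken at 1. *)
Lemma information_term_eq0 K (alpha pi : 'rV[R]_K) (p : 'M[R]_K) (i j : 'I_K) :
  stochastic p -> (forall k, 0 < alpha 0 k) ->
  (forall k, pi 0 i * p i k / alpha 0 i = pi 0 j * p j k / alpha 0 j) ->
  (forall k, pi 0 k * p k i / alpha 0 i = pi 0 k * p k j / alpha 0 j) ->
  information_term alpha pi p i j = 0%E.
Proof.
move=> [_ p1] a0 hout hin.
have an0 k : alpha 0 k != 0 by rewrite lt0r_neq0.
have piE : pi 0 i / alpha 0 i = pi 0 j / alpha 0 j.
  have : \sum_k pi 0 i * p i k / alpha 0 i = \sum_k pi 0 j * p j k / alpha 0 j.
    by apply: eq_bigr => k _; exact: hout.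
  by rewrite -!mulr_suml -!mulr_sumr !p1 !mulr1.
rewrite /information_term piE subrr adde0 big1 // => k _.
have -> : mul_ln_ratio (pi 0 i * p i k) (p i k) (p j k) = 0%E.
  rewrite /mul_ln_ratio; case: eqP => // /eqP; rewrite mulf_eq0 negb_or => /andP[pin pik].
  have pjk : p j k = p i k.
    have e : (pi 0 i / alpha 0 i) * p i k = (pi 0 i / alpha 0 i) * p j k.
      by rewrite {2}piE mulrAC hout mulrAC.
    by apply/esym/(mulfI _ e); rewrite mulf_neq0 // invr_eq0.
  by rewrite pjk (negbTE pik) divff // ln1 mulr0.
have -> : mul_ln_ratio (pi 0 k * p k i) (p k i * alpha 0 j) (p k j * alpha 0 i) = 0%E.
  rewrite /mul_ln_ratio; case: eqP => // /eqP; rewrite mulf_eq0 negb_or => /andP[pkn pki].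
  have e : p k j * alpha 0 i = p k i * alpha 0 j.
    have := hin k; rewrite -!mulrA => /(mulfI pkn) h.
    by rewrite -[p k j](divfK (an0 j)) -h; field; exact: an0.
  by rewrite e mulf_eq0 (negbTE pki) (negbTE (an0 j)) /= divff ?ln1 ?mulr0 // mulf_neq0.
by rewrite adde0 mule0.
Qed.

Lemma information_gt0_distinguishable K (alpha pi : 'rV[R]_K) (p : 'M[R]_K) :
  stochastic p -> (forall k, 0 < alpha 0 k) -> (0 < information alpha pi p)%E ->
  exists2 delta, 0 < delta & distinguishable alpha pi p delta.
Proof.
move=> hp a0 hI.
pose g (ij : 'I_K * 'I_K) := \sum_k
  (`|pi 0 ij.1 * p ij.1 k / alpha 0 ij.1 - pi 0 ij.2 * p ij.2 k / alpha 0 ij.2| +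
   `|pi 0 k * p k ij.1 / alpha 0 ij.1 - pi 0 k * p k ij.2 / alpha 0 ij.2|).
have g0 ij : ij.1 != ij.2 -> 0 < g ij.
  move=> hij; rewrite lt_def sumr_ge0 => [|k _]; last by rewrite addr_ge0.
  rewrite andbT; apply: contraTneq hI => /eqP.
  rewrite psumr_eq0 => [|k _]; last by rewrite addr_ge0.
  move=> /allP h; have hk k : _ := h k (mem_index_enum k).
  rewrite -leNgt /information; apply: (bigmin_inf ij) => //.
  rewrite information_term_eq0 // => k; have := hk k; rewrite /= paddr_eq0 // => /andP[].
    by rewrite normr_eq0 subr_eq0 => /eqP.
  by rewrite !normr_eq0 !subr_eq0 => _ /eqP.
(* The default value 1 keeps [m] positive when there is no pair of distinct clusters. *)
pose m := \big[Num.min/(1 : R)]_(ij | ij.1 != ij.2) g ij.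
have m0 : 0 < m by apply/bigmin_gtP; split.
have [K0|K0] := posnP K.
  by exists 1 => // i; suff : false by []; rewrite -(ltn0 i) -[X in (_ < X)%N]K0 ltn_ord.
have KR : 0 < K%:R :> R by rewrite ltr0n.
(* [g] has [2 * K] summands, so if each were at most [m / (4 * K)], their sum would be at most
   [m / 2]. *)
exists (m / (4 * K%:R)) => [|i j ij]; first by rewrite divr_gt0 ?mulr_gt0.
apply: contrapT => hn.
have : g (i, j) <= m / 2.
  apply: le_trans (_ : \sum_(k < K) (m / (4 * K%:R) + m / (4 * K%:R)) <= _).
    apply: ler_sum => k _ /=; apply: lerD; rewrite leNgt; apply/negP => /ltW h; apply: hn; exists k.
      by left.
    by right.
  rewrite sumr_const card_ord -[leLHS]mulr_natl le_eqVlt; apply/orP; left; apply/eqP; field.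
  by rewrite lt0r_neq0.
have : m <= g (i, j) by apply: bigmin_le_cond.
lra.
Qed.

Lemma block_mean_tr n K (sigma : 'I_n -> 'I_K) (N : 'M[R]_n) :
  (block_mean sigma N)^T = block_mean sigma N^T.
Proof. by rewrite /block_mean !trmx_mul averaging_mxT mulmxA. Qed.

(** On each of the [#|Vk|] columns of cluster [k], the rows differ by [(r (sigma x) - r (sigma y)) *
    D ^+ 2 / #|Vk|]; the squares are added and [#|Vk| <= n] is used. *)
Lemma block_mean_row_separation n K (sigma : 'I_n -> 'I_K) (N : 'M[R]_n) (D delta : R)
    (x y : 'I_n) (k : 'I_K) :
  (0 < n)%N -> 0 < D -> 0 <= delta -> (forall a, (0 < #|cluster_set sigma a|)%N) ->
  let r (a : 'I_K) := weight_between N (cluster_set sigma a) (cluster_set sigma k) /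
                      (#|cluster_set sigma a|%:R * D ^+ 2) in
  delta <= `|r (sigma x) - r (sigma y)| ->
  delta ^+ 2 * D ^+ 4 / n%:R <= nsq (row x (block_mean sigma N) - row y (block_mean sigma N)).
Proof.
move=> n0 D0 delta0 cl0 r hr.
have VR a : 0 < #|cluster_set sigma a|%:R :> R by rewrite ltr0n.
have nR : 0 < n%:R :> R by rewrite ltr0n.
set Vk := cluster_set sigma k; set c := (r (sigma x) - r (sigma y)) * D ^+ 2 / #|Vk|%:R.
apply: le_trans (_ : \sum_(z in Vk) c ^+ 2 <= _); last first.
  rewrite big_mkcond; apply: ler_sum => z _; case: ifP => hz; last by rewrite sqr_ge0.
  rewrite le_eqVlt; apply/orP; left; apply/eqP; congr (_ ^+ 2).
  have -> (A : 'M[R]_n) : (row x A - row y A) 0 z = A x z - A y z by rewrite !mxE.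
  rewrite !block_meanE; move: hz; rewrite inE => /eqP ->.
  by rewrite /c /r -/Vk; field; rewrite !lt0r_neq0 ?VR.
rewrite sumr_const -[leRHS]mulr_natl.
have -> : #|Vk|%:R * c ^+ 2 = (r (sigma x) - r (sigma y)) ^+ 2 * D ^+ 4 / #|Vk|%:R.
  by rewrite /c; field; rewrite lt0r_neq0 ?VR.
have D4 : 0 <= D ^+ 4 by rewrite exprn_ge0 // ltW.
apply: ler_pM; [exact: mulr_ge0 (sqr_ge0 _) D4|by rewrite invr_ge0| |].
  rewrite ler_wpM2r // -[leRHS]real_normK ?num_real // ler_sqr ?nnegrE //.
by rewrite lef_pV2 ?posrE ?VR // ler_nat -[leqRHS]card_ord max_card.
Qed.

(** [w / l] estimates [q] and [n / v] estimates [alpha^-1]; each error takes half of [delta]. *)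
Lemma ratio_approx (w q v l n D kappa alpha eps delta : R) :
  0 < n -> 0 < v -> 0 < l -> 0 < D -> n * D ^+ 2 = l -> n <= kappa * v -> 0 <= q <= 1 ->
  `|w - l * q| <= eps * l -> `|n / v - alpha^-1| <= delta / 2 ->
  eps * kappa <= delta / 2 -> `|w / (v * D ^+ 2) - q / alpha| <= delta.
Proof.
move=> n0 v0 l0 D0 lE nv /andP[q0 q1] hw hv he.
have D2 : 0 < D ^+ 2 by rewrite exprn_gt0.
have -> : w / (v * D ^+ 2) - q / alpha =
    (w - l * q) / l * (n / v) + q * (n / v - alpha^-1).
  by move: (alpha^-1) => al; rewrite -lE; field; rewrite !lt0r_neq0.
apply: le_trans (ler_normD _ _) _.
have h1 : `|(w - l * q) / l * (n / v)| <= eps * kappa.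
  rewrite normrM; apply: ler_pM => //.
    by rewrite normrM normfV [`|l|]gtr0_norm // ler_pdivrMr.
  by rewrite gtr0_norm ?divr_gt0 // ler_pdivrMr.
have h2 : `|q * (n / v - alpha^-1)| <= delta / 2.
  by rewrite normrM ger0_norm //; apply: le_trans hv; exact: ler_piMl.
lra.
Qed.

Lemma block_mean_separation n K (sigma : 'I_n -> 'I_K) (N : 'M[R]_n) (l : nat)
    (alpha pi : 'rV[R]_K) (p : 'M[R]_K) (D delta eps kappa : R) :
  (0 < n)%N -> 0 < D -> n%:R * D ^+ 2 = l%:R -> 0 < delta -> 0 < kappa ->
  (forall a, n%:R <= kappa * #|cluster_set sigma a|%:R) ->
  (forall a b, 0 <= pi 0 a * p a b <= 1) ->
  distinguishable alpha pi p (4 * delta) ->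
  (forall a, `|n%:R / #|cluster_set sigma a|%:R - (alpha 0 a)^-1| <= delta / 2) ->
  eps * kappa <= delta / 2 ->
  (forall a b, `|weight_between N (cluster_set sigma a) (cluster_set sigma b)
                 - l%:R * (pi 0 a * p a b)| <= eps * l%:R) ->
  forall x y, sigma x != sigma y ->
  4 * delta ^+ 2 * D ^+ 4 / n%:R <=
    nsq (row x (block_mean sigma N) - row y (block_mean sigma N)) +
    nsq (row x (block_mean sigma N)^T - row y (block_mean sigma N)^T).
Proof.
move=> n0 D0 lE d0 k0 hV q01 hdist hal he hN x y /hdist[k].
have nR : 0 < n%:R :> R by rewrite ltr0n.
have VR a : 0 < #|cluster_set sigma a|%:R :> R.
  by rewrite -(pmulr_rgt0 _ k0); exact: lt_le_trans (hV a).
have cl0 a : (0 < #|cluster_set sigma a|)%N by rewrite -(ltr0n R).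
have lR : 0 < l%:R :> R by rewrite -lE mulr_gt0 ?exprn_gt0.
have tri (r1 r2 q1 q2 : R) : `|r1 - q1| <= delta -> `|r2 - q2| <= delta ->
    4 * delta <= `|q1 - q2| -> 2 * delta <= `|r1 - r2|.
  move=> h1 h2 h; have e : q1 - q2 = (r1 - r2) - (r1 - q1) + (r2 - q2) by ring.
  have := ler_normD ((r1 - r2) - (r1 - q1)) (r2 - q2); rewrite -e.
  have := ler_normB (r1 - r2) (r1 - q1); lra.
have approx a b c : `|weight_between N (cluster_set sigma a) (cluster_set sigma b) /
    (#|cluster_set sigma c|%:R * D ^+ 2) - pi 0 a * p a b / alpha 0 c| <= delta.
  exact: (ratio_approx nR (VR c) lR D0 lE (hV c)).
have -> : 4 * delta ^+ 2 = (2 * delta) ^+ 2 by ring.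
have d2 : 0 <= 2 * delta by rewrite mulr_ge0 // ltW.
case=> h.
  have := block_mean_row_separation (N := N) (x := x) (y := y) (k := k) n0 D0 d2 cl0
    (tri _ _ _ _ (approx _ _ _) (approx _ _ _) h).
  by move=> hs; apply: le_trans hs _; rewrite lerDl nsq_ge0.
rewrite block_mean_tr.
have /= := block_mean_row_separation (N := N^T) (x := x) (y := y) (k := k) n0 D0 d2 cl0.
rewrite !weight_between_tr => /(_ (tri _ _ _ _ (approx _ _ _) (approx _ _ _) h)) hs.
by apply: le_trans hs _; rewrite lerDr nsq_ge0.
Qed.

End Separation.

(** * The deterministic conclusion on good trajectories *)

Section GoodTrajectories.
Context {R : realType}.

(** The constant of [trimmed_op_le] at [C1 = 6 * kappa ^+ 2 + 5], [C2 = expR (4 * kappa ^+ 2)],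
    [C3 = 24], [CL = kappa ^+ 2 + 296]. In [C1], 5 replaces the 4 of the degree tail to pay for the
    extra exit in [path_out_le_in]. *)
Definition op_const (kappa : R) : R :=
  2 * (kappa ^+ 2 + 296 + (2 * (6 * kappa ^+ 2 + 5) +
    32 * (16 * expR (4 * kappa ^+ 2) + 40 * 24 + 2 * expR 1)) + kappa ^+ 2) +
  2 * kappa ^+ 2.

Definition good_counts n K (sigma : 'I_n -> 'I_K) (q : 'M[R]_K) (l : nat)
    (D kappa eps : R) (N : 'M[R]_n) : Prop :=
  [/\ ~~ light_event sigma D kappa N,
      discrepancy N D (expR (4 * kappa ^+ 2)) 24 /\
      discrepancy N^T D (expR (4 * kappa ^+ 2)) 24,
      #|[set y | (6 * kappa ^+ 2 + 4) * D ^+ 2 <= \sum_a N a y]%SET|%:R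
        <= n%:R * expR (- D ^+ 2) &
      forall a b, `|weight_between N (cluster_set sigma a) (cluster_set sigma b)
                    - l%:R * q a b| <= eps * l%:R].

(** A state outside [G] with column sum above [c] would force all of [G] to reach [c], giving
    [#|G|.+1] such states; since [#|G|] is the integer part of [n * expR (- D ^+ 2)], that is too
    many. *)
Lemma most_visited_degree n (l : nat) (N : 'M[R]_n) (G : {set 'I_n}) (D c : R) :
  (0 < n)%N -> n%:R * D ^+ 2 = l%:R -> most_visited l N G ->
  #|[set y | c <= \sum_a N a y]%SET|%:R <= n%:R * expR (- D ^+ 2) ->
  #|G|%:R <= n%:R * expR (- D ^+ 2) /\ forall y, y \notin G -> \sum_a N a y <= c.
Proof.
move=> n0 lE [cG hG] hc; have nR : 0 < n%:R :> R by rewrite ltr0n.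
have dE : l%:R / n%:R = D ^+ 2 by rewrite -lE mulrAC divff ?mul1r // lt0r_neq0.
rewrite dE in cG; split.
  by rewrite cG truncn_le mulr_ge0 ?expR_ge0.
move=> y yG; rewrite leNgt; apply/negP => hy.
have : (#|G|.+1 <= #|[set y | (c <= \sum_a N a y)%R]%SET|)%N.
  have -> : #|G|.+1 = #|y |: G| by rewrite cardsU1 yG.
  apply: subset_leq_card; apply/fintype.subsetP => z; rewrite !inE => /orP[/eqP ->|zG].
    exact: ltW.
  by apply: le_trans (ltW hy) _; exact: hG.
rewrite -(ler_nat R) => h; have := le_trans h hc.
by rewrite leNgt cG truncnS_gt.
Qed.

Lemma estimated_clusters_good n K (sigma : 'I_n -> 'I_K) (alpha pi : 'rV[R]_K)
    (p : 'M[R]_K) (l : nat) (D kappa eps delta gamma h rho : R)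
    (X : nat -> nat) (x : 'I_n) (s : seq 'I_n) (m : nat) :
  (0 < K)%N -> (0 < n)%N -> 1 <= D -> n%:R * D ^+ 2 = l%:R -> 1 <= kappa ->
  (forall a, n%:R <= kappa * #|cluster_set sigma a|%:R) ->
  (forall a b, 0 <= pi 0 a * p a b <= 1) ->
  0 < delta -> distinguishable alpha pi p (4 * delta) ->
  (forall a, `|n%:R / #|cluster_set sigma a|%:R - (alpha 0 a)^-1| <= delta / 2) ->
  eps * kappa <= delta / 2 ->
  0 < h -> op_const kappa * D < gamma ->
  16 * kappa * (gamma ^+ 2 + (op_const kappa * D) ^+ 2) / n%:R + 10 * h ^+ 2
    < 4 * delta ^+ 2 * D ^+ 4 / n%:R ->
  16 * K%:R * (op_const kappa * D) ^+ 2 / h ^+ 2 < rho ->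
  rho + 8 * K%:R * (op_const kappa * D) ^+ 2 / h ^+ 2 <= n%:R / kappa ->
  size s = l -> (forall t, (t <= l)%N -> X t = nth x (x :: s) t) ->
  good_counts sigma (\matrix_(a, b) (pi 0 a * p a b)) l D kappa eps (path_count x s) ->
  estimated_clusters n l gamma h rho X m -> m = K.
Proof.
move=> K0 n0 D1 lE k1 hV q01 d0 hdist hal he h0 hgam hsep hrho1 hrho2 sl hX.
have k0 : 0 < kappa by lra.
have D0 : 0 < D by lra.
set N := path_count x s => -[nlight [disc discT] hdeg hlln] [G [U [sv [V /=]]]].
have -> : count_mx n l X = N by rewrite -sl; apply: count_mx_path; rewrite sl.
move=> [hG hsvd hout].
have [G1 G2] := most_visited_degree n0 lE hG hdeg.
have D2 : 1 <= D ^+ 2 by rewrite expr_ge1 // ltW.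
have k2 : 0 <= kappa ^+ 2 by rewrite sqr_ge0.
have N0 a b : 0 <= N a b by exact: path_count_ge0.
have CL0 : 0 <= kappa ^+ 2 + 296 by lra.
have Nt : \sum_a \sum_b N a b <= n%:R * D ^+ 2 by rewrite path_count_total sl lE.
have C10 : 0 <= 6 * kappa ^+ 2 + 5 by lra.
have C2e : expR 1 <= expR (4 * kappa ^+ 2).
  have k21 : 1 <= kappa ^+ 2 by rewrite expr_ge1 // ltW.
  by rewrite ler_expR; lra.
have C30 : 0 <= 24 :> R by [].
have light : forall g1 g2 : grid n, in_ball g1 -> in_ball g2 ->
    light_dev sigma D (grid_vec g1) (grid_vec g2) N <= (kappa ^+ 2 + 296) * D.
  move=> g1 g2 b1 b2; rewrite leNgt; apply/negP => /ltW hl; move/negP: nlight; apply.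
  by apply/existsP; exists (g1, g2); rewrite b1 b2.
have col y : y \notin G -> \sum_a N a y <= (6 * kappa ^+ 2 + 5) * D ^+ 2.
  move=> /G2 hy; apply: le_trans hy _; rewrite ler_wpM2r ?sqr_ge0 //; lra.
have row y : y \notin G -> \sum_b N y b <= (6 * kappa ^+ 2 + 5) * D ^+ 2.
  move=> /G2 hy; apply: le_trans (path_out_le_in x s y) _; rewrite -/N.
  move: hy; lra.
have [E1 E2] := trimmed_op_le n0 k0 hV D1 N0 Nt C10 C2e C30 light disc discT col row G1 CL0.
have c0 : 0 <= op_const kappa * D.
  rewrite mulr_ge0 ?(ltW D0) // /op_const; have := expR_ge0 (4 * kappa ^+ 2).
  have := expR_ge0 (1 : R); lra.
apply: (clustering_output_spectral K0 n0 hsvd _ E1 E2 c0 hgam h0 k0 hV _ hrho1 hrho2 hout).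
  exact: block_mean_cluster.
move=> y z yz; apply: lt_le_trans hsep _.
apply: (block_mean_separation n0 D0 lE d0 k0 hV q01 hdist hal he _ yz) => a b.
by have := hlln a b; rewrite mxE.
Qed.

End GoodTrajectories.

(** * Probability of good trajectories *)

Section GoodProbability.
Context {R : realType}.

Lemma expRN_le_inv (z : R) : 0 < z -> expR (- z) <= z^-1.
Proof.
move=> z0; rewrite expRN lef_pV2 ?posrE ?expR_gt0 //.
by apply: le_trans (expR_ge1Dx z); rewrite lerDr.
Qed.

(** All bad events have probability [O(1 / n)] except excessive degrees, which contribute
    [1 / D ^+ 2]. [C] is independent of [n], [sigma] and [l]; in its summand 3, light pairs count
    for 1 and discrepancy for 2. *)
Lemma good_counts_probability K (p : 'M[R]_K) (pi : 'rV[R]_K) (kappa eps : R) :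
  stochastic p -> irreducible_mx p -> stationary_distribution p pi ->
  0 < kappa -> 0 < eps ->
  exists2 C : R, 0 <= C & forall n (sigma : 'I_n -> 'I_K) (l : nat) (D : R),
    (0 < n)%N -> (forall a, n%:R <= kappa * #|cluster_set sigma a|%:R) ->
    1 <= D -> n%:R * D ^+ 2 = l%:R ->
    1 - (C / n%:R + (D ^+ 2)^-1) <=
      chain_prob sigma p pi l (fun x s => `[< good_counts sigma
        (\matrix_(a, b) (pi 0 a * p a b)) l D kappa eps (path_count x s) >]).
Proof.
move=> hp hirr hstat k0 e0; have [pi0 pi1 _] := hstat.
have [C hC] := choice (fun ab : 'I_K * 'I_K =>
  transition_count_lln ab.1 ab.2 hp hirr hstat).
pose C' := 3 + \sum_ab `|C ab| / eps ^+ 2.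
have S0 : 0 <= \sum_ab `|C ab| / eps ^+ 2.
  by apply: sumr_ge0 => ab _; rewrite divr_ge0 ?sqr_ge0.
exists C' => [|n sigma l D n0 hV D1 lE]; first by rewrite addr_ge0.
have nR : 0 < n%:R :> R by rewrite ltr0n.
have D0 : 0 < D by exact: lt_le_trans ltr01 D1.
have cl0 a : (0 < #|cluster_set sigma a|)%N by exact: cluster_nonempty n0 k0 hV a.
have D2 : 1 <= D ^+ 2 by rewrite expr_ge1 // ltW.
have nl : n%:R <= l%:R :> R by rewrite -lE ler_peMr ?ler0n.
have l0 : (0 < l)%N by rewrite -(ltr0n R); exact: lt_le_trans nl.
set prob := chain_prob sigma p pi l.
pose B1 (x : 'I_n) s := light_event sigma D kappa (path_count (R := R) x s).
pose B2 (x : 'I_n) s := ~~ `[< discrepancy (path_count x s) D (expR (4 * kappa ^+ 2)) 24 >]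
  || ~~ `[< discrepancy (path_count x s)^T D (expR (4 * kappa ^+ 2)) 24 >].
pose B3 (x : 'I_n) s := n%:R * expR (- D ^+ 2) <
  #|[set y | (6 * kappa ^+ 2 + 4) * D ^+ 2 <= \sum_a path_count x s a y]%SET|%:R.
pose B4 (ab : 'I_K * 'I_K) (x : 'I_n) s := eps * l%:R <=
  `|weight_between (path_count x s) (cluster_set sigma ab.1) (cluster_set sigma ab.2)
    - l%:R * (pi 0 ab.1 * p ab.1 ab.2)|.
set Gd := fun x s => `[< good_counts _ _ _ _ _ _ (path_count x s) >].
have h1 : prob B1 <= n%:R^-1.
  exact: le_trans (light_event_tail n0 hp pi0 pi1 k0 hV D1 lE) (expRN_le_inv nR).
have h2 : prob B2 <= 2 / n%:R by exact: discrepancy_tail.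
have h3 : prob B3 <= (D ^+ 2)^-1.
  apply: le_trans (high_degree_tail n0 hp pi0 pi1 k0 hV lE) (expRN_le_inv _).
  exact: lt_le_trans ltr01 D2.
have h4 : \sum_ab prob (B4 ab) <= (\sum_ab `|C ab| / eps ^+ 2) / n%:R.
  rewrite mulr_suml; apply: ler_sum => ab _.
  apply: le_trans (hC ab n sigma l eps cl0 l0 e0) _.
  apply: le_trans (_ : `|C ab| / (l%:R * eps ^+ 2) <= _).
    by rewrite ler_wpM2r ?ler_norm // invr_ge0 mulr_ge0 ?sqr_ge0.
  rewrite [l%:R * _]mulrC invfM mulrA ler_wpM2l ?divr_ge0 ?sqr_ge0 //.
  by rewrite lef_pV2 // posrE ltr0n.
have mu1 : \sum_x bmc_stationary sigma pi 0 x = 1 by apply: bmc_stationary_sum1.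
have P1 : stochastic (bmc_transition sigma p) by apply: bmc_transition_stochastic.
have cover : 1 <= prob Gd + (prob B1 + prob B2 + prob B3 + \sum_ab prob (B4 ab)).
  rewrite -[leLHS](chain_exp_cst l 1 mu1 P1) /prob /chain_prob -chain_exp_sum -!chain_expD.
  apply: chain_exp_le => [||x s].
  - exact: bmc_stationary_ge0.
  - exact: bmc_transition_ge0.
  have b0 (b : bool) : 0 <= b%:R :> R by [].
  have s0 : 0 <= \sum_ab (B4 ab x s)%:R :> R by apply: sumr_ge0.
  have [h|h] := boolP (Gd x s); first by rewrite lerDl !addr_ge0.
  have [b1|b1] := boolP (B1 x s).
    by have := b0 (B2 x s); have := b0 (B3 x s); rewrite mulr1n mulr0n; lra.
  have [b2|b2] := boolP (B2 x s).
    by have := b0 (B3 x s); rewrite mulr1n !mulr0n; lra.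
  have [b3|b3] := boolP (B3 x s); first by rewrite !add0r lerDl.
  rewrite !add0r; have [/existsP[ab hab]|hn] := boolP [exists ab, B4 ab x s].
    by rewrite (bigD1 ab) //= hab lerDl sumr_ge0.
  case/asboolP: h; split => //.
  - by move: b2; rewrite negb_or !negbK => /andP[/asboolP ? /asboolP ?].
  - by rewrite leNgt.
  - move=> a b; rewrite mxE leNgt; apply/negP => /ltW hab; move/negP: hn; apply.
    by apply/existsP; exists (a, b).
have : C' / n%:R = n%:R^-1 + 2 / n%:R + (\sum_ab `|C ab| / eps ^+ 2) / n%:R.
  by rewrite /C'; ring.
lra.
Qed.

End GoodProbability.

(** * Choice of the constants and passage to the limit *)

Theorem theorem3p3 (R : realType) (K : nat) (p : 'M[R]_K)
    (alpha pi : 'rV[R]_K) (sigma : forall n : nat, 'I_n -> 'I_K)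
    (ell : nat -> nat) (gamma h rho : nat -> R)
    (d : nat -> measure_display) (Omega : forall n : nat, measurableType (d n))
    (Pr : forall n : nat, probability (Omega n) R)
    (X : forall n : nat, nat -> {RV (Pr n) >-> nat})
    (Khat : forall n : nat, {RV (Pr n) >-> nat}) :
  (0 < K)%N ->
  stochastic p ->
  irreducible_mx p ->
  stationary_distribution p pi ->
  \sum_k alpha 0 k = 1 ->
  (forall k, 0 < alpha 0 k) ->
  (0 < information alpha pi p)%E ->
  (\forall n \near \oo, forall k : 'I_K, exists x : 'I_n, sigma n x = k) ->
  (forall k : 'I_K,
     (#|cluster_set (sigma n) k|%:R / n%:R : R) @[n --> \oo] --> alpha 0 k) ->
  (\forall n \near \oo,
     is_markov_chain (Pr n) (bmc_stationary (sigma n) pi)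
       (bmc_transition (sigma n) p) (fun t => X n t)) ->
  (forall n, (0 < ell n)%N) ->
  is_omega (fun n => (ell n)%:R : R) (fun n => n%:R) ->
  (forall n, [/\ 0 < gamma n, 0 < h n & 0 < rho n]) ->
  is_omega gamma (fun n => Num.sqrt ((ell n)%:R / n%:R)) ->
  is_o gamma (fun n => (ell n)%:R / n%:R) ->
  is_omega (fun n => n%:R * h n ^+ 2) (fun n => (ell n)%:R / n%:R) ->
  is_o (fun n => n%:R * h n ^+ 2) (fun n => ((ell n)%:R / n%:R) ^+ 2) ->
  is_omega rho (fun n => ((ell n)%:R / n%:R) / h n ^+ 2) ->
  is_o rho (fun n => n%:R) ->
  (\forall n \near \oo, forall w : Omega n,
     estimated_clusters n (ell n) (gamma n) (h n) (rho n) (fun t => X n t w)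
       (Khat n w)) ->
  Pr n [set w | Khat n w = K] @[n --> \oo] --> 1%E.
Proof.
move=> K0 hp hirr hstat alpha1 alpha0 hI _ hsize hchain ell0 hell hpos hgam1 hgam2 _ hh2 hrho1 hrho2 hest.
have [delta4 delta40 hdist4] := information_gt0_distinguishable hp alpha0 hI.
pose delta := delta4 / 4.
have delta0 : 0 < delta by rewrite divr_gt0.
have hdist : distinguishable alpha pi p (4 * delta).
  by rewrite /delta mulrC divfK.
(* Eventually each cluster has at least [alpha 0 a * n / 2] elements, so [kappa] has to dominate
   every [2 / alpha 0 a]. *)
pose kappa := 1 + \sum_k 2 / alpha 0 k.
have kS a : 2 / alpha 0 a <= kappa.
  have pos k : 0 <= 2 / alpha 0 k by rewrite divr_ge0 // ltW.
  rewrite /kappa (bigD1 a) //= addrCA lerDl addr_ge0 // sumr_ge0 //.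
have k1 : 1 <= kappa by rewrite lerDl sumr_ge0 // => k _; rewrite divr_ge0 // ltW.
have k0 : 0 < kappa by exact: lt_le_trans ltr01 k1.
pose eps := delta / (2 * kappa).
have eps0 : 0 < eps by rewrite divr_gt0 ?mulr_gt0.
have hek : eps * kappa <= delta / 2.
  by rewrite le_eqVlt; apply/orP; left; apply/eqP; rewrite /eps; field; rewrite lt0r_neq0.
have [pi0 pi1 _] := hstat; have [p0 p1] := hp.
have q01 a b : 0 <= pi 0 a * p a b <= 1.
  rewrite mulr_ge0 //= mulr_ile1 //.
    by rewrite -pi1 (bigD1 a) //= lerDl sumr_ge0.
  by rewrite -(p1 a) (bigD1 b) //= lerDl sumr_ge0.
have [C C0 hC] := good_counts_probability hp hirr hstat k0 eps0.
pose c := op_const kappa.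
have c0 : 0 < c.
  rewrite /c /op_const; have := expR_gt0 (4 * kappa ^+ 2); have := expR_gt0 (1 : R).
  have := sqr_ge0 kappa; lra.
pose D n := Num.sqrt ((ell n)%:R / n%:R) : R.
have D2 n : D n ^+ 2 = (ell n)%:R / n%:R by rewrite sqr_sqrtr // divr_ge0.
have Dinf A : \forall n \near \oo, A <= D n ^+ 2.
  by apply: filterS ((cvgryPge _).1 hell A) => n; rewrite D2.
have ninf A : \forall n \near \oo, A <= n%:R :> R by exact: (cvgryPge _).1 cvgr_idn A.
have Vclose a e : 0 < e -> \forall n \near \oo,
    `|alpha 0 a - #|cluster_set (sigma n) a|%:R / n%:R| <= e.
  by move=> e0; exact: (cvgrPdist_le _ _).1 (hsize a) e e0.
have Vlarge : \forall n \near \oo, forall a, n%:R <= kappa * #|cluster_set (sigma n) a|%:R.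
  apply: filter_forall => a.
  have ha : 0 < alpha 0 a / 2 by rewrite divr_gt0.
  near=> n.
  have n0 : 0 < n%:R :> R by apply: lt_le_trans ltr01 _; near: n; exact: ninf.
  have : `|alpha 0 a - #|cluster_set (sigma n) a|%:R / n%:R| <= alpha 0 a / 2.
    by near: n; exact: Vclose.
  set v := #|_|%:R; rewrite ler_norml => /andP[_ hv].
  have hv' : alpha 0 a / 2 * n%:R <= v by rewrite -ler_pdivlMr //; lra.
  apply: le_trans (ler_wpM2r (ler0n _ _) (kS a)); rewrite -/v.
  rewrite mulrAC ler_pdivlMr //; move: hv'; lra.
have Vinv : \forall n \near \oo, forall a,
    `|n%:R / #|cluster_set (sigma n) a|%:R - (alpha 0 a)^-1| <= delta / 2.
  apply: filter_forall => a; have an0 : alpha 0 a != 0 by rewrite lt0r_neq0.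
  have d20 : 0 < delta / 2 by rewrite divr_gt0.
  apply: filterS ((cvgrPdist_le _ _).1 (cvgV an0 (hsize a)) _ d20) => n.
  by rewrite distrC /= invf_div.
have gamS : \forall n \near \oo, c * D n < gamma n.
  apply: filterS2 ((cvgryPge _).1 hgam1 (c + 1)) (Dinf 1) => n h1 D1.
  have Dn0 : 0 < D n by rewrite lt_def sqrtr_ge0 andbT; apply: contraTneq D1 => ->; rewrite expr0n /= ler10.
  move: h1; rewrite -/(D n) ler_pdivlMr // => h1; apply: lt_le_trans h1.
  by rewrite ltr_pM2r // ltrDl.
(* The separation [4 * delta ^+ 2 * D ^+ 4 / n] is split into four equal parts: one each for
   [gamma], for the perturbation [c * D] and for [h], and one that makes the inequality strict.
   [tau] is the share of [gamma]. *)
pose tau := delta ^+ 2 / (16 * kappa).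
have tau0 : 0 < tau by rewrite divr_gt0 ?exprn_gt0 ?mulr_gt0.
pose tau1 := Num.min 1 tau.
have tau10 : 0 < tau1 by rewrite lt_min ltr01.
have tau12 : tau1 ^+ 2 <= tau.
  apply: le_trans (_ : tau1 <= _); last by rewrite ge_min lexx orbT.
  by rewrite expr2 ler_piMl ?(ltW tau10) // ge_min lexx.
have gamB : \forall n \near \oo, gamma n ^+ 2 <= tau * D n ^+ 4.
  apply: filterS2 ((cvgr0Pnorm_le _).1 hgam2 _ tau10) (Dinf 1) => n h1 D1.
  have [g0 _ _] := hpos n; have D20 : 0 < D n ^+ 2 by exact: lt_le_trans ltr01 D1.
  move: h1; rewrite -D2 ger0_norm; last by rewrite divr_ge0 // ltW.
  rewrite ler_pdivrMr // => h1.
  apply: le_trans (_ : (tau1 * D n ^+ 2) ^+ 2 <= _).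
    have td0 : 0 <= tau1 * D n ^+ 2 by apply: mulr_ge0; exact: ltW.
    by rewrite ler_sqr ?nnegrE ?(ltW g0).
  by rewrite exprMn -exprM ler_wpM2r // exprn_ge0 // sqrtr_ge0.
have hB : \forall n \near \oo, n%:R * h n ^+ 2 <= delta ^+ 2 / 10 * D n ^+ 4.
  have t0 : 0 < delta ^+ 2 / 10 by rewrite divr_gt0 // exprn_gt0.
  apply: filterS2 ((cvgr0Pnorm_le _).1 hh2 _ t0) (Dinf 1) => n h1 D1.
  have D20 : 0 < D n ^+ 2 by exact: lt_le_trans ltr01 D1.
  have D40 : 0 < D n ^+ 4 by rewrite (_ : 4 = 2 * 2)%N // exprM exprn_gt0.
  move: h1; rewrite -D2 -exprM (_ : (2 * 2)%N = 4%N) // ger0_norm; first by rewrite ler_pdivrMr.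
  by apply: divr_ge0; rewrite ?(ltW D40) // mulr_ge0 ?sqr_ge0.
have rhoL : \forall n \near \oo, 16 * K%:R * (c * D n) ^+ 2 / h n ^+ 2 < rho n.
  apply: filterS2 ((cvgryPge _).1 hrho1 (16 * K%:R * c ^+ 2 + 1)) (Dinf 1) => n h1 D1.
  have [_ h0 _] := hpos n; have D20 : 0 < D n ^+ 2 by exact: lt_le_trans ltr01 D1.
  have q0 : 0 < D n ^+ 2 / h n ^+ 2 by rewrite divr_gt0 // exprn_gt0.
  move: h1; rewrite -D2 ler_pdivlMr // => h1; apply: lt_le_trans h1.
  have -> : 16 * K%:R * (c * D n) ^+ 2 / h n ^+ 2 = 16 * K%:R * c ^+ 2 * (D n ^+ 2 / h n ^+ 2) by ring.
  by rewrite [ltRHS]mulrDl mul1r ltrDl.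
(* The factor 2 leaves room in the smallest cluster for [rho] and for the misplaced rows, whose
   bound is below [rho / 2] by [rhoL]. *)
have rhoU : \forall n \near \oo, rho n * (2 * kappa) <= n%:R.
  have t0 : 0 < (2 * kappa)^-1 by rewrite invr_gt0 mulr_gt0.
  apply: filterS2 ((cvgr0Pnorm_le _).1 hrho2 _ t0) (ninf 1) => n h1 n1.
  have n0 : 0 < n%:R :> R by exact: lt_le_trans ltr01 n1.
  have [_ _ r0] := hpos n.
  move: h1; rewrite ger0_norm ?divr_ge0 ?(ltW r0) //.
  by rewrite ler_pdivrMr // mulrC ler_pdivlMr ?mulr_gt0.
pose A n := [set w | Khat n w = K].
have mA n : measurable (A n).
  by rewrite (_ : A n = Khat n @^-1` [set K]) //; exact: measurable_funPTI.
have main e : 0 < e -> \forall n \near \oo, ((1 - e)%:E <= Pr n (A n))%E.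
  move=> e0; near=> n.
  have n1 : 1 <= n%:R :> R by near: n; exact: ninf.
  have n0 : (0 < n)%N by rewrite -(ltr0n R); exact: lt_le_trans ltr01 n1.
  have D1 : 1 <= D n.
    by rewrite -(@expr_ge1 _ 2) ?sqrtr_ge0 //; near: n; exact: Dinf.
  have lE : n%:R * D n ^+ 2 = (ell n)%:R.
    by rewrite D2 mulrC divfK // pnatr_eq0 -lt0n.
  have hV : forall a, n%:R <= kappa * #|cluster_set (sigma n) a|%:R by near: n.
  apply: le_trans (_ : ((1 - (C / n%:R + (D n ^+ 2)^-1))%:E <= _)%E).
    have D20 : 0 < D n ^+ 2 by rewrite exprn_gt0 // (lt_le_trans ltr01).
    have nR : 0 < n%:R :> R by rewrite ltr0n.
    have hn : 2 * C / e <= n%:R by near: n; exact: ninf.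
    have hD : 2 / e <= D n ^+ 2 by near: n; exact: Dinf.
    rewrite lee_fin lerD2l lerN2.
    have b1 : C / n%:R <= e / 2 by rewrite ler_pdivrMr //; move: hn; rewrite ler_pdivrMr //; lra.
    have b2 : (D n ^+ 2)^-1 <= e / 2.
      by rewrite -[_^-1]mul1r ler_pdivrMr //; move: hD; rewrite ler_pdivrMr //; lra.
    lra.
  apply: le_trans (_ : ((chain_prob (sigma n) p pi (ell n) (fun x s => `[< good_counts (sigma n)
      (\matrix_(a, b) (pi 0 a * p a b)) (ell n) (D n) kappa eps (path_count x s) >]))%:E <= _)%E).
    by rewrite lee_fin; exact: hC.
  have hch : is_markov_chain (Pr n) (bmc_stationary (sigma n) pi)
      (bmc_transition (sigma n) p) (fun t => X n t) by near: n.
  apply: (chain_prob_le_probability _ hch (mA n)).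
    by move=> t k; exact: (measurable_funPTI (X n t) (Y := [set k])).
  move=> x s w sl hX /asboolP hgood.
  have [g0 h0 r0] := hpos n.
  have D20 : 1 <= D n ^+ 2 by rewrite expr_ge1 // (le_trans ler01).
  have hgam : c * D n < gamma n by near: n.
  have hrL : 16 * K%:R * (c * D n) ^+ 2 / h n ^+ 2 < rho n by near: n.
  have hest' : forall w : Omega n, estimated_clusters n (ell n) (gamma n) (h n) (rho n)
      (fun t => X n t w) (Khat n w) by near: n.
  apply: (estimated_clusters_good (D := D n) K0 n0 D1 lE k1 hV q01 delta0 hdist _ hek h0
    hgam _ hrL _ sl _ hgood (hest' w)).
  - by near: n.
  - have nR : 0 < n%:R :> R by rewrite ltr0n.
    have D4 : D n ^+ 4 = D n ^+ 2 * D n ^+ 2 by rewrite -exprD.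
    have D40 : 0 < D n ^+ 4 by rewrite D4 mulr_gt0 // (lt_le_trans ltr01).
    have G2 : gamma n ^+ 2 <= tau * D n ^+ 4 by near: n.
    have H2 : n%:R * h n ^+ 2 <= delta ^+ 2 / 10 * D n ^+ 4 by near: n.
    have DD : 16 * kappa * c ^+ 2 / delta ^+ 2 <= D n ^+ 2 by near: n; exact: Dinf.
    rewrite -/c ltr_pdivlMr // mulrDl divfK ?lt0r_neq0 //.
    have t1 : 16 * kappa * gamma n ^+ 2 <= delta ^+ 2 * D n ^+ 4.
      apply: le_trans (_ : 16 * kappa * (tau * D n ^+ 4) <= _); first by rewrite ler_wpM2l // mulr_ge0 // ltW.
      by rewrite le_eqVlt; apply/orP; left; apply/eqP; rewrite /tau; field; rewrite lt0r_neq0.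
    have t2 : 16 * kappa * (c * D n) ^+ 2 <= delta ^+ 2 * D n ^+ 4.
      move: DD; rewrite ler_pdivrMr ?exprn_gt0 // => DD.
      have -> : 16 * kappa * (c * D n) ^+ 2 = 16 * kappa * c ^+ 2 * D n ^+ 2 by ring.
      have -> : delta ^+ 2 * D n ^+ 4 = D n ^+ 2 * delta ^+ 2 * D n ^+ 2 by ring.
      by rewrite ler_wpM2r ?sqr_ge0.
    have t3 : 0 < delta ^+ 2 * D n ^+ 4 by rewrite mulr_gt0 // exprn_gt0.
    lra.
  - have r2 : rho n * (2 * kappa) <= n%:R by near: n.
    rewrite -/c ler_pdivlMr //; move: hrL r2.
    have -> : 16 * K%:R * (c * D n) ^+ 2 / h n ^+ 2 = 2 * (8 * K%:R * (c * D n) ^+ 2 / h n ^+ 2) by ring.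
    set z := 8 * K%:R * (c * D n) ^+ 2 / h n ^+ 2 => hz r2.
    apply: le_trans r2; rewrite mulrDl.
    have : z * kappa <= rho n / 2 * kappa by rewrite ler_wpM2r ?(ltW k0) //; lra.
    have : 0 < rho n * kappa by rewrite mulr_gt0.
    lra.
  - by move=> t ht; apply: hX; rewrite sl.
apply: cvg_EFin.
  by near=> n; exact: fin_num_measure.
apply/cvgrPdist_le => e e0; apply: filterS (main e e0) => n /= hA.
have h1 := probability_le1 (Pr n) (mA n).
rewrite -[Pr n _]fineK ?fin_num_measure // in hA h1.
rewrite !lee_fin in hA h1; rewrite ger0_norm ?subr_ge0 //; move: hA; rewrite /A; lra.
Unshelve. all: by end_near.
Qed.
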